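(* Let $1<p<Q$, let $f\in L^m(\Omega)$ with $m>\frac{Q}{p}$, and let $u\in W^{1,p}_0(\Omega,X)$ be a weak solution to $$X^*a(x,u,Xu)=f(x)\ \text{ in }\Omega,\qquad u=0\ \text{ on }\partial\Omega.$$ Then $u\in L^\infty(\Omega)$ and there exists a constant $C=C(Q,p,\Omega,\alpha,m,X)$ such that $$\|u\|_{L^\infty(\Omega)}\leq C\,\|f\|_{L^m(\Omega)}^{\frac1{p-1}}.$$
   Context: Setting. $\Omega$ is a bounded open subset of $\mathbb{R}^N$, $N\geq2$. $X=\{X_1,\dots,X_d\}$, $d\geq2$, is a family of locally Lipschitz-continuous vector fields on $\mathbb{R}^N$, $X_j=(c_{j1},\dots,c_{jN})$, identified with the operators $X_j=\sum_{k=1}^N c_{jk}\partial_{x_k}$. For a $C^1$ function $u$, the $X$-gradient is $Xu=(X_1u,\dots,X_du)=C(x)\nabla u$ with $C(x)=(c_{jk}(x))$. Geometric standing assumptions. An absolutely continuous path $\gamma:[0,T]\to\mathbb{R}^N$ is $X$-subunit if $\dot\gamma(t)=\sum_{j=1}^d\theta_j(t)X_j(\gamma(t))$ with $\sum_{j=1}^d\theta_j^2(t)\leq1$ for a.e. $t\in[0,T]$. Any two points are assumed to be connected by an $X$-subunit path, and the Carnot–Carathéodory (control) distance $\delta(x,y)$ is the infimum of the $T>0$ for which there is an $X$-subunit path $\gamma:[0,T]\to\mathbb{R}^N$ with $\gamma(0)=x$, $\gamma(T)=y$. $B_r$ denotes a $\delta$-ball of radius $r$; $B_{\lambda r}$ is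 the concentric ball of radius $\lambda r$; $|E|$ is the Lebesgue measure of $E$. It is assumed that: (1) $|y-x|\to0$ if and only if $\delta(x,y)\to0$; (2) (doubling) there is a constant $Q$, which is fixed and taken $>2$ (as one may, without loss of generality), such that $0<|B_{2r}|\leq2^Q|B_r|$ for every $\delta$-ball $B_r$; (3) (Poincaré) there are constants $C_P,\nu>0$ such that for every $\delta$-ball $B_r$ and every $u\in C^1(\overline{B_{\nu r}})$, $\frac1{|B_r|}\int_{B_r}|u-u_r|\,dx\leq C_P\,r\,\frac{1}{|B_{\nu r}|}\int_{B_{\nu r}}|Xu|\,dx$, where $u_r=\frac1{|B_r|}\int_{B_r}u\,dx$. Function space. $W^{1,p}_0(\Omega,X)$ is the closure of $C_c^\infty(\Omega)$ under the norm $\|u\|_{W^{1,p}_0(\Omega,X)}=\|Xu\|_{L^p(\Omega)}$; for $u$ in this space, $Xu\in (L^p(\Omega))^d$ is the $L^p$-limit of $X\varphi_n$ for any sequence $\varphi_n\in C_c^\infty(\Omega)$ converging to $u$. $X^*$ is the formal adjoint: $\langle X^*F,\varphi\rangle=\int_\Omega F\cdot X\varphi\,dx$. $p'=p/(p-1)$. Operator. $a:\Omega\times\mathbb{R}\times\mathbb{R}^d\to\mathbb{R}^d$ is a Carathéodory function (measurable in $x$, continuous in $(s,\xi)$ for a.e. $x$) such that for a.e. $x\in\Omega$, every $s\in\mathbb{R}$ and every $\xi\neq\eta\in\mathbb{R}^d$: $a(x,s,\xi)\cdot\xi\geq\alpha|\xi|^p$; $|a(x,s,\xi)|\leq\beta(h(x)+|s|^{p-1}+|\xi|^{p-1})$;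 $[a(x,s,\xi)-a(x,s,\eta)]\cdot(\xi-\eta)>0$; where $\alpha,\beta>0$ are constants and $h\in L^{p'}(\Omega)$. Weak solution: $u\in W^{1,p}_0(\Omega,X)$ with $\int_\Omega a(x,u,Xu)\cdot Xv\,dx=\int_\Omega f\,v\,dx$ for all $v\in W^{1,p}_0(\Omega,X)$. The notation $C=C(Q,p,\Omega,\alpha,m,X)$ means that $C$ depends only on the listed data (in particular not on $f$ or $u$); the dependence on $\Omega$ and $X$ is through the constant $\mathcal{S}_p$ in the Sobolev inequality $\|w\|_{L^{p^*}(\Omega)}\leq\mathcal{S}_p\|Xw\|_{L^p(\Omega)}$ for $w\in W^{1,p}_0(\Omega,X)$, $p^*=\frac{pQ}{Q-p}$. *)

(* Defs.v *)
From HB Require Import structures.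
From mathcomp Require Import all_boot all_order all_algebra.
From mathcomp Require Import all_classical all_reals all_analysis.

Set Implicit Arguments.
Unset Strict Implicit.
Unset Printing Implicit Defensive.

Import Order.TTheory GRing.Theory Num.Theory.
Import numFieldNormedType.Exports.

Local Open Scope classical_set_scope.
Local Open Scope ring_scope.

(* Lebesgue measure on R^N (points are row vectors): the outer measure given
   by countable covers by boxes, restricted to the Caratheodory measurable
   sets.  The sigma-algebra is thus the complete Lebesgue one. *)
Section lebesgue_outer_measure.
Variables (R : realType) (N : nat).
Implicit Types (a b : 'rV[R]_N) (A : set 'rV[R]_N).

Definition box a b : set 'rV[R]_N :=
  [set x | forall i, a ord0 i < x ord0 i <= b ord0 i].

Definition box_volume a b : R :=
  \prod_(i < N) Num.max 0 (b ord0 i - a ord0 i).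

Lemma box_volume_ge0 a b : 0 <= box_volume a b.
Proof. by apply: prodr_ge0 => i _; rewrite le_max lexx. Qed.

(* The index set D allows finite and empty covers. *)
Definition lebesgue_outer A : \bar R :=
  ereal_inf [set s | exists (D : set nat) (a b : nat -> 'rV[R]_N),
    A `<=` \bigcup_(k in D) box (a k) (b k) /\
    s = (\esum_(k in D) (box_volume (a k) (b k))%:E)%E].

Local Open Scope ereal_scope.

Lemma lebesgue_outer_ge0 A : 0 <= lebesgue_outer A.
Proof.
apply: le_ereal_inf_tmp => _ [D [a [b [_ ->]]]].
by apply: esum_ge0 => k _; rewrite lee_fin box_volume_ge0.
Qed.

Lemma lebesgue_outer0 : lebesgue_outer set0 = 0.
Proof.
apply/eqP; rewrite eq_le lebesgue_outer_ge0 andbT.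
apply: ereal_inf_lbound; exists set0, (fun=> 0%R), (fun=> 0%R).
by split; [exact: sub0set | rewrite esum_set0].
Qed.

Lemma le_lebesgue_outer :
  {homo lebesgue_outer : A B / A `<=` B >-> A <= B}.
Proof.
move=> A B AB; apply/ereal_inf_le_tmp => _ [D [a [b [BD ->]]]].
by exists D, a, b; split=> //; exact: subset_trans AB BD.
Qed.

Lemma lebesgue_outer_sigma_subadditive : sigma_subadditive lebesgue_outer.
Proof.
move=> A; have [[i ioo]|] := pselect (exists i, lebesgue_outer (A i) = +oo).
  rewrite (eseries_pinfty _ _ ioo) ?leey// => n _.
  by rewrite -ltNye (lt_le_trans _ (lebesgue_outer_ge0 _)).
rewrite -forallNE => Aoo.
apply/lee_addgt0Pr => _/posnumP[e].
rewrite (le_trans _ (epsilon_trick _ _ _))//; last first.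
  by move=> n; exact: lebesgue_outer_ge0.
pose P n (F : set nat * ((nat -> 'rV[R]_N) * (nat -> 'rV[R]_N))) :=
  A n `<=` \bigcup_(k in F.1) box (F.2.1 k) (F.2.2 k) /\
  \esum_(k in F.1) (box_volume (F.2.1 k) (F.2.2 k))%:E <=
    lebesgue_outer (A n) + (e%:num / (2 ^ n.+1)%:R)%:E.
have [G PG] : {G & forall n, P n (G n)}.
  apply: (@choice _ _ P) => n.
  have fA : lebesgue_outer (A n) \is a fin_num.
    by rewrite ge0_fin_numE ?lebesgue_outer_ge0// ltey; apply/eqP/Aoo.
  have en1 : (0 < e%:num / (2 ^ n.+1)%:R)%R by [].
  have [_ [D [a [b [AD ->]]]] Dlt] := lb_ereal_inf_adherent en1 fA.
  by exists (D, (a, b)); split=> //=; exact/ltW.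
pose v (x : nat * nat) : \bar R :=
  (box_volume ((G x.1).2.1 x.2) ((G x.1).2.2 x.2))%:E.
have v0 x : 0 <= v x by rewrite lee_fin box_volume_ge0.
have /card_esym/ppcard_eqP[f] := card_nat2.
pose K : set (nat * nat) := [set x | (G x.1).1 x.2].
pose D : set nat := [set k | K (f k)].
apply: (@le_trans _ _ (\esum_(x in K) v x)).
  apply: ereal_inf_lbound.
  exists D, (fun k => (G (f k).1).2.1 (f k).2),
    (fun k => (G (f k).1).2.2 (f k).2); split.
    move=> x [n _ /(PG n).1 [k Gk xk]]; exists (f^-1%FUN (n, k)).
      by rewrite /D /= invK ?inE.
    by rewrite invK ?inE.
  rewrite (reindex_esum D K f) //; split=> //.
    by move=> i j _ _; apply: inj; rewrite in_setT.
  by move=> x Kx; exists (f^-1%FUN x); rewrite /D/= invK ?inE.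
have -> : \esum_(x in K) v x = \sum_(i <oo) \esum_(k in (G i).1) v (i, k).
  rewrite nneseries_esumT => [|n]; last exact: esum_ge0.
  by rewrite esum_esum//; congr esum; apply/seteqP; split=> -[i j]//= [].
apply: lee_nneseries => [n _ _|n _]; first exact: esum_ge0.
exact: (PG n).2.
Qed.

HB.instance Definition _ := isOuterMeasure.Build R 'rV[R]_N lebesgue_outer
  lebesgue_outer0 lebesgue_outer_ge0 le_lebesgue_outer
  lebesgue_outer_sigma_subadditive.

HB.instance Definition _ := @isMeasurable.Build
  (caratheodory_display lebesgue_outer) 'rV[R]_N
  lebesgue_outer.-caratheodory
  (caratheodory_measurable_set0 lebesgue_outer)
  (@caratheodory_measurable_setC _ _ lebesgue_outer)
  (@caratheodory_measurable_bigcup _ _ lebesgue_outer).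

Definition lebesgueN : set 'rV[R]_N -> \bar R := lebesgue_outer.

HB.instance Definition _ := isMeasure.Build _ 'rV[R]_N R lebesgueN
  (@caratheodory_measure0 _ _ lebesgue_outer)
  (@caratheodory_measure_ge0 _ _ lebesgue_outer)
  (@caratheodory_measure_sigma_additive _ _ lebesgue_outer).

End lebesgue_outer_measure.
Arguments lebesgueN {R N}.

Section carnot_caratheodory.
Variables (R : realType) (N d : nat).
Implicit Types (X : 'I_d -> 'rV[R]_N -> 'rV[R]_N).
Implicit Types (u v f h : 'rV[R]_N -> R) (G H : 'rV[R]_N -> 'rV[R]_d).
Implicit Types (x y : 'rV[R]_N) (Omega U : set 'rV[R]_N) (p r : R).

(* The library norm on row vectors is the sup norm; |xi| is Euclidean. *)
Definition dotv n (xi eta : 'rV[R]_n) : R :=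
  \sum_(i < n) xi ord0 i * eta ord0 i.
Definition enorm n (xi : 'rV[R]_n) : R := Num.sqrt (dotv xi xi).

Definition partial (k : 'I_N) u : 'rV[R]_N -> R :=
  fun x => 'D_(delta_mx ord0 k) u x.

Definition C1_on U u := forall k x, U x ->
  derivable u x (delta_mx ord0 k) /\ {for x, continuous (partial k u)}.

Definition smooth u := forall s : seq 'I_N, C1_on setT (foldr partial u s).

Definition test_function Omega u :=
  [/\ smooth u, compact (closure [set x | u x != 0])
    & closure [set x | u x != 0] `<=` Omega].

Definition Xgrad X u : 'rV[R]_N -> 'rV[R]_d :=
  fun x => \row_j \sum_(k < N) X j x ord0 k * partial k u x.

Definition locally_lipschitz (V W : normedModType R) (F : V -> W) :=
  forall x : V, exists2 U, nbhs x U & [lipschitz F y | y in U].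

Definition absolutely_continuous (gamma : R -> 'rV[R]_N) (a b : R) :=
  forall e : R, 0 < e -> exists2 dl : R, 0 < dl &
    forall n (s t : 'I_n -> R),
      (forall i, [/\ a <= s i, s i <= t i & t i <= b]) ->
      (forall i j : 'I_n, (i < j)%N -> t i <= s j) ->
      \sum_i (t i - s i) < dl ->
      \sum_i enorm (gamma (t i) - gamma (s i)) < e.

Definition subunit X (T : R) (gamma : R -> 'rV[R]_N) :=
  absolutely_continuous gamma 0 T /\
  exists theta : R -> 'I_d -> R,
    {ae (@lebesgue_measure R), forall t, 0 <= t <= T ->
      \sum_j theta t j ^+ 2 <= 1 /\
      is_derive t 1 gamma (\sum_j theta t j *: X j (gamma t))}.

Definition subunit_times X x y : set R :=
  [set T | 0 < T /\
    exists gamma, [/\ subunit X T gamma, gamma 0 = x & gamma T = y]].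

Definition cc_connected X := forall x y, subunit_times X x y !=set0.

Definition cc_dist X x y : R := inf (subunit_times X x y).

Definition cc_ball X x r : set 'rV[R]_N := [set y | cc_dist X x y < r].

Definition cc_topology X := forall x (y : nat -> 'rV[R]_N),
  enorm (y n - x) @[n --> \oo] --> (0 : R) <->
  cc_dist X x (y n) @[n --> \oo] --> (0 : R).

Definition doubling X (Q : R) := forall x r, 0 < r ->
  (0 < lebesgueN (cc_ball X x (2 * r)) /\
   lebesgueN (cc_ball X x (2 * r)) <=
     (2 `^ Q)%:E * lebesgueN (cc_ball X x r))%E.

Definition average (B : set 'rV[R]_N) u : R :=
  Rintegral lebesgueN B u / fine (lebesgueN B).

(* C^1 of a closed ball is read as C^1 on an open neighbourhood of it.  The
   two integrals are [0, +oo]-valued; cc_topology and doubling make the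
   measure of every ball positive and finite, so that fine is harmless. *)
Definition poincare X := exists CP nu : R, [/\ 0 < CP, 0 < nu &
  forall x r u, 0 < r ->
    (exists U, [/\ open U, closure (cc_ball X x (nu * r)) `<=` U & C1_on U u]) ->
    let B := cc_ball X x r in
    let nuB := cc_ball X x (nu * r) in
    ((fine (lebesgueN B))^-1%:E *
        \int[lebesgueN]_(z in B) (`|u z - average B u|)%:E <=
     (CP * r)%:E * ((fine (lebesgueN nuB))^-1%:E *
        \int[lebesgueN]_(z in nuB) (enorm (Xgrad X u z))%:E))%E].

Definition Lnorm_on Omega (q : \bar R) u : \bar R :=
  Lnorm lebesgueN q (EFin \o (u \_ Omega)).

Definition Lspace_on Omega (q : \bar R) u :=
  measurable_fun Omega u /\ (Lnorm_on Omega q u < +oo)%E.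

(* W0_gradient Omega X p u G: u belongs to W^{1,p}_0(Omega, X) and Xu = G.
   The abstract completion of the test functions for |X phi|_p is realized as
   a space of functions by also requiring convergence of phi_n to u in L^p,
   which the Sobolev inequality makes automatic. *)
Definition W0_gradient Omega X p u G :=
  [/\ Lspace_on Omega p%:E u,
      forall j, Lspace_on Omega p%:E (fun x => G x ord0 j) &
      exists phi : nat -> 'rV[R]_N -> R,
      [/\ forall n, test_function Omega (phi n),
          Lnorm_on Omega p%:E (fun x => phi n x - u x) @[n --> \oo] --> 0%E &
          Lnorm_on Omega p%:E (fun x => enorm (Xgrad X (phi n) x - G x))
            @[n --> \oo] --> 0%E]].

Definition structure_conditions Omega (p alpha beta : R) h
    (a : 'rV[R]_N -> R -> 'rV[R]_d -> 'rV[R]_d) :=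
  [/\ forall s xi j, measurable_fun Omega (fun x => a x s xi ord0 j),
      {ae (@lebesgueN R N), forall x, Omega x ->
        continuous (fun z : R * 'rV[R]_d => a x z.1 z.2)} &
      {ae (@lebesgueN R N), forall x, Omega x -> forall s xi,
        [/\ dotv (a x s xi) xi >= alpha * enorm xi `^ p,
            enorm (a x s xi) <=
              beta * (h x + `|s| `^ (p - 1) + enorm xi `^ (p - 1)) &
            forall eta, xi <> eta ->
              dotv (a x s xi - a x s eta) (xi - eta) > 0]}].

Definition weak_solution Omega X p
    (a : 'rV[R]_N -> R -> 'rV[R]_d -> 'rV[R]_d) f u :=
  exists2 G, W0_gradient Omega X p u G &
    forall v H, W0_gradient Omega X p v H ->
      Rintegral lebesgueN Omega (fun x => dotv (a x (u x) (G x)) (H x)) =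
      Rintegral lebesgueN Omega (fun x => f x * v x).

End carnot_caratheodory.

(* Main.v *)
Require Import Defs.
From HB Require Import structures.
From mathcomp Require Import all_boot all_order all_algebra.
From mathcomp Require Import all_classical all_reals all_analysis.
From mathcomp Require Import measurable_realfun ess_sup_inf ring lra.

(** The proof is Stampacchia's truncation method. For a level [k >= 0] let [w] be the
excess of [u] (or of [- u]) over [k]. Testing the equation with [w] and using
coercivity bounds [alpha] times the integral of [|X w| ^ p] by that of [|f| * w]
([energy_inequality]); the Sobolev inequality then gives, for an exponent [q],
  [|w|_q ^ p <= C * int |f| * w <= C * |f|_m * |w|_q * A(k) ^ (1 / m' - 1 / q)],
the last step being Hoelder's inequality, where [A k] is the measure of
[{u > k}] and [m'] the conjugate exponent of [m]. As [(l - k) ^ q * A l <= |w|_q ^ q]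
for [l > k], this is a recurrence [(l - k) ^ q * A l <= K * A k ^ gamma] with
[gamma = (q / m' - 1) / (p - 1)]. If [gamma > 1], that is if [q > p * m'], then [A]
vanishes from an explicit level on ([stampacchia], [ae_le_level_constant]), and this
level is a constant times [|f|_m ^ (1 / (p - 1))]. Since [m > Q / p] means
[p * m' < p * Q / (Q - p)], the exponent [q] can be taken strictly below the critical
Sobolev exponent ([intermediate_exponent]).

The Sobolev inequality for such a [q] comes from doubling and the Poincare
inequality by a chain argument ([sobolev_test_function]). A test function [phi] is the
limit at [x] of its averages over the balls of radius [R0 / 2 ^+ i] around [x], and it
vanishes on a fixed ball away from [Omega]; the Poincare inequality controls each
difference of consecutive averages by the radius times the [p]-th root of the average
of [g ^ p], [g = |X phi|], over a dilated ball ([chain_estimate], [average_far]). Each such average has two bounds: the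
total energy over the volume of the ball, which is at least a multiple of
[2 ^ (- Q * i)], and a geometric factor times a weighted sum of all these averages.
Interpolating between them leaves a convergent geometric series as soon as
[Q * (1 / p - 1 / q) < 1] ([chain_pointwise]). The weighted sum is integrable, with
an integral at most a multiple of the energy, by Tonelli's theorem and doubling
([integral_ball_average]). Measurability of all these objects rests on the fact that
control balls are open, and open sets Lebesgue measurable.

Truncations must be admissible test functions. They are replaced by the smooth
[soft_trunc k e], which keeps test functions smooth and compactly supported and passes
to [W^{1,p}_0] by approximation, with the expected gradient ([W0_soft_trunc]); the
parameter [e] goes to 0 only after the Sobolev inequality and the energy bound have
been combined. The Sobolev inequality passes to [W^{1,p}_0] by Fatou's lemma
([W0_sobolev]). Only the constant of this inequality, [alpha], the exponents and the
measure of [Omega] enter the final constant. *)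

Set Implicit Arguments.
Unset Strict Implicit.
Unset Printing Implicit Defensive.

Import Order.TTheory GRing.Theory Num.Theory.
Import numFieldNormedType.Exports.

Local Open Scope classical_set_scope.
Local Open Scope ring_scope.

(** * Real powers *)

Lemma le_pow2 (R : realType) (t : R) : exists k : nat, t <= 2 ^+ k.
Proof.
exists (Num.truncn t).+1; rewrite (le_trans (ltW (truncnS_gt _)))//.
by rewrite -natrX ler_nat ltnW// ltn_expl.
Qed.

Lemma powR_exprn (R : realType) (a s : R) i : 0 <= a -> (a ^+ i) `^ s = (a `^ s) ^+ i.
Proof.
by move=> a0; rewrite -(powR_mulrn _ a0) -(powR_mulrn _ (powR_ge0 a s)) powRAC.
Qed.

Lemma powR_add_le (R : realType) (a b q : R) : 0 <= a -> 0 <= b -> 0 < q ->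
  (a + b) `^ q <= 2 `^ q * (a `^ q + b `^ q).
Proof.
move=> a0 b0 q0.
wlog ab : a b a0 b0 / a <= b.
  move=> h; have [|/ltW] := leP a b; first exact: h.
  by move=> ba; rewrite addrC [X in _ * X]addrC; exact: h.
apply: (@le_trans _ _ ((2 * b) `^ q)).
  apply: ge0_ler_powR; rewrite ?nnegrE ?addr_ge0 ?mulr_ge0 ?(ltW q0)//.
  by rewrite mulr_natl mulr2n lerD2r.
by rewrite powRM// ler_wpM2l ?powR_ge0// lerDr powR_ge0.
Qed.

Lemma powR_sum_le (R : realType) (I : Type) (s : seq I) (F : I -> R) p :
  (forall i, 0 <= F i) -> 0 < p ->
  (\sum_(i <- s) F i) `^ p <= (2 `^ p) ^+ size s * \sum_(i <- s) F i `^ p.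
Proof.
move=> F0 p0; elim: s => [|i s IH].
  by rewrite !big_nil powR0 ?gt_eqF// mulr0.
rewrite !big_cons/= exprS -mulrA.
apply: le_trans (powR_add_le _ _ p0) _ => //; first exact: sumr_ge0.
rewrite ler_wpM2l ?powR_ge0// mulrDr lerD//.
rewrite ler_peMl ?powR_ge0// exprn_ege1//.
by rewrite -[leLHS](congr1 (fun h => h p) (powR1 R)) ge0_ler_powR ?nnegrE ?(ltW p0)// ler1n.
Qed.

(** Lets a small parameter go to 0 inside a power: [eps := e] settles the case
    [0 < e], at the price of a factor 2, and for [e = 0] the power itself tends
    to 0. *)
Lemma le_of_add_eps (R : realType) (A : \bar R) (S c e r : R) :
  0 <= S -> 0 <= e -> 0 < r -> 0 < c ->
  (forall eps, 0 < eps -> (A <= (S * (c * (eps + e)) `^ r)%:E)%E) ->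
  (A <= (S * (c * (2 * e)) `^ r)%:E)%E.
Proof.
move=> S0 e0 r0 c0 key.
have [e00|e00] := eqVneq e 0; last first.
  have {}e0 : 0 < e by rewrite lt_def e00.
  by have := key e e0; rewrite -mulr2n -[e *+ 2]mulr_natl.
rewrite e00 !mulr0 powR0 ?gt_eqF// mulr0.
apply/lee_addgt0Pr => delta delta0; rewrite add0e.
pose t := (delta / (S + 1)) `^ r^-1 / c.
have S1 : 0 < S + 1 by rewrite ltr_wpDl.
have t0 : 0 < t by rewrite divr_gt0 ?powR_gt0// divr_gt0.
apply: le_trans (key t t0) _; rewrite lee_fin e00 addr0 /t [c * _]mulrC.
rewrite divfK ?gt_eqF// -powRrM mulVf ?gt_eqF//.
rewrite powRr1 ?divr_ge0 ?(ltW delta0) ?(ltW S1)// mulrCA ger_pMr//.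
by rewrite ler_pdivrMr// mul1r lerDl.
Qed.

Lemma powR_norm_lt (R : realType) (a e p : R) : 0 < p -> 0 < e ->
  (`|a| `^ p < e `^ p) = (`|a| < e).
Proof.
move=> p0 e0; apply/idP/idP => h; last first.
  by apply: gt0_ltr_powR; rewrite ?nnegrE// ltW.
rewrite ltNge; apply/negP => ea; move: h; rewrite ltNge => /negP; apply.
by apply: ge0_ler_powR; rewrite ?nnegrE// ltW.
Qed.

Lemma powR_norm_continuous (R : realType) (p : R) : 0 < p ->
  continuous (fun a : R => `|a| `^ p).
Proof.
move=> p0 a; have [->|a0] := eqVneq a 0.
  apply/cvgrPdist_lt => e e0.
  have ep : 0 < e `^ p^-1 by rewrite powR_gt0.
  apply/nbhs_ballP; exists (e `^ p^-1) => // b; rewrite /ball/= sub0r normrN.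
  rewrite normr0 powR0 ?gt_eqF// sub0r normrN (ger0_norm (powR_ge0 _ _))//.
  by rewrite -(powR_norm_lt _ p0 ep) -powRrM mulVf ?gt_eqF// powRr1// ltW.
apply: (@continuous_comp _ _ _ (fun a : R => `|a|) (fun b => b `^ p)).
  exact: norm_continuous.
apply/differentiable_continuous/derivable1_diffP/derivable_powR.
by rewrite in_itv/= andbT normr_gt0.
Qed.

Lemma cvg_of_powR_cvg0 (R : realType) (v : nat -> R) (l p : R) : 0 < p ->
  `|v n - l| `^ p @[n --> \oo] --> 0 -> v n @[n --> \oo] --> l.
Proof.
move=> p0 /cvgrPdist_lt h; apply/cvgrPdist_lt => e e0.
have [n0 _ hn] := h _ (powR_gt0 p e0); exists n0 => // n /hn.
by rewrite /= sub0r normrN ger0_norm ?powR_ge0// powR_norm_lt// distrC.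
Qed.

(** A crude Young inequality: the larger of [x] and [y] bounds both factors. *)
Lemma powRB1_mul_le (R : realType) (x y p : R) : 0 <= x -> 0 <= y -> 1 < p ->
  x `^ (p - 1) * y <= x `^ p + y `^ p.
Proof.
move=> x0 y0 p1; have p0 : 0 < p by exact: lt_trans p1.
have q0 : 0 <= p - 1 by rewrite subr_ge0 ltW.
have [yx|/ltW xy] := leP y x.
  apply: (@le_trans _ _ (x * x `^ (p - 1))).
    by rewrite mulrC ler_wpM2r ?powR_ge0.
  by rewrite mulr_powRB1// lerDl powR_ge0.
apply: (@le_trans _ _ (y * y `^ (p - 1))).
  by rewrite mulrC ler_wpM2l// ge0_ler_powR ?nnegrE.
by rewrite mulr_powRB1// lerDr powR_ge0.
Qed.

Lemma conjugate_powR_le (R : realType) (x y p : R) : 0 <= x -> 0 <= y -> 1 < p ->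
  x * y <= x `^ (p / (p - 1)) + y `^ p.
Proof.
move=> x0 y0 p1; have q0 : 0 < p - 1 by rewrite subr_gt0.
have := powRB1_mul_le (powR_ge0 x (p - 1)^-1) y0 p1.
by rewrite -!powRrM mulVf ?gt_eqF// powRr1// [_^-1 * p]mulrC.
Qed.

(** A sublinear power of [W] on the right-hand side is absorbed by dividing. *)
Lemma powR_absorb (R : realType) (W K p : R) : 0 <= W -> 0 <= K -> 1 < p ->
  W <= K * W `^ p^-1 -> W <= K `^ (p / (p - 1)).
Proof.
move=> W0 K0 p1 h; have p0 : 0 < p by exact: lt_trans p1.
have q0 : 0 < p - 1 by rewrite subr_gt0.
have [->|Wn0] := eqVneq W 0; first exact: powR_ge0.
have {}W0 : 0 < W by rewrite lt_def Wn0.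
have Wp0 : 0 < W `^ p^-1 by rewrite powR_gt0.
have h1 : W `^ ((p - 1) / p) <= K.
  have -> : (p - 1) / p = 1 - p^-1 by rewrite mulrBl mul1r divff ?gt_eqF.
  rewrite powRB ?Wn0 ?implybT// powRr1 ?(ltW W0)//.
  by rewrite ler_pdivrMr.
have e : W = W `^ ((p - 1) / p) `^ (p / (p - 1)).
  rewrite -powRrM (_ : (p - 1) / p * (p / (p - 1)) = 1) ?powRr1 ?(ltW W0)//.
  by field; rewrite !gt_eqF.
rewrite [leLHS]e; apply: ge0_ler_powR; rewrite ?nnegrE ?powR_ge0//.
by rewrite divr_ge0// ltW.
Qed.

(** * The Euclidean norm *)

Section euclidean_norm.
Variables (R : realType) (n : nat).
Implicit Types x y z : 'rV[R]_n.

Lemma dotvC x y : dotv x y = dotv y x.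
Proof. by apply: eq_bigr => i _; rewrite mulrC. Qed.

Lemma dotvDl x y z : dotv (x + y) z = dotv x z + dotv y z.
Proof. by rewrite -big_split; apply: eq_bigr => i _; rewrite !mxE mulrDl. Qed.

Lemma dotvZl (c : R) x z : dotv (c *: x) z = c * dotv x z.
Proof. by rewrite mulr_sumr; apply: eq_bigr => i _; rewrite !mxE mulrA. Qed.

Lemma dotvZr (c : R) x z : dotv z (c *: x) = c * dotv z x.
Proof. by rewrite dotvC dotvZl dotvC. Qed.

Lemma dotv_ge0 x : 0 <= dotv x x.
Proof. by apply: sumr_ge0 => i _; rewrite -expr2 sqr_ge0. Qed.

Lemma enorm_ge0 x : 0 <= enorm x.
Proof. exact: sqrtr_ge0. Qed.

Lemma sqr_enorm x : enorm x ^+ 2 = dotv x x.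
Proof. by rewrite sqr_sqrtr ?dotv_ge0. Qed.

Lemma dotv0 x : dotv x x = 0 -> x = 0.
Proof.
move=> /eqP; rewrite psumr_eq0 => [/allP h|i _]; last by rewrite -expr2 sqr_ge0.
apply/rowP => i; rewrite mxE; apply/eqP.
by have := h i (mem_index_enum _); rewrite mulf_eq0 orbb.
Qed.

Lemma dotv_le_enorm x y : `|dotv x y| <= enorm x * enorm y.
Proof.
have h : dotv x y ^+ 2 <= dotv x x * dotv y y.
  have [/dotv0 ->|y0] := eqVneq (dotv y y) 0.
    have d0 z : dotv z (0 : 'rV[R]_n) = 0.
      by apply: big1 => i _; rewrite mxE mulr0.
    by rewrite !d0 expr0n/= mulr0.
  have yy : 0 < dotv y y by rewrite lt_def y0 dotv_ge0.
  have := dotv_ge0 (dotv y y *: x + (- dotv x y) *: y).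
  rewrite !(dotvDl, dotvZl) !(dotvC _ (_ + _)) !(dotvDl, dotvZl) (dotvC y x).
  rewrite (_ : _ + _ = dotv y y * (dotv x x * dotv y y - dotv x y ^+ 2)).
    by rewrite pmulr_rge0// subr_ge0.
  ring.
rewrite -sqrtr_sqr /enorm -sqrtrM ?dotv_ge0//.
by rewrite ler_wsqrtr.
Qed.

Lemma enormD x y : enorm (x + y) <= enorm x + enorm y.
Proof.
rewrite -(@ler_pXn2r _ 2)// ?nnegrE ?addr_ge0 ?enorm_ge0//.
rewrite sqrrD !sqr_enorm dotvDl !(dotvC _ (_ + _)) !dotvDl (dotvC y x).
have := le_trans (ler_norm _) (dotv_le_enorm x y); lra.
Qed.

Lemma enormZ (c : R) x : enorm (c *: x) = `|c| * enorm x.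
Proof.
by rewrite /enorm dotvZl dotvZr mulrA -expr2 sqrtrM ?sqr_ge0// sqrtr_sqr.
Qed.

Lemma enormN x : enorm (- x) = enorm x.
Proof. by rewrite -scaleN1r enormZ normrN normr1 mul1r. Qed.

Lemma enormB x y : enorm (x - y) = enorm (y - x).
Proof. by rewrite -enormN opprB. Qed.

Lemma enorm0 : enorm (0 : 'rV[R]_n) = 0.
Proof. by rewrite -(scale0r (0 : 'rV_n)) enormZ normr0 mul0r. Qed.

Lemma coord_le_enorm x i : `|x ord0 i| <= enorm x.
Proof.
rewrite -sqrtr_sqr ler_wsqrtr// expr2 /dotv (bigD1 i)//= lerDl.
by apply: sumr_ge0 => j _; rewrite -expr2 sqr_ge0.
Qed.

Lemma enorm_le_sum x : enorm x <= \sum_i `|x ord0 i|.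
Proof.
rewrite -(@ler_pXn2r _ 2)// ?nnegrE ?enorm_ge0 ?sumr_ge0// sqr_enorm.
rewrite expr2 mulr_suml ler_sum// => i _.
rewrite (le_trans (ler_norm _))// normrM ler_wpM2l// (bigD1 i)//= lerDl.
by rewrite sumr_ge0.
Qed.

End euclidean_norm.

Lemma mx_norm_le_enorm (R : realType) n (x : 'rV[R]_n) : `|x| <= enorm x.
Proof.
rewrite [leLHS]mx_normrE; apply: bigmax_le => [|[i j] _/=]; first exact: enorm_ge0.
by rewrite ord1; exact: coord_le_enorm.
Qed.

Lemma enorm_le_mx_norm (R : realType) n (x : 'rV[R]_n) : enorm x <= n%:R * `|x|.
Proof.
rewrite (le_trans (enorm_le_sum x))// mulr_natl.
rewrite (_ : _ *+ n = \sum_(i < n) `|x|); last by rewrite sumr_const card_ord.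
apply: ler_sum => i _; rewrite [leRHS]mx_normrE.
exact: (le_bigmax _ (fun ij : 'I_1 * 'I_n => `|x ij.1 ij.2|) (ord0, i)).
Qed.

Lemma coord_le_mx_norm (R : realType) m n (x : 'M[R]_(m, n)) i j : `|x i j| <= `|x|.
Proof.
rewrite [leRHS]mx_normrE.
exact: (le_bigmax _ (fun ij : 'I_m * 'I_n => `|x ij.1 ij.2|) (i, j)).
Qed.

(** * Lebesgue measure on [R^N] *)

Section lebesgue_measurable_sets.
Variables (R : realType) (N : nat).
Implicit Types (A U : set 'rV[R]_N) (a b x : 'rV[R]_N).

Let cut_min b i (c : R) : 'rV[R]_N :=
  \row_j (if j == i then Num.min (b ord0 i) c else b ord0 j).
Let cut_max a i (c : R) : 'rV[R]_N :=
  \row_j (if j == i then Num.max (a ord0 i) c else a ord0 j).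

Let box_volume_cut a b i (c : R) :
  box_volume a (cut_min b i c) + box_volume (cut_max a i c) b <= box_volume a b.
Proof.
rewrite /box_volume (bigD1 i)//= [X in _ + X <= _](bigD1 i)//= [leRHS](bigD1 i)//=.
rewrite (eq_bigr (fun j => Num.max 0 (b ord0 j - a ord0 j))); last first.
  by move=> j ji; rewrite mxE (negbTE ji).
rewrite [X in _ + _ * X <= _](eq_bigr (fun j => Num.max 0 (b ord0 j - a ord0 j))); last first.
  by move=> j ji; rewrite mxE (negbTE ji).
rewrite -mulrDl ler_wpM2r//.
  by apply: prodr_ge0 => j _; rewrite le_max lexx.
rewrite !mxE eqxx; set s := a _ _; set t := b _ _.
by rewrite /Num.max/= /Num.min/=; repeat case: ifPn; rewrite ?ltNge ?negbK; lra.
Qed.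

(** A half-space cuts every box into two boxes whose volumes add up, so
    splitting a cover along it costs nothing. *)
Lemma halfspace_measurable i (c : R) :
  measurable [set x : 'rV[R]_N | x ord0 i <= c].
Proof.
apply: le_caratheodory_measurable => X.
apply: le_ereal_inf_tmp => _ [D [a [b [XD ->]]]].
apply: (@le_trans _ _ (\esum_(k in D) (box_volume (a k) (cut_min (b k) i c))%:E +
  \esum_(k in D) (box_volume (cut_max (a k) i c) (b k))%:E)%E).
  apply: leeD; apply: ereal_inf_lbound.
    exists D, a, (fun k => cut_min (b k) i c); split=> // x [/XD[k Dk xk] /= xc].
    exists k => // j; rewrite mxE; case: eqP => [->|_]; last exact: xk.
    by have /andP[-> ?] := xk i; rewrite le_min xc andbT.
  exists D, (fun k => cut_max (a k) i c), b; split=> // x [/XD[k Dk xk] /= /negP].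
  rewrite -ltNge => xc.
  exists k => // j; rewrite mxE; case: eqP => [->|_]; last exact: xk.
  by have /andP[? ->] := xk i; rewrite gt_max xc !andbT.
rewrite -esumD => [|k _|k _]; try by rewrite lee_fin box_volume_ge0.
by apply: le_esum => k _; rewrite -EFinD lee_fin box_volume_cut.
Qed.

Lemma box_measurable a b : measurable (box a b).
Proof.
rewrite (_ : box a b = \bigcap_(i in [set: 'I_N])
    ([set x | x ord0 i <= b ord0 i] `\` [set x | x ord0 i <= a ord0 i])).
  apply: fin_bigcap_measurable => // i _.
  by apply: measurableD; exact: halfspace_measurable.
apply/seteqP; split=> x /=.
  by move=> h i _ /=; have /andP[h1 h2] := h i; split=> //; apply/negP; rewrite -ltNge.
by move=> h i; have [/= -> /negP] := h i I; rewrite -ltNge => ->.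
Qed.

(** The rational half-open boxes contained in an open set cover it. *)
Lemma open_measurable_rV U : open U -> measurable U.
Proof.
move=> oU.
pose F (ab : 'rV[rat]_N * 'rV[rat]_N) : set 'rV[R]_N :=
  if `[< box (map_mx ratr ab.1) (map_mx ratr ab.2) `<=` U >]
  then box (map_mx ratr ab.1) (map_mx ratr ab.2) else set0.
rewrite (_ : U = \bigcup_ab F ab); last first.
  apply/seteqP; split=> [x Ux|x [ab _]]; last by rewrite /F; case: asboolP => // h /h.
  have /nbhs_ballP[e /= e0 eU] := open_nbhs_nbhs (conj oU Ux).
  have hq i : {q : rat * rat | [&& x ord0 i - e < ratr q.1, ratr q.1 < x ord0 i,
      x ord0 i < ratr q.2 & ratr q.2 < x ord0 i + e]}.
    apply: cid.
    have [q] := @rat_in_itvoo _ (x ord0 i - e) (x ord0 i) ltac:(lra).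
    have [r] := @rat_in_itvoo _ (x ord0 i) (x ord0 i + e) ltac:(lra).
    rewrite !in_itv/= => /andP[r1 r2] /andP[q1 q2].
    by exists (q, r); rewrite q1 q2 r1 r2.
  exists (\row_i (sval (hq i)).1, \row_i (sval (hq i)).2) => //.
  rewrite /F/=; case: asboolP => [_ i|[]].
    by rewrite !mxE; have /and4P[_ -> /ltW -> _] := svalP (hq i).
  move=> y xy; apply: eU; split=> // j i; rewrite ord1 /ball/=.
  have := xy i; rewrite !mxE; have /and4P[h1 h2 h3 h4] := svalP (hq i).
  move=> /andP[h5 h6]; rewrite ltr_distl; lra.
apply: countable_bigcupT_measurable => // ab; rewrite /F.
by case: asboolP => _; [exact: box_measurable|exact: measurable0].
Qed.

Lemma continuous_measurable_rV (f : 'rV[R]_N -> R) :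
  continuous f -> measurable_fun setT f.
Proof.
move=> /continuousP cf; apply: (measurability _ (RGenOpens.measurableE R)).
move=> _ [_ [a [b ->] <-]]; rewrite setTI; apply: open_measurable_rV.
exact/cf/interval_open.
Qed.

Lemma lebesgueN_box a b : (lebesgueN (box a b) <= (box_volume a b)%:E)%E.
Proof.
apply: ereal_inf_lbound; exists [set 0%N], (fun=> a), (fun=> b); split.
  by move=> x xab; exists 0%N.
by rewrite esum_set1// lee_fin box_volume_ge0.
Qed.

Lemma lebesgueN_bounded A : bounded_set A -> (lebesgueN A < +oo)%E.
Proof.
move=> [M [_ /(_ (`|M| + 1))]].
rewrite (le_lt_trans (ler_norm _)) ?ltrDl// => /(_ isT) AM.
apply: (@le_lt_trans _ _ (lebesgueN (box (const_mx (- (`|M| + 2)))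
   (const_mx (`|M| + 2) : 'rV[R]_N)))).
  apply: le_outer_measure => x /AM /= xM i; rewrite !mxE.
  have := le_trans (coord_le_mx_norm x ord0 i) xM; rewrite ler_norml; lra.
by rewrite (le_lt_trans (lebesgueN_box _ _))// ltry.
Qed.

Lemma lebesgueN_sigma_finite : sigma_finite setT (@lebesgueN R N).
Proof.
exists (fun n => box (const_mx (- n%:R)) (const_mx n%:R)).
  apply/esym/seteqP; split=> // x _.
  exists (Num.truncn `|x|).+1 => // i; rewrite !mxE.
  have := coord_le_mx_norm x ord0 i; have := truncnS_gt `|x|.
  rewrite ler_norml; lra.
move=> n; split; first exact: box_measurable.
by rewrite (le_lt_trans (lebesgueN_box _ _))// ltry.
Qed.

HB.instance Definition _ := @Measure_isSigmaFinite.Build _ 'rV[R]_N R lebesgueN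
  lebesgueN_sigma_finite.

End lebesgue_measurable_sets.

(** * The control distance *)

Section affine_null_sets.
Variable R : realType.
Implicit Types (P : R -> Prop) (c : R).

Lemma ae_lebesgue_opp P :
  {ae (@lebesgue_measure R), forall t, P t} ->
  {ae (@lebesgue_measure R), forall t, P (- t)}.
Proof.
move=> [A [mA A0 PA]]; exists (-%R @^-1` A); split.
- by rewrite -[X in measurable X]setTI; exact: oppr_measurable.
- by rewrite -A0 -(lebesgue_measureN mA).
- by move=> t /= /PA.
Qed.

Lemma ae_lebesgue_shift c P :
  {ae (@lebesgue_measure R), forall t, P t} ->
  {ae (@lebesgue_measure R), forall t, P (t - c)}.
Proof.
have mc : measurable_fun setT ((fun t => t - c) : measurableTypeR R -> measurableTypeR R).
  exact: measurable_funB.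
move=> [A [mA A0 PA]]; exists ((fun t => t - c) @^-1` A); split.
- by rewrite -[X in measurable X]setTI; exact: mc.
- rewrite -A0 -[LHS]/(pushforward lebesgue_measure
    ((fun t => t - c) : measurableTypeR R -> measurableTypeR R) A).
  apply/esym/lebesgue_measure_unique => // _ [[a b]] _ <-.
  rewrite /pushforward; transitivity (lebesgue_measure `]a + c, b + c]%classic).
    rewrite !lebesgue_measure_itv/= !lte_fin ltrD2r.
    by case: ifP => // _; rewrite -!EFinD; congr EFin; lra.
  by congr lebesgue_measure; apply/seteqP; split=> t/=; rewrite !in_itv/=; lra.
- by move=> t /= /PA.
Qed.

End affine_null_sets.

Lemma is_derive1_vcomp (R : realType) (V : normedModType R) (rho : R -> R)
    (gamma : R -> V) (t a : R) (v : V) :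
  is_derive t 1 rho a -> is_derive (rho t) 1 gamma v ->
  is_derive t 1 (gamma \o rho) (a *: v).
Proof.
move=> [dr ra] [dg gv].
have /derivable1_diffP dr' := dr; have /derivable1_diffP dg' := dg.
have dc : differentiable (gamma \o rho) t by exact: differentiable_comp.
apply: DeriveDef; first exact/derivable1_diffP.
rewrite deriveE// diff_comp//=.
have -> : 'd rho t 1 = a by rewrite -ra deriveE.
by rewrite -[a in LHS]mulr1 -[a * 1]/(a *: (1 : R)) linearZ/= -deriveE// gv.
Qed.

Section subunit_paths.
Variables (R : realType) (N d : nat) (X : 'I_d -> 'rV[R]_N -> 'rV[R]_N).
Implicit Types (x y z : 'rV[R]_N) (gamma : R -> 'rV[R]_N) (T : R).

(** The reversed path has the opposite controls; its null set of bad times is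
    the image of the original one under [t |-> T - t]. *)
Lemma subunit_times_sym x y T :
  subunit_times X x y T -> subunit_times X y x T.
Proof.
move=> [T0 [gamma [[acg [theta thetaP]] g0 gT]]]; split=> //.
exists (fun t => gamma (T - t)); rewrite subr0 subrr; split=> //; split.
  move=> e /acg[dl dl0 h]; exists dl => // n s t st sep sum_lt.
  rewrite (reindex_inj rev_ord_inj)/=.
  rewrite (eq_bigr (fun i => enorm (gamma (T - s (rev_ord i)) -
     gamma (T - t (rev_ord i))))) => [|i _]; last by rewrite enormB.
  apply: h => [i|i j ij|].
  - by have [] := st (rev_ord i); split; lra.
  - have ji : (rev_ord j < rev_ord i)%N by rewrite /= ltn_sub2l ?ltnS// (leq_ltn_trans ij).
    by have := sep _ _ ji; lra.
  - apply: le_lt_trans sum_lt; rewrite [leRHS](reindex_inj rev_ord_inj)/=.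
    by apply: ler_sum => i _; lra.
exists (fun t j => - theta (T - t) j).
have := ae_lebesgue_shift T (ae_lebesgue_opp thetaP).
apply: (@filterS _ _ (ae_filter_ringOfSetsType _)) => t; rewrite opprB => h t0T.
have [|th dg] := h; first by lra.
split; first by under eq_bigr do rewrite sqrrN.
have dr : is_derive t 1 (fun t : R => T - t) (-1).
  by apply: is_derive_eq; rewrite add0r mul1r.
have := is_derive1_vcomp dr dg; rewrite scaleN1r -sumrN.
by under eq_bigr do rewrite -scaleNr.
Qed.

(** On [[0, T1 + T2]] the concatenated path is the sum of the first path
    stopped at [T1] and of the second one started at [T1], minus the common
    point; in this form its absolute continuity is that of its two terms. *)
Lemma subunit_times_trans x y z T1 T2 :
  subunit_times X x y T1 -> subunit_times X y z T2 ->
  subunit_times X x z (T1 + T2).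
Proof.
move=> [T10 [g1 [[ac1 [th1 th1P]] g10 g1T]]].
move=> [T20 [g2 [[ac2 [th2 th2P]] g20 g2T]]].
split; first exact: addr_gt0.
pose g t := g1 (Num.min t T1) + g2 (Num.max t T1 - T1) - y.
have g_le t : t <= T1 -> g t = g1 t.
  by move=> tT; rewrite /g (min_idPl tT) (max_idPr tT) subrr g20 addrK.
have g_ge t : T1 <= t -> g t = g2 (t - T1).
  by move=> tT; rewrite /g (min_idPr tT) (max_idPl tT) g1T addrC addKr.
exists g; split; last 2 first.
- by rewrite g_le// ltW.
- by rewrite g_ge ?lerDl ?(ltW T20)// addrAC subrr add0r.
split.
  move=> e e0; have e20 : 0 < e / 2 by rewrite divr_gt0.
  have [d1 d10 h1] := ac1 _ e20; have [d2 d20 h2] := ac2 _ e20.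
  exists (Num.min d1 d2); first by rewrite lt_min d10.
  move=> n s t st sep; rewrite lt_min => /andP[sum1 sum2].
  have minsub (a b : R) : a <= b -> Num.min b T1 - Num.min a T1 <= b - a.
    by rewrite /Num.min; do 2 case: ifPn; rewrite -?leNgt; lra.
  have maxsub (a b : R) : a <= b -> (Num.max b T1 - T1) - (Num.max a T1 - T1) <= b - a.
    by rewrite /Num.max; do 2 case: ifPn; rewrite -?leNgt; lra.
  have k1 : \sum_i enorm (g1 (Num.min (t i) T1) - g1 (Num.min (s i) T1)) < e / 2.
    apply: h1 => [i|i j ij|].
    - have [a b c] := st i; split; rewrite ?le_min ?ge_min ?lexx ?orbT ?a ?(ltW T10)//.
      by rewrite b.
    - by rewrite !(le_min, ge_min) (sep _ _ ij) lexx !orbT.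
    - apply: le_lt_trans sum1; apply: ler_sum => i _; apply: minsub.
      by have [] := st i.
  have k2 : \sum_i enorm (g2 (Num.max (t i) T1 - T1) - g2 (Num.max (s i) T1 - T1)) < e / 2.
    apply: h2 => [i|i j ij|].
    - have [a b c] := st i; split.
      + by rewrite subr_ge0 le_max lexx orbT.
      + by rewrite lerD2r ge_max !le_max b lexx !orbT.
      + by rewrite lerBlDr ge_max [T2 + _]addrC c lerDl (ltW T20).
    - by rewrite lerD2r ge_max !le_max (sep _ _ ij) lexx !orbT.
    - apply: le_lt_trans sum2; apply: ler_sum => i _; apply: maxsub.
      by have [] := st i.
  rewrite [ltRHS]splitr; apply: le_lt_trans (ltrD k1 k2).
  rewrite -big_split/=; apply: ler_sum => i _; apply: le_trans (enormD _ _).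
  rewrite le_eqVlt; apply/orP; left; apply/eqP; congr enorm.
  by rewrite /g opprB addrA subrK opprD addrACA.
exists (fun t => if t < T1 then th1 t else th2 (t - T1)).
have T1neq : {ae (@lebesgue_measure R), forall t, t <> T1}.
  exists [set T1]; split; [exact: measurable_set1|exact: lebesgue_measure_set1|].
  by move=> t /= /contrapT.
move: (ae_lebesgue_shift T1 th2P) th1P T1neq; apply: (@filterS3 _ _ (ae_filter_ringOfSetsType _)) => t h2 h1 tT /andP[t0 tT12].
have [tT1|T1t] := ltP t T1.
  have [|le1 dg] := h1; first by rewrite t0 ltW.
  split=> //; rewrite (g_le _ (ltW tT1)); apply: near_eq_is_derive dg.
  near=> s; rewrite g_le//; apply/ltW; near: s.
  exact: lt_nbhsl tT1.
have {}T1t : T1 < t by rewrite lt_def T1t andbT; apply/eqP.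
have [|le1 dg] := h2; first by rewrite subr_ge0 (ltW T1t)/= lerBlDl.
split=> //; rewrite (g_ge _ (ltW T1t)).
have dr : is_derive t 1 (fun t : R => t - T1) 1.
  by apply: is_derive_eq; ring.
have := is_derive1_vcomp dr dg; rewrite scale1r.
apply: near_eq_is_derive; near=> s; rewrite g_ge//; apply/ltW; near: s.
exact: lt_nbhsr T1t.
Unshelve. all: by end_near. Qed.

Lemma subunit_times_lbound x y : lbound (subunit_times X x y) 0.
Proof. by move=> T [/ltW]. Qed.

End subunit_paths.

(** Turns the sequential form of the comparison between the Euclidean and the
    control topologies into its epsilon-delta form. *)
Lemma seq_small_to_uniform (R : realType) (T : Type) (f g : T -> R) :
  (forall y, 0 <= f y) -> (forall y, 0 <= g y) ->
  (forall y : nat -> T, f (y n) @[n --> \oo] --> 0 -> g (y n) @[n --> \oo] --> 0) ->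
  forall e, 0 < e -> exists2 r, 0 < r & forall y, f y < r -> g y < e.
Proof.
move=> f0 g0 fg e e0; apply: contrapT => H.
have /choice[y yP] n : exists y, f y < n.+1%:R^-1 /\ e <= g y.
  apply: contrapT => hn; apply: H; exists n.+1%:R^-1; first by rewrite invr_gt0.
  by move=> y fy; rewrite ltNge; apply/negP => gy; apply: hn; exists y.
have fy0 : f (y n) @[n --> \oo] --> 0.
  apply: (@squeeze_cvgr _ _ _ _ (cst 0) (@harmonic R)); last 2 first.
  - exact: cvg_cst.
  - exact: cvg_harmonic.
  by apply: nearW => n; rewrite f0/=; apply/ltW; have [] := yP n.
have /cvgr0Pnorm_lt/(_ e e0)[n _ /(_ n (leqnn n))] := fg y fy0.
by rewrite ger0_norm// ltNge; have [_ ->] := yP n.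
Qed.

Section control_distance.
Variables (R : realType) (N d : nat) (X : 'I_d -> 'rV[R]_N -> 'rV[R]_N).
Hypotheses (conn : cc_connected X) (topo : cc_topology X).
Implicit Types (x y z : 'rV[R]_N) (r e : R).
Let mu := @lebesgueN R N.

Lemma cc_dist_le x y T : subunit_times X x y T -> cc_dist X x y <= T.
Proof. by move=> xyT; apply: ge_inf => //; exists 0; exact: subunit_times_lbound. Qed.

Lemma cc_dist_ge0 x y : 0 <= cc_dist X x y.
Proof. by apply: lb_le_inf => //; exact: subunit_times_lbound. Qed.

Lemma cc_dist_sym x y : cc_dist X x y = cc_dist X y x.
Proof.
by congr inf; apply/seteqP; split => T; exact: subunit_times_sym.
Qed.

Lemma cc_dist_tri y x z : cc_dist X x z <= cc_dist X x y + cc_dist X y z.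
Proof.
apply/ler_addgt0Pr => e e0; have e20 : 0 < e / 2 by rewrite divr_gt0.
have hi x' y' : has_inf (subunit_times X x' y').
  by split=> //; exists 0; exact: subunit_times_lbound.
have [T1 xyT1 T1lt] := inf_adherent e20 (hi x y).
have [T2 yzT2 T2lt] := inf_adherent e20 (hi y z).
apply: le_trans (cc_dist_le (subunit_times_trans xyT1 yzT2)) _.
move: T1lt T2lt; rewrite -/(cc_dist X x y) -/(cc_dist X y z); lra.
Qed.

Lemma cc_dist_refl x : cc_dist X x x = 0.
Proof.
have /cvg_lim : cc_dist X x x @[_ --> \oo] --> (0 : R).
  by apply/(topo x (fun=> x)); rewrite subrr enorm0; exact: cvg_cst.
by rewrite (@lim_cst _ (@Rhausdorff R)) => <-.
Qed.

Lemma cc_dist_small x e : 0 < e ->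
  exists2 r, 0 < r & forall y, enorm (y - x) < r -> cc_dist X x y < e.
Proof.
apply: seq_small_to_uniform => [y|y|y]; [exact: enorm_ge0|exact: cc_dist_ge0|].
by move/(topo x y).
Qed.

Lemma enorm_small x e : 0 < e ->
  exists2 r, 0 < r & forall y, cc_dist X x y < r -> enorm (y - x) < e.
Proof.
apply: seq_small_to_uniform => [y|y|y]; [exact: cc_dist_ge0|exact: enorm_ge0|].
by move/(topo x y).
Qed.

Lemma nbhs_cc_dist x e : 0 < e -> \forall y \near x, cc_dist X x y < e.
Proof.
move=> /(cc_dist_small x)[r r0 h].
apply/nbhs_ballP; exists (r / N.+1%:R) => /= [|y]; first by rewrite divr_gt0.
rewrite mx_norm_ball /ball_/= => xy; apply: h.
rewrite enormB (le_lt_trans (enorm_le_mx_norm _))//.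
move: xy; rewrite ltr_pdivlMr// mulrC; apply: le_lt_trans.
by rewrite ler_wpM2r// ler_nat.
Qed.

Lemma cc_dist_continuous z : continuous (cc_dist X z).
Proof.
move=> x; apply/(@cvgrPdist_lt _ R^o _ (nbhs x) (nbhs_filter x)) => e e0.
apply: (@filterS _ _ (nbhs_filter x) _ _ _ (nbhs_cc_dist x e0)) => y.
apply: le_lt_trans; rewrite ler_distl.
have := cc_dist_tri x z y; have := cc_dist_tri y z x.
rewrite (cc_dist_sym y x); lra.
Qed.

Lemma cc_ball_open x r : open (cc_ball X x r).
Proof.
rewrite (_ : cc_ball X x r = cc_dist X x @^-1` [set t | t < r]) //.
by apply: open_comp; [move=> y _; exact: cc_dist_continuous|exact: open_lt].
Qed.

Lemma cc_ball_measurable x r : measurable (cc_ball X x r).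
Proof. exact/open_measurable_rV/cc_ball_open. Qed.

Lemma sub_cc_ball x y r s : cc_dist X x y + r <= s ->
  cc_ball X y r `<=` cc_ball X x s.
Proof.
move=> h z /= yz; have := cc_dist_tri y x z; rewrite /cc_ball/= in yz *; lra.
Qed.

Lemma cc_ball_subset x r s : r <= s -> cc_ball X x r `<=` cc_ball X x s.
Proof. by move=> rs y /lt_le_trans; exact. Qed.

(** The distance to [z] is continuous for the Euclidean topology, hence bounded
    on the compact closure of a bounded set. *)
Lemma bounded_cc_dist (A : set 'rV[R]_N) z : bounded_set A ->
  exists2 D, 0 < D & forall x, A x -> cc_dist X z x <= D.
Proof.
move=> [M [_ /(_ (`|M| + 1))]].
rewrite (le_lt_trans (ler_norm _)) ?ltrDl// => /(_ isT) AM.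
have M2 : 0 < `|M| + 2 by rewrite ltr_wpDl.
have cK : compact (closed_ball (0 : 'rV[R]_N) (`|M| + 2)).
  apply: bounded_closed_compact; last exact: closed_ball_closed.
  exists (`|M| + 2); split=> // t ht x; rewrite closed_ballE//.
  by rewrite /closed_ball_ /= sub0r normrN => /le_trans; apply; exact/ltW.
have /compact_bounded[D [_ /(_ (`|D| + 1))]] :
    compact (cc_dist X z @` closed_ball (0 : 'rV[R]_N) (`|M| + 2)).
  by apply: continuous_compact => //; exact/continuous_subspaceT/cc_dist_continuous.
rewrite (le_lt_trans (ler_norm _)) ?ltrDl// => /(_ isT) h.
exists (`|D| + 1); first by rewrite ltr_wpDl.
move=> x /AM xM; apply: le_trans (ler_norm _) _; apply: h; exists x => //.
rewrite closed_ballE//.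
rewrite /closed_ball_ /= sub0r normrN (le_trans xM)//.
by rewrite lerD2l ler1n.
Qed.

(** Provides a ball on which every test function vanishes: the far end of the
    chains of balls that control a test function. *)
Lemma cc_ball_disjoint (A : set 'rV[R]_N) : (0 < N)%N -> bounded_set A ->
  exists z, exists2 rho, 0 < rho & forall x, A x -> rho <= cc_dist X z x.
Proof.
move=> N0 [M [_ /(_ (`|M| + 1))]].
rewrite (le_lt_trans (ler_norm _)) ?ltrDl// => /(_ isT) AM.
pose z : 'rV[R]_N := const_mx (`|M| + 2).
have [r r0 rP] := enorm_small z ltr01.
exists z, r => // x /AM xM; rewrite leNgt; apply/negP => /rP.
rewrite ltNge => /negP; apply.
apply: le_trans (coord_le_enorm _ (Ordinal N0)).
rewrite !mxE -normrN opprB; apply: le_trans (ler_norm _).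
have := le_trans (coord_le_mx_norm x ord0 (Ordinal N0)) xM.
rewrite ler_norml; lra.
Qed.

(** [cc_dist X x y < r] holds iff some point [q] with rational coordinates is
    within [n.+1%:R^-1] of [x] and within [r - n.+1%:R^-1] of [y], for some [n]:
    a countable union of measurable rectangles. *)
Lemma cc_dist_lt_measurable r :
  measurable [set xy : 'rV[R]_N * 'rV[R]_N | cc_dist X xy.1 xy.2 < r].
Proof.
pose F (qn : 'rV[rat]_N * nat) : set ('rV[R]_N * 'rV[R]_N) :=
  cc_ball X (map_mx ratr qn.1) qn.2.+1%:R^-1 `*`
  cc_ball X (map_mx ratr qn.1) (r - qn.2.+1%:R^-1).
rewrite (_ : [set _ | _] = \bigcup_qn F qn).
  apply: countable_bigcupT_measurable => // qn.
  by apply: measurableX; exact: cc_ball_measurable.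
apply/seteqP; split=> [[x y] /= xyr|[x y] [[q n] _ [/=]]]; last first.
  rewrite /cc_ball/= => qx qy; have := cc_dist_tri (map_mx ratr q) x y.
  rewrite (cc_dist_sym x (map_mx _ _)).
  by move: n.+1%:R^-1 qx qy => s; lra.
pose n := Num.truncn (2 / (r - cc_dist X x y)).
have rxy : 0 < r - cc_dist X x y by rewrite subr_gt0.
have n2 : 2 * n.+1%:R^-1 < r - cc_dist X x y.
  rewrite ltr_pdivrMr// mulrC -ltr_pdivrMr//; exact: truncnS_gt.
have n0 : 0 < n.+1%:R^-1 :> R by rewrite invr_gt0.
have /nbhs_ballP[e /= e0 eP] := nbhs_cc_dist x n0.
have /choice[q qP] i : exists q : rat, `|x ord0 i - ratr q| < e.
  have [q] := @rat_in_itvoo _ (x ord0 i) (x ord0 i + e) ltac:(lra).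
  by rewrite in_itv/= => /andP[h1 h2]; exists q; rewrite ltr_distl; lra.
have xq : cc_dist X x (map_mx ratr (\row_i q i)) < n.+1%:R^-1.
  by apply: eP; split=> // j i; rewrite ord1 !mxE; exact: qP.
exists (\row_i q i, n) => //; split; rewrite /cc_ball/=; first by rewrite cc_dist_sym.
have := cc_dist_tri x (map_mx ratr (\row_i q i)) y; rewrite (cc_dist_sym (map_mx _ _) x).
by move: n.+1%:R^-1 n2 n0 xq => s; lra.
Qed.

End control_distance.

(** * Doubling *)

Section doubling_balls.
Variables (R : realType) (N d : nat) (X : 'I_d -> 'rV[R]_N -> 'rV[R]_N) (Q : R).
Hypotheses (conn : cc_connected X) (topo : cc_topology X) (dbl : doubling X Q).
Implicit Types (x y z : 'rV[R]_N) (r : R).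
Local Notation B := (cc_ball X).
Local Notation vol x r := (fine (lebesgueN (cc_ball X x r))).

Lemma lebesgueN_cc_ball_gt0 x r : 0 < r -> (0 < lebesgueN (B x r))%E.
Proof.
move=> r0; have [|+ _] := dbl x (r := r / 2); first by rewrite divr_gt0.
by rewrite mulrC divfK.
Qed.

Lemma doubling_iter x r k : 0 < r ->
  (lebesgueN (B x (2 ^+ k * r)) <= (2 `^ Q ^+ k)%:E * lebesgueN (B x r))%E.
Proof.
move=> r0; elim: k => [|k IH]; first by rewrite !expr0 mul1r mul1e.
have [|_] := dbl x (r := 2 ^+ k * r); first by rewrite mulr_gt0// exprn_gt0.
rewrite mulrA -exprS => /le_trans; apply.
by rewrite exprS EFinM -muleA lee_wpmul2l// lee_fin powR_ge0.
Qed.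

(** A small ball is bounded in the Euclidean sense, hence of finite measure, and
    doubling propagates finiteness to all radii. *)
Lemma lebesgueN_cc_ball_fin x r : lebesgueN (B x r) \is a fin_num.
Proof.
rewrite ge0_fin_numE ?measure_ge0//.
have [e e0 eP] := enorm_small conn topo x ltr01.
have fin_e : (lebesgueN (B x e) < +oo)%E.
  apply: lebesgueN_bounded; exists (1 + `|x|); split=> // t ht y /eP yx.
  apply: le_trans (ltW ht); rewrite -[y](subrK x) (le_trans (ler_normD _ _))//.
  by rewrite lerD2r (le_trans (mx_norm_le_enorm _))// ltW.
pose k := Num.truncn (r / e).
have rk : r <= 2 ^+ k.+1 * e.
  rewrite -ler_pdivrMr// (le_trans (ltW (truncnS_gt _)))//.
  by rewrite -natrX ler_nat ltnW// ltn_expl.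
apply: le_lt_trans (le_outer_measure _ _ _ (cc_ball_subset rk)) _.
apply: le_lt_trans (doubling_iter _ _ e0) _.
by rewrite lte_mul_pinfty// lee_fin exprn_ge0// powR_ge0.
Qed.

Lemma cc_volK x r : (vol x r)%:E = lebesgueN (B x r).
Proof. by rewrite fineK// lebesgueN_cc_ball_fin. Qed.

Lemma cc_vol_gt0 x r : 0 < r -> 0 < vol x r.
Proof. by move=> r0; rewrite -lte_fin cc_volK lebesgueN_cc_ball_gt0. Qed.

Lemma cc_vol_doubling x r k : 0 < r -> vol x (2 ^+ k * r) <= 2 `^ Q ^+ k * vol x r.
Proof. by move=> r0; rewrite -lee_fin EFinM !cc_volK doubling_iter. Qed.

Lemma le_cc_vol x y r s : B x r `<=` B y s -> vol x r <= vol y s.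
Proof. by move=> xy; rewrite -lee_fin !cc_volK le_outer_measure. Qed.

End doubling_balls.

(** * Calculus along coordinate lines *)

Section line_calculus.
Variable R : realType.

(** A directional derivative is the derivative of the restriction to a line; the
    one-variable chain rule and mean value theorem are used through this. *)
Lemma is_derive_line (V W : normedModType R) (f : V -> W) (x v : V) (t : R) (df : W) :
  is_derive (x + t *: v) v f df <->
  is_derive t 1 (fun s : R => f (x + s *: v)) df.
Proof.
suff E : (fun h : R => h^-1 *: ((f \o shift (x + t *: v)) (h *: v) - f (x + t *: v))) =
    (fun h : R => h^-1 *: (((fun s : R => f (x + s *: v)) \o shift t) (h *: 1)
       - f (x + t *: v))).
  split=> -[df1 df2]; split.
  - by move: df1; rewrite /derivable E.
  - by rewrite -df2 /derive E.
  - by rewrite /derivable E.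
  - by rewrite -df2 /derive E.
apply/funext => h /=; congr (_ *: (f _ - _)).
by rewrite [h *: 1]mulr1 scalerDl addrCA.
Qed.

Lemma is_derive_ext (V W : normedModType R) (f : V -> W) (x v : V) (df dg : W) :
  is_derive x v f df -> df = dg -> is_derive x v f dg.
Proof. by move=> h <-. Qed.

Lemma is_derive_comp1 (V : normedModType R) (r : R -> R) (f : V -> R) (x v : V)
    (dr df : R) :
  is_derive (f x) 1 r dr -> is_derive x v f df ->
  is_derive x v (r \o f) (dr * df).
Proof.
have key t : is_derive (f (x + t *: v)) 1 r dr -> is_derive (x + t *: v) v f df ->
    is_derive (x + t *: v) v (r \o f) (dr * df).
  move=> hr /is_derive_line hf; apply/is_derive_line.
  exact: (@is_derive1_comp _ r (fun s => f (x + s *: v))).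
by have := key 0; rewrite scale0r addr0.
Qed.

Lemma mean_value (g dg : R -> R) (a b : R) :
  (forall s : R, is_derive s 1 g (dg s)) ->
  exists2 c, `|c - a| <= `|b - a| & g b - g a = dg c * (b - a).
Proof.
move=> hg.
have cg : continuous g.
  by move=> s; apply/differentiable_continuous/derivable1_diffP; case: (hg s).
have [ab|ba] := leP a b.
  have [c] := MVT_segment ab (fun s _ => hg s) (continuous_subspaceT cg).
  rewrite in_itv/= => /andP[ac cb] ->; exists c => //.
  by rewrite !ger0_norm ?subr_ge0// lerD2r.
have [c] := MVT_segment (ltW ba) (fun s _ => hg s) (continuous_subspaceT cg).
rewrite in_itv/= => /andP[bc ca] e; exists c.
  by rewrite !ler0_norm ?subr_le0// ?(ltW ba)// lerN2 lerD2r.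
by rewrite -opprB e; ring.
Qed.

End line_calculus.

Section C1_functions.
Variables (R : realType) (N : nat).
Implicit Types (f g phi : 'rV[R]_N -> R) (x y : 'rV[R]_N).

Lemma C1_is_derive f k x : C1_on setT f ->
  is_derive x (delta_mx ord0 k) f (partial k f x).
Proof. by move=> /(_ k x I)[df _]; apply: DeriveDef. Qed.

(** Going from [x] to [y] one coordinate at a time, each step costs at most
    a partial derivative times the length of that step. *)
Lemma C1_continuous f : C1_on setT f -> continuous f.
Proof.
move=> Cf x.
have [e e0 [M M0 eM]] : exists2 e, 0 < e & exists2 M, 0 < M &
    forall k y, `|x - y| < e -> `|partial k f y| <= M.
  have /choice[e eP] k : exists e, 0 < e /\
      forall y, `|x - y| < e -> `|partial k f y| <= `|partial k f x| + 1.
    have [_ cf] := Cf k x I.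
    have /cvgrPdist_lt/(_ 1 ltr01)/nbhs_ballP[e /= e0 eP] := cf.
    exists e; split=> // y xy.
    have := eP y; rewrite mx_norm_ball /ball_/= => /(_ xy).
    rewrite distrC => h; rewrite -[partial k f y](subrK (partial k f x)).
    by rewrite (le_trans (ler_normD _ _))// addrC lerD2l ltW.
  exists (\big[Num.min/1]_k e k).
    by elim/big_ind: _ => // [a b a0 b0|k _]; [rewrite lt_min a0|have [] := eP k].
  exists (1 + \sum_k (`|partial k f x| + 1)).
    by rewrite ltr_pwDl// sumr_ge0.
  move=> k y xy; apply: le_trans (_ : _ <= `|partial k f x| + 1) _.
    apply: (eP k).2; apply: lt_le_trans xy _; exact: bigmin_le.
  by rewrite (bigD1 k)//= addrCA lerDl addr_ge0// sumr_ge0.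
apply/(@cvgrPdist_lt _ R^o _ (nbhs x) (nbhs_filter x)) => eps eps0.
apply/nbhs_ballP; exists (Num.min e (eps / (N.+1%:R * M))) => /=.
  by rewrite lt_min e0 divr_gt0// mulr_gt0.
move=> y; rewrite mx_norm_ball /ball_/= lt_min => /andP[xye xyeps].
(* [z n] has the first [n] coordinates of [y] and the other ones of [x]. *)
pose z n : 'rV[R]_N := \row_j (if (j < n)%N then y ord0 j else x ord0 j).
have z0 : z 0%N = x by apply/rowP => j; rewrite mxE.
have zN : z N = y by apply/rowP => j; rewrite mxE ltn_ord.
have step (k : 'I_N) : `|f (z k.+1) - f (z k)| <= M * `|x - y|.
  pose h := y ord0 k - x ord0 k.
  have zS : z k.+1 = z k + h *: delta_mx ord0 k.
    apply/rowP => j; rewrite !mxE eqxx/= ltnS leq_eqVlt.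
    have [->|jk] := eqVneq j k; first by rewrite ?eqxx ltnn mulr1 addrC subrK.
    by rewrite (negbTE (_ : val j != val k))// mulr0 addr0.
  have hxy : `|h| <= `|x - y|.
    by have := coord_le_mx_norm (x - y) ord0 k; rewrite !mxE distrC.
  have [c ch] := @mean_value _ (fun s => f (z k + s *: delta_mx ord0 k))
    (fun s => partial k f (z k + s *: delta_mx ord0 k)) 0 h
    (fun s => (is_derive_line _ _ _ _ _).1 (C1_is_derive k _ Cf)).
  rewrite scale0r addr0 -zS subr0 => ->; rewrite normrM ler_pM// eM//.
  apply: le_lt_trans xye; rewrite [leLHS]mx_normrE.
  apply: bigmax_le => // -[i j] _ /=; rewrite (ord1 i) !mxE ?eqxx/=.
  rewrite !subr0 in ch.
  have [->|jk] := eqVneq j k.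
    by rewrite ltnn mulr1 opprD addrA subrr sub0r normrN (le_trans ch).
  rewrite mulr0 addr0; case: ifP => _; last by rewrite subrr normr0.
  by have := coord_le_mx_norm (x - y) ord0 j; rewrite !mxE.
rewrite distrC -z0 -zN -(telescope_sumr (fun n => f (z n)) (leq0n N)) big_mkord.
apply: le_lt_trans (ler_norm_sum _ _ _) _.
apply: le_lt_trans (ler_sum _ (fun k _ => step k)) _.
rewrite sumr_const card_ord -mulr_natl mulrA.
apply: (@le_lt_trans _ _ (N.+1%:R * M * `|x - y|)).
  by rewrite -!mulrA ler_wpM2r ?mulr_ge0 ?(ltW M0)// ler_nat.
by rewrite mulrC -ltr_pdivlMr// mulr_gt0.
Qed.

Lemma smooth_continuous phi : smooth phi -> continuous phi.
Proof. by move=> /(_ [::]) /C1_continuous. Qed.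

Lemma smooth_partial_continuous phi k : smooth phi -> continuous (partial k phi).
Proof. by move=> /(_ [:: k]) /C1_continuous. Qed.

End C1_functions.

(** * A smooth truncation *)

Section soft_truncation.
Variables (R : realType) (k e : R).
Hypothesis e0 : 0 < e.
Implicit Types s t : R.

Definition soft_root s : R := Num.sqrt ((s - k) ^+ 2 + e ^+ 2).

(** Half of [(s - k) + sqrt ((s - k) ^ 2 + e ^ 2)] is a smooth version of
    [Num.max 0 (s - k)]; the shift makes it vanish at [0], so that composing
    with it does not enlarge supports. *)
Definition soft_trunc s : R :=
  2^-1 * ((s - k) + soft_root s) - 2^-1 * (soft_root 0 - k).

(** The derivative of [soft_trunc]: a smooth version of the indicator of
    [k < s]. *)
Definition soft_step s : R := 2^-1 * (1 + (s - k) / soft_root s).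

Lemma soft_root_gt0 s : 0 < soft_root s.
Proof. by rewrite sqrtr_gt0 ltr_wpDl ?sqr_ge0// exprn_gt0. Qed.

Lemma sqr_soft_root s : soft_root s ^+ 2 = (s - k) ^+ 2 + e ^+ 2.
Proof. by rewrite sqr_sqrtr// addr_ge0// sqr_ge0. Qed.

Lemma soft_root_bounds s :
  `|s - k| <= soft_root s /\ soft_root s <= `|s - k| + e.
Proof.
split.
  by rewrite -sqrtr_sqr ler_wsqrtr// lerDl sqr_ge0.
rewrite -(@ler_pXn2r _ 2)// ?nnegrE ?(ltW (soft_root_gt0 _)) ?addr_ge0 ?(ltW e0)//.
rewrite sqr_soft_root [leRHS]sqrrD real_normK ?num_real//.
by rewrite lerD2r lerDl mulrn_wge0// mulr_ge0// (ltW e0).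
Qed.

Lemma is_derive_soft_root s : is_derive s 1 soft_root ((s - k) / soft_root s).
Proof.
have h : is_derive s 1 (fun s : R => (s - k) ^+ 2 + e ^+ 2) (2 * (s - k)).
  by apply: is_derive_eq; rewrite /GRing.scale/=; ring.
have r0 : 0 < (s - k) ^+ 2 + e ^+ 2 by rewrite ltr_wpDl ?sqr_ge0// exprn_gt0.
apply: is_derive_ext (is_derive_comp1 (f := fun s => (s - k) ^+ 2 + e ^+ 2)
  (is_derive1_sqrt r0) h) _.
rewrite -/(soft_root s); field; exact/lt0r_neq0/soft_root_gt0.
Qed.

Lemma is_derive_soft_root_inv s :
  is_derive s 1 (fun s => (soft_root s)^-1) (- (s - k) * (soft_root s)^-1 ^+ 3).
Proof.
have r0 := lt0r_neq0 (soft_root_gt0 s).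
apply: is_derive_ext (is_deriveV r0 (is_derive_soft_root s)) _.
by rewrite /GRing.scale/=; field.
Qed.

Lemma is_derive_soft_trunc s : is_derive s 1 soft_trunc (soft_step s).
Proof.
have h := is_derive_soft_root s.
by apply: is_derive_eq; rewrite /soft_step /GRing.scale/=; field; exact/lt0r_neq0/soft_root_gt0.
Qed.

Lemma soft_step_bounds s : 0 <= soft_step s <= 1.
Proof.
have r0 := soft_root_gt0 s; have [h _] := soft_root_bounds s.
have : `|(s - k) / soft_root s| <= 1.
  by rewrite normrM normfV (gtr0_norm r0) ler_pdivrMr// mul1r.
rewrite ler_norml /soft_step; lra.
Qed.

Lemma soft_trunc_lipschitz s t : `|soft_trunc t - soft_trunc s| <= `|t - s|.
Proof.
have [c _ ->] := mean_value s t is_derive_soft_trunc.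
rewrite normrM ger0_norm; last by have /andP[] := soft_step_bounds c.
by rewrite ler_piMl//; have /andP[] := soft_step_bounds c.
Qed.

Lemma soft_trunc0 : soft_trunc 0 = 0.
Proof. by rewrite /soft_trunc sub0r [- k + _]addrC subrr. Qed.

Lemma soft_trunc_le s : `|soft_trunc s| <= `|s|.
Proof. by have := soft_trunc_lipschitz 0 s; rewrite soft_trunc0 !subr0. Qed.

Lemma soft_trunc_approx s : 0 <= k ->
  `|soft_trunc s - Num.max 0 (s - k)| <= e.
Proof.
move=> k0; have := soft_root_bounds s; have := soft_root_bounds 0.
rewrite sub0r normrN (ger0_norm k0) /soft_trunc; move: (soft_root 0) (soft_root s) e0.
move=> a b e0' [a1 a2]; have [sk|sk] := leP 0 (s - k).
  by rewrite (ger0_norm sk) => -[b1 b2]; rewrite ler_norml; lra.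
by rewrite (ltr0_norm sk) => -[b1 b2]; rewrite ler_norml; lra.
Qed.

Lemma continuous_soft_step : continuous soft_step.
Proof.
move=> s; apply/differentiable_continuous/derivable1_diffP.
have h := is_derive_soft_root_inv s.
have : is_derive s 1 soft_step (2^-1 * ((soft_root s)^-1 +
    (s - k) * (- (s - k) * (soft_root s)^-1 ^+ 3))).
  by apply: is_derive_eq; rewrite /GRing.scale/=; ring.
by case.
Qed.

End soft_truncation.

Section smooth_truncation.
Variables (R : realType) (N : nat) (k e : R) (phi : 'rV[R]_N -> R).
Hypotheses (e0 : 0 < e) (sphi : smooth phi).
Implicit Types f g : 'rV[R]_N -> R.

(** The algebra generated by the partial derivatives of [phi] and by the
    inverse of [soft_root k e \o phi] is stable under partial derivatives,
    hence made of smooth functions, and it contains the truncation of [phi]. *)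
Inductive trunc_algebra : ('rV[R]_N -> R) -> Prop :=
| trunc_partial s : trunc_algebra (foldr (@partial R N) phi s)
| trunc_root_inv : trunc_algebra (fun x => (soft_root k e (phi x))^-1)
| trunc_cst c : trunc_algebra (cst c)
| trunc_add f g : trunc_algebra f -> trunc_algebra g -> trunc_algebra (fun x => f x + g x)
| trunc_mul f g : trunc_algebra f -> trunc_algebra g -> trunc_algebra (fun x => f x * g x).

Let trunc_derivable f j x : trunc_algebra f ->
  derivable f x (delta_mx ord0 j).
Proof.
move=> Pf; elim: Pf x => [s x|x|c x|f1 g1 _ h1 _ h2 x|f1 g1 _ h1 _ h2 x].
- by case: (C1_is_derive j x (sphi s)).
- by case: (is_derive_comp1 (is_derive_soft_root_inv k e0 (phi x)) (C1_is_derive j x (sphi [::]))).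
- exact: derivable_cst.
- exact: derivableD.
- exact: derivableM.
Qed.

Let trunc_partial_closed f j : trunc_algebra f -> trunc_algebra (partial j f).
Proof.
move=> Pf; elim: (Pf) => [s||c|f1 g1 Pf1 h1 Pg1 h2|f1 g1 Pf1 h1 Pg1 h2].
- exact: (trunc_partial (j :: s)).
- rewrite (_ : partial j _ = fun x => (k + (-1) * phi x) *
     ((soft_root k e (phi x))^-1 * ((soft_root k e (phi x))^-1 * (soft_root k e (phi x))^-1))
      * partial j phi x).
    do ![exact: trunc_root_inv|exact: trunc_cst|exact: (trunc_partial [::])
      |exact: (trunc_partial [:: j])|apply: trunc_mul|apply: trunc_add].
  apply/funext => x.
  have := is_derive_comp1 (is_derive_soft_root_inv k e0 (phi x)) (C1_is_derive j x (sphi [::])).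
  by move=> [_]; rewrite /partial/= => ->; ring.
- rewrite (_ : partial j _ = cst 0); first exact: trunc_cst.
  by apply/funext => x; rewrite /partial derive_cst.
- rewrite (_ : partial j _ = fun x => partial j f1 x + partial j g1 x); first exact: trunc_add.
  by apply/funext => x; rewrite /partial deriveD//; exact: trunc_derivable.
- rewrite (_ : partial j _ = fun x => f1 x * partial j g1 x + g1 x * partial j f1 x).
    by apply: trunc_add; apply: trunc_mul.
  by apply/funext => x; rewrite /partial deriveM//; exact: trunc_derivable.
Qed.

Let trunc_continuous f : trunc_algebra f -> continuous f.
Proof.
move=> Pf; elim: Pf => [s||c|f1 g1 _ h1 _ h2|f1 g1 _ h1 _ h2] x.
- exact: C1_continuous.
- apply: (@continuous_comp _ _ _ phi (fun s => (soft_root k e s)^-1)).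
    exact: smooth_continuous.
  by apply/differentiable_continuous/derivable1_diffP; case: (is_derive_soft_root_inv k e0 (phi x)).
- exact: cst_continuous.
- by apply: continuousD; [exact: h1|exact: h2].
- by apply: continuousM; [exact: h1|exact: h2].
Qed.

Let trunc_smooth f : trunc_algebra f -> smooth f.
Proof.
move=> Pf s; have {Pf} : trunc_algebra (foldr (@partial R N) f s).
  by elim: s => //= j s; exact: trunc_partial_closed.
move: (foldr _ _ _) => g Pg j x _; split; first exact: trunc_derivable.
exact/trunc_continuous/trunc_partial_closed.
Qed.

Lemma smooth_soft_trunc : smooth (soft_trunc k e \o phi).
Proof.
rewrite (_ : _ \o _ = fun x => 2^-1 * ((phi x + - k) +
   ((phi x + - k) * (phi x + - k) + e ^+ 2) * (soft_root k e (phi x))^-1)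
   + - (2^-1 * (soft_root k e 0 - k))).
  apply: trunc_smooth.
  do ![exact: trunc_root_inv|exact: trunc_cst|exact: (trunc_partial [::])
      |apply: trunc_add|apply: trunc_mul].
apply/funext => x; rewrite /= /soft_trunc; congr (_ * (_ + _) - _).
rewrite -!expr2 -(sqr_soft_root k e) expr2 mulfK//; exact/lt0r_neq0/soft_root_gt0.
Qed.

Lemma partial_soft_trunc j x :
  partial j (soft_trunc k e \o phi) x = soft_step k e (phi x) * partial j phi x.
Proof.
by have [_] := is_derive_comp1 (is_derive_soft_trunc k e0 (phi x)) (C1_is_derive j x (sphi [::])).
Qed.

End smooth_truncation.

Lemma Xgrad_soft_trunc (R : realType) (N d : nat) (X : 'I_d -> 'rV[R]_N -> 'rV[R]_N)
    (k e : R) (phi : 'rV[R]_N -> R) x : 0 < e -> smooth phi ->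
  Xgrad X (soft_trunc k e \o phi) x = soft_step k e (phi x) *: Xgrad X phi x.
Proof.
move=> e0 sphi; apply/rowP => j; rewrite !mxE mulr_sumr; apply: eq_bigr => i _.
by rewrite partial_soft_trunc//; ring.
Qed.

Lemma test_function_soft_trunc (R : realType) (N : nat) (Omega : set 'rV[R]_N)
    (k e : R) (phi : 'rV[R]_N -> R) : 0 < e ->
  test_function Omega phi -> test_function Omega (soft_trunc k e \o phi).
Proof.
move=> e0 [sphi cphi phiO].
have sub : closure [set x | (soft_trunc k e \o phi) x != 0] `<=`
    closure [set x | phi x != 0].
  apply: closureS => x /=; apply: contra => /eqP ->.
  by rewrite soft_trunc0.
split; first exact: smooth_soft_trunc.
  by apply: subclosed_compact sub => //; exact: closed_closure.
exact: subset_trans phiO.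
Qed.

Lemma continuous_bigsum (R : realType) (N : nat) (I : Type) (s : seq I)
    (F : I -> 'rV[R]_N -> R) x : (forall i, {for x, continuous (F i)}) ->
  {for x, continuous (fun y => \sum_(i <- s) F i y)}.
Proof.
move=> cF; elim: s => [|i s IH].
  have -> : (fun y => \sum_(i <- [::]) F i y) = cst 0.
    by apply/funext => y; rewrite big_nil.
  exact: cst_continuous.
have -> : (fun y => \sum_(j <- i :: s) F j y) = (fun y => F i y + \sum_(j <- s) F j y).
  by apply/funext => y; rewrite big_cons.
by apply: continuousD; [exact: cF|exact: IH].
Qed.

Section test_functions.
Variables (R : realType) (N d : nat) (X : 'I_d -> 'rV[R]_N -> 'rV[R]_N).
Variables (Omega : set 'rV[R]_N) (phi : 'rV[R]_N -> R).
Hypotheses (lipX : forall j, locally_lipschitz (X j)) (tphi : test_function Omega phi).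

Lemma test_function_continuous : continuous phi.
Proof. by case: tphi => /smooth_continuous. Qed.

Lemma test_function_out x : ~ Omega x -> phi x = 0.
Proof.
case: tphi => _ _ suppO; apply: contra_notP => /eqP phix.
exact/suppO/subset_closure.
Qed.

Lemma test_function_bounded : exists M, forall x, `|phi x| <= M.
Proof.
case: tphi => sphi cphi _.
have /compact_bounded[D [_ /(_ (`|D| + 1))]] : compact (phi @` closure [set x | phi x != 0]).
  by apply: continuous_compact => //; exact/continuous_subspaceT/smooth_continuous.
rewrite (le_lt_trans (ler_norm _)) ?ltrDl// => /(_ isT) h.
exists (`|D| + 1) => x; have [->|phix] := eqVneq (phi x) 0.
  by rewrite normr0 addr_ge0.
by apply: h; exists x => //; exact: subset_closure.
Qed.

Lemma Xgrad_out_support x : ~ closure [set x | phi x != 0] x -> Xgrad X phi x = 0.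
Proof.
move=> xC; have oC : open (~` closure [set x | phi x != 0]).
  exact/closed_openC/closed_closure.
have near0 : \forall y \near x, phi y = 0.
  apply: (@filterS _ _ (nbhs_filter x) _ _ _ (open_nbhs_nbhs (conj oC xC))) => y.
  by apply: contra_notP => /eqP ?; exact: subset_closure.
apply/rowP => j; rewrite !mxE big1// => i _; rewrite /partial.
by rewrite (near_eq_derive (g := cst 0))// derive_cst mulr0.
Qed.

Lemma Xgrad_out x : ~ Omega x -> Xgrad X phi x = 0.
Proof. by case: tphi => _ _ suppO xO; apply: Xgrad_out_support => /suppO. Qed.

(** The fields are only Lipschitz, which gives the continuity of [X phi] and
    nothing more. *)
Lemma Xgrad_continuous j : continuous (fun x => Xgrad X phi x ord0 j).
Proof.
case: tphi => sphi _ _ x.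
rewrite (_ : (fun x => _) = fun x => \sum_(k < N) X j x ord0 k * partial k phi x); last first.
  by apply/funext => y; rewrite mxE.
apply: continuous_bigsum => k.
apply: continuousM; last exact: smooth_partial_continuous.
apply: (@continuous_comp _ _ _ (X j) (fun y => y ord0 k)); last exact: coord_continuous.
have [U Ux [M [_ /(_ (`|M| + 1))]]] := lipX j x.
rewrite (le_lt_trans (ler_norm _)) ?ltrDl// => /(_ isT) h.
have M1 : 0 < `|M| + 1 by rewrite ltr_wpDl.
apply/(@cvgrPdist_lt _ _ _ (nbhs x) (nbhs_filter x)) => e e0.
have xe : nbhs x (ball x (e / (`|M| + 1))) by apply: nbhsx_ballx; rewrite divr_gt0.
apply: (@filterS _ _ (nbhs_filter x) _ _ _ (@filterI _ _ (nbhs_filter x) _ _ Ux xe)) => y [Uy].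
rewrite mx_norm_ball /ball_/= ltr_pdivlMr// mulrC; apply: le_lt_trans.
by apply: (h (x, y)); split=> //; exact: nbhs_singleton.
Qed.

Lemma enorm_Xgrad_continuous : continuous (fun x => enorm (Xgrad X phi x)).
Proof.
move=> x; apply: (@continuous_comp _ _ _ (fun x => dotv (Xgrad X phi x) (Xgrad X phi x)) Num.sqrt).
  apply: continuous_bigsum => j.
  by apply: continuousM; exact: Xgrad_continuous.
exact: sqrt_continuous.
Qed.

Lemma enorm_Xgrad_bounded : exists M, forall x, `|enorm (Xgrad X phi x)| <= M.
Proof.
case: tphi => _ cphi _.
have /compact_bounded[D [_ /(_ (`|D| + 1))]] :
    compact ((fun x => enorm (Xgrad X phi x)) @` closure [set x | phi x != 0]).
  by apply: continuous_compact => //; exact/continuous_subspaceT/enorm_Xgrad_continuous.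
rewrite (le_lt_trans (ler_norm _)) ?ltrDl// => /(_ isT) h.
exists (`|D| + 1) => x; have [xC|xC] := pselect (closure [set x | phi x != 0] x).
  by apply: h; exists x.
by rewrite Xgrad_out_support// enorm0 normr0 addr_ge0.
Qed.

End test_functions.

(** * Averages over balls *)

Section averages.
Variables (R : realType) (N d : nat) (X : 'I_d -> 'rV[R]_N -> 'rV[R]_N) (Q : R).
Hypotheses (conn : cc_connected X) (topo : cc_topology X) (dbl : doubling X Q).
Implicit Types (x y z : 'rV[R]_N) (r s : R) (f g u : 'rV[R]_N -> R).
Local Notation B := (cc_ball X).
Local Notation vol x r := (fine (lebesgueN (cc_ball X x r))).
Local Notation avg x r f := (average (cc_ball X x r) f).
Let mu := @lebesgueN R N.

Definition bounded_measurable f :=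
  measurable_fun setT f /\ exists M, forall x, `|f x| <= M.

Lemma bounded_measurable_integrable f x r :
  bounded_measurable f -> mu.-integrable (B x r) (EFin \o f).
Proof.
move=> [mf [M fM]]; apply: measurable_bounded_integrable.
- exact: cc_ball_measurable.
- by rewrite -ge0_fin_numE ?measure_ge0//; exact: (lebesgueN_cc_ball_fin conn topo dbl).
- exact: measurable_funS mf.
- by exists M; split=> [|t Mt y _]; [exact: num_real|exact: le_trans (ltW Mt)].
Qed.

Lemma bounded_measurable_cst c : bounded_measurable (cst c).
Proof. by split; [exact: measurable_cst|exists `|c|]. Qed.

Lemma bounded_measurableB f g : bounded_measurable f -> bounded_measurable g ->
  bounded_measurable (fun x => f x - g x).
Proof.
move=> [mf [M fM]] [mg [L gL]]; split; first exact: measurable_funB.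
by exists (M + L) => x; rewrite (le_trans (ler_normB _ _))// lerD.
Qed.

Lemma bounded_measurableD f g : bounded_measurable f -> bounded_measurable g ->
  bounded_measurable (fun x => f x + g x).
Proof.
move=> [mf [M fM]] [mg [L gL]]; split; first exact: measurable_funD.
by exists (M + L) => x; rewrite (le_trans (ler_normD _ _))// lerD.
Qed.

Lemma bounded_measurableZ c f : bounded_measurable f ->
  bounded_measurable (fun x => c * f x).
Proof.
move=> [mf [M fM]]; split; first exact: measurable_funM.
by exists (`|c| * M) => x; rewrite normrM ler_wpM2l.
Qed.

Lemma bounded_measurable_norm f : bounded_measurable f ->
  bounded_measurable (fun x => `|f x|).
Proof.
move=> [mf [M fM]]; split; first exact: measurableT_comp.
by exists M => x; rewrite normr_id.
Qed.

Lemma bounded_measurable_powR f p : 0 <= p -> (forall x, 0 <= f x) ->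
  bounded_measurable f -> bounded_measurable (fun x => f x `^ p).
Proof.
move=> p0 f0 [mf [M fM]]; split; first exact: (measurableT_comp (measurable_powR _) mf).
exists (M `^ p) => x; rewrite ger0_norm ?powR_ge0// ge0_ler_powR ?nnegrE//.
  exact: le_trans (normr_ge0 (f x)) (fM x).
exact: le_trans (ler_norm _) (fM x).
Qed.

Section fixed_ball.
Variables (x : 'rV[R]_N) (r : R).
Hypothesis r0 : 0 < r.

Let v0 : 0 < vol x r. Proof. exact: (cc_vol_gt0 conn topo dbl). Qed.
Let mB : measurable (B x r). Proof. exact: cc_ball_measurable. Qed.

Lemma average_cst c : avg x r (cst c) = c.
Proof. by rewrite /average Rintegral_cst// mulfK// lt0r_neq0. Qed.

Lemma le_average f g : bounded_measurable f -> bounded_measurable g ->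
  (forall y, B x r y -> f y <= g y) -> avg x r f <= avg x r g.
Proof.
move=> bf bg fg; rewrite /average ler_pM2r ?invr_gt0//.
by apply: le_Rintegral => //; exact: bounded_measurable_integrable.
Qed.

Lemma average_ge0 f : (forall y, 0 <= f y) -> 0 <= avg x r f.
Proof. by move=> f0; rewrite divr_ge0 ?Rintegral_ge0 ?(ltW v0). Qed.

Lemma averageB f c : bounded_measurable f ->
  avg x r (fun y => f y - c) = avg x r f - c.
Proof.
move=> bf; rewrite /average RintegralB ?mulrBl//.
- by rewrite -[in RHS](average_cst c).
- exact: bounded_measurable_integrable.
- exact: (bounded_measurable_integrable _ _ (bounded_measurable_cst c)).
Qed.

Lemma averageD f g : bounded_measurable f -> bounded_measurable g ->
  avg x r (fun y => f y + g y) = avg x r f + avg x r g.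
Proof.
by move=> bf bg; rewrite /average RintegralD ?mulrDl//; exact: bounded_measurable_integrable.
Qed.

Lemma averageZ f c : bounded_measurable f ->
  avg x r (fun y => c * f y) = c * avg x r f.
Proof.
by move=> bf; rewrite /average RintegralZl ?mulrA//; exact: bounded_measurable_integrable.
Qed.

Lemma normr_average_le f : bounded_measurable f ->
  `|avg x r f| <= avg x r (fun y => `|f y|).
Proof.
move=> bf; rewrite normrM normfV (gtr0_norm v0) ler_pM2r ?invr_gt0//.
by apply: le_normr_Rintegral => //; exact: bounded_measurable_integrable.
Qed.

(** Jensen's inequality up to a factor 2, from the pointwise bound
    [f <= t + t `^ (1 - p) * f `^ p] with [t] the [p]-th root of the average
    of [f `^ p]. *)
Lemma average_le_powR f p : 1 < p -> (forall y, 0 <= f y) ->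
  bounded_measurable f ->
  avg x r f <= 2 * (avg x r (fun y => f y `^ p)) `^ p^-1.
Proof.
move=> p1 f0 bf; have p0 : 0 < p by rewrite (lt_trans _ p1).
have bfp := bounded_measurable_powR (ltW p0) f0 bf.
set A := avg x r (fun y => f y `^ p).
have A0 : 0 <= A by apply: average_ge0 => y; exact: powR_ge0.
have key t : 0 < t -> avg x r f <= t + t `^ (1 - p) * A.
  move=> t0; rewrite -averageZ// -[t in t + _]average_cst -averageD//; last 2 first.
  - exact: bounded_measurable_cst.
  - exact: bounded_measurableZ.
  apply: le_average => //.
    by apply: bounded_measurableD; [exact: bounded_measurable_cst|exact: bounded_measurableZ].
  move=> y _ /=; have [ft|tf] := leP (f y) t.
    by rewrite ler_wpDr// mulr_ge0// powR_ge0.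
  have fy0 := lt_trans t0 tf.
  rewrite ler_wpDl ?(ltW t0)// [leLHS](_ : _ = f y `^ (1 - p) * f y `^ p); last first.
    by rewrite -powRD ?(gt_eqF fy0) ?implybT// subrK powRr1// ltW.
  rewrite ler_wpM2r ?powR_ge0//.
  rewrite -opprB !powRN lef_pV2 ?posrE ?powR_gt0// ge0_ler_powR ?nnegrE ?subr_ge0//;
    exact: ltW.
have [A00|A00] := eqVneq A 0.
  rewrite A00 powR0 ?invr_eq0 ?lt0r_neq0// mulr0.
  by apply/ler_addgt0Pr => e e0; have := key e e0; rewrite A00 mulr0 add0r addr0.
have {}A0 : 0 < A by rewrite lt_def A00.
apply: le_trans (key (A `^ p^-1) (powR_gt0 _ A0)) _.
rewrite -powRrM -[A in _ * A]powRr1 ?(ltW A0)// -powRD ?(lt0r_neq0 A0) ?implybT//.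
rewrite (_ : _ + 1 = p^-1); first by rewrite mulrDl mul1r.
by field; exact: lt0r_neq0.
Qed.

End fixed_ball.

(** The integral over the smaller ball is at most that over the larger one, and the
    ratio of the volumes makes up for the normalizations. *)
Lemma average_sub_ball f K x r y s : 0 < r -> 0 < s ->
  bounded_measurable f -> (forall w, 0 <= f w) ->
  B y s `<=` B x r -> vol x r <= K * vol y s -> avg y s f <= K * avg x r f.
Proof.
move=> r0 s0 [mf bf] f0 sub volK.
have vx : 0 < vol x r by exact: (cc_vol_gt0 conn topo dbl).
have vy : 0 < vol y s by exact: (cc_vol_gt0 conn topo dbl).
rewrite /average ler_pdivrMr// mulrAC mulrA ler_pdivlMr//.
apply: (@le_trans _ _ (Rintegral mu (B x r) f * vol x r)).
  rewrite ler_wpM2r ?(ltW vx)// fine_le//.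
  - by apply: integrable_fin_num; [exact: cc_ball_measurable|exact: bounded_measurable_integrable].
  - by apply: integrable_fin_num; [exact: cc_ball_measurable|exact: bounded_measurable_integrable].
  - apply: ge0_subset_integral => //; first exact: cc_ball_measurable.
    + exact: cc_ball_measurable.
    + by apply/measurable_EFinP; exact: measurable_funS mf.
    + by move=> w _; rewrite lee_fin.
rewrite [leRHS](_ : _ = Rintegral mu (B x r) f * (K * vol y s)); last by ring.
by rewrite ler_wpM2l// Rintegral_ge0.
Qed.

Lemma average_cvg u x : continuous u -> bounded_measurable u ->
  forall e, 0 < e -> exists2 rho, 0 < rho &
    forall r, 0 < r -> r < rho -> `|avg x r u - u x| <= e.
Proof.
move=> cu bu e e0.
have /cvgrPdist_le/(_ e e0)/nbhs_ballP[eps /= eps0 epsP] := cu x.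
have [rho rho0 rhoP] := enorm_small conn topo x eps0.
exists rho => // r r0 rrho.
rewrite -averageB//.
apply: le_trans (normr_average_le _ _ _) _ => //.
  exact: (bounded_measurableB bu (bounded_measurable_cst (u x))).
rewrite -[leRHS](@average_cst x r r0); apply: (le_average r0).
- exact/bounded_measurable_norm/(bounded_measurableB bu (bounded_measurable_cst (u x))).
- exact: bounded_measurable_cst.
move=> y /= xy; rewrite distrC; apply: epsP.
rewrite mx_norm_ball /ball_/= distrC (le_lt_trans (mx_norm_le_enorm _))// rhoP//.
exact: lt_trans xy rrho.
Qed.

End averages.

(** * Chains of balls *)

Section chains.
Variables (R : realType) (N d : nat) (X : 'I_d -> 'rV[R]_N -> 'rV[R]_N) (Q : R).
Hypotheses (conn : cc_connected X) (topo : cc_topology X) (dbl : doubling X Q).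
Implicit Types (x y z : 'rV[R]_N) (r s : R) (f g u : 'rV[R]_N -> R).
Local Notation B := (cc_ball X).
Local Notation vol x r := (fine (lebesgueN (cc_ball X x r))).
Local Notation avg x r f := (average (cc_ball X x r) f).
Let mu := @lebesgueN R N.

Let vol_gt0 x r : 0 < r -> 0 < vol x r.
Proof. exact: (cc_vol_gt0 conn topo dbl). Qed.

(** The Poincare inequality of the pair [u], [g] with a dilation factor
    [2 ^+ a], so that only dyadic multiples of a radius ever occur. *)
Definition dyadic_poincare (CP : R) (a : nat) u g := forall x r, 0 < r ->
  avg x r (fun y => `|u y - avg x r u|) <= CP * r * avg x (2 ^+ a * r) g.

(** The dilated ball is enlarged to a dyadic one; doubling compares the two
    averages. *)
Lemma poincare_dyadic : poincare X -> exists CP a, 0 < CP /\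
  forall u, C1_on setT u -> bounded_measurable u ->
    bounded_measurable (fun x => enorm (Xgrad X u x)) ->
    dyadic_poincare CP a u (fun x => enorm (Xgrad X u x)).
Proof.
move=> [CP [nu [CP0 nu0 HP]]].
have [a nua] := le_pow2 nu; have [b ab] := le_pow2 (2 ^+ a / nu).
exists (CP * (2 `^ Q) ^+ b), a; split.
  by rewrite mulr_gt0// exprn_gt0// powR_gt0.
move=> u Cu bu bg x r r0; pose g y := enorm (Xgrad X u y).
have nur : 0 < nu * r by rewrite mulr_gt0.
have ar : 0 < 2 ^+ a * r by rewrite mulr_gt0// exprn_gt0.
have bum : bounded_measurable (fun y => `|u y - avg x r u|).
  exact/bounded_measurable_norm/(bounded_measurableB bu (bounded_measurable_cst _ _)).
have EI f y t : bounded_measurable f ->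
    (\int[mu]_(z in B y t) (f z)%:E)%E = (Rintegral mu (B y t) f)%:E.
  move=> bf; rewrite /Rintegral fineK//.
  exact: (integrable_fin_num (cc_ball_measurable conn topo y t)
    (bounded_measurable_integrable conn topo dbl y t bf)).
have hU : exists U, [/\ open U, closure (B x (nu * r)) `<=` U & C1_on U u].
  by exists setT; split=> //; exact: openT.
have /= := HP x r u r0 hU.
rewrite -/mu (EI (fun z => `|u z - avg x r u|))// (EI (fun y => enorm (Xgrad X u y)))// -!EFinM lee_fin.
rewrite mulrC -/(average _ _) => /le_trans; apply.
rewrite [leRHS](_ : _ = CP * r * ((2 `^ Q) ^+ b * avg x (2 ^+ a * r) g)); last first.
  by rewrite /g; ring.
rewrite ler_pM2l ?mulr_gt0// mulrC -/(average _ _).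
apply: (average_sub_ball conn topo dbl) => //.
- by move=> w; exact: enorm_ge0.
- by apply: cc_ball_subset; rewrite ler_wpM2r// ltW.
apply: le_trans (cc_vol_doubling conn topo dbl _ b nur).
apply: (le_cc_vol conn topo dbl); apply: cc_ball_subset.
by rewrite mulrA ler_wpM2r ?(ltW r0)// -ler_pdivrMr.
Qed.

Section one_pair.
Variables (CP : R) (a : nat) (u g : 'rV[R]_N -> R) (p : R).
Hypotheses (CP0 : 0 < CP) (p1 : 1 < p) (cu : continuous u).
Hypotheses (bu : bounded_measurable u) (bg : bounded_measurable g) (g0 : forall x, 0 <= g x).
Hypothesis HP : dyadic_poincare CP a u g.
Local Notation A x r := (avg x r (fun y => g y `^ p)).

Let p0 : 0 < p. Proof. exact: lt_trans p1. Qed.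
Let bgp : bounded_measurable (fun y => g y `^ p).
Proof. exact: bounded_measurable_powR (ltW p0) g0 bg. Qed.
Let A0 x r : 0 < r -> 0 <= A x r.
Proof. by move=> r0; apply: (average_ge0 conn topo dbl) => // y; exact: powR_ge0. Qed.

(** The oscillation of [u] between two nested comparable balls, by the Poincare
    inequality followed by Jensen's. *)
Lemma average_oscillation K x r y s : 0 < r -> 0 < s ->
  B y s `<=` B x r -> vol x r <= K * vol y s ->
  `|avg y s u - avg x r u| <= K * (CP * r * (2 * A x (2 ^+ a * r) `^ p^-1)).
Proof.
move=> r0 s0 sub volK.
have bum : bounded_measurable (fun y => u y - avg x r u).
  exact: (bounded_measurableB bu (bounded_measurable_cst _ _)).
have K0 : 0 < K by rewrite -(pmulr_lgt0 _ (vol_gt0 y s0)) (lt_le_trans (vol_gt0 x r0)).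
rewrite -(averageB conn topo dbl)//.
apply: le_trans (normr_average_le conn topo dbl _ s0 bum) _.
apply: le_trans (average_sub_ball conn topo dbl r0 s0
  (bounded_measurable_norm bum) (fun=> normr_ge0 _) sub volK) _.
rewrite ler_pM2l//; apply: le_trans (HP x r0) _.
rewrite ler_pM2l ?mulr_gt0//; apply: (average_le_powR conn topo dbl) => //.
by rewrite mulr_gt0// exprn_gt0.
Qed.

(** The averages of [u] over the balls of radius [r / 2 ^+ i] converge to [u x];
    their successive differences are controlled by the oscillation estimate,
    and the assumed geometric decay makes the telescoping sum converge. *)
Lemma chain_estimate x r H theta : 0 < r -> 0 <= H -> 0 <= theta < 1 ->
  (forall i, r / 2 ^+ i * A x (2 ^+ a * (r / 2 ^+ i)) `^ p^-1 <= H * theta ^+ i) ->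
  `|u x - avg x r u| <= 2 `^ Q * CP * 2 * (H / (1 - theta)).
Proof.
move=> r0 H0 /andP[th0 th1] hi.
set K := 2 `^ Q * CP * 2.
have K0 : 0 <= K by rewrite !mulr_ge0 ?powR_ge0 ?(ltW CP0).
have ri i : 0 < r / 2 ^+ i by rewrite divr_gt0// exprn_gt0.
have step i : `|avg x (r / 2 ^+ i.+1) u - avg x (r / 2 ^+ i) u| <= K * (H * theta ^+ i).
  have e2 : r / 2 ^+ i = 2 ^+ 1 * (r / 2 ^+ i.+1).
    by rewrite expr1 exprS; field; rewrite expf_neq0.
  apply: le_trans (average_oscillation (K := 2 `^ Q) (ri i) (ri i.+1) _ _) _.
  - apply: cc_ball_subset; rewrite e2 expr1 ler_peMl ?(ltW (ri _))// ler1n//.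
  - rewrite [in leLHS]e2 (le_trans (cc_vol_doubling conn topo dbl _ 1 (ri _)))//.
  rewrite [leLHS](_ : _ = K * (r / 2 ^+ i * A x (2 ^+ a * (r / 2 ^+ i)) `^ p^-1)).
    by rewrite ler_wpM2l.
  by rewrite /K; ring.
have part n : `|avg x (r / 2 ^+ n) u - avg x r u| <= K * (H / (1 - theta)).
  apply: (@le_trans _ _ (\sum_(0 <= i < n) K * (H * theta ^+ i))).
    have := telescope_sumr (fun i => avg x (r / 2 ^+ i) u) (leq0n n).
    rewrite expr0 divr1 => <-; apply: le_trans (ler_norm_sum _ _ _) _.
    by apply: ler_sum => i _; exact: step.
  rewrite -mulr_sumr ler_wpM2l// -mulr_sumr ler_wpM2l//.
  rewrite -[leRHS]mul1r ler_pdivlMr ?subr_gt0// mulrC big_mkord.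
  by rewrite -opprB mulNr -subrX1 opprB lerBlDr lerDl exprn_ge0.
apply/ler_addgt0Pr => e e0.
have [rho rho0 rhoP] := average_cvg conn topo dbl x cu bu e0.
have [n rn] := le_pow2 (r / rho + 1).
have := part n; have := rhoP _ (ri n); rewrite ltr_pdivrMr ?exprn_gt0// => /(_ _).
have -> : r < rho * 2 ^+ n.
  by rewrite mulrC -ltr_pdivrMr// (lt_le_trans _ rn)// ltrDl.
move=> /(_ isT) h1 h2; rewrite distrC in h1.
rewrite -[u x](subrK (avg x (r / 2 ^+ n) u)) -addrA addrC.
by rewrite (le_trans (ler_normD _ _))// lerD.
Qed.

Variables (z : 'rV[R]_N) (rho R0 Gamma : R).
Hypotheses (rho0 : 0 < rho) (R00 : 0 < R0) (rhoR : rho <= R0).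
Hypothesis GammaP : forall x r, 0 < r -> vol x r * A x r <= Gamma.
Hypothesis uz : forall y, B z rho y -> u y = 0.

Let Gamma0 : 0 <= Gamma.
Proof.
by apply: le_trans (GammaP z rho0); rewrite mulr_ge0 ?A0// ltW ?vol_gt0.
Qed.

Let A_le x r c : 0 < r -> 0 < c -> c <= vol x r -> A x r <= Gamma / c.
Proof.
move=> r0 c0 cx; rewrite ler_pdivlMr//; apply: le_trans (GammaP x r0).
by rewrite mulrC ler_wpM2r ?A0.
Qed.

(** Since [u] vanishes on [B z rho], its averages over the large balls are
    differences of averages; the chain goes from [B x R0] to [B z (2 * R0)] and
    down to [B z rho]. *)
Lemma average_far x : cc_dist X z x <= R0 ->
  `|avg x R0 u| <= ((2 `^ Q) ^+ 2 + vol z (2 * R0) / vol z rho) *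
    (CP * (2 * R0) * (2 * (Gamma / vol z rho) `^ p^-1)).
Proof.
move=> zx; have R20 : 0 < 2 * R0 by rewrite mulr_gt0.
have aR : 0 < 2 ^+ a * (2 * R0) by rewrite mulr_gt0// exprn_gt0.
have r2 : 2 * R0 <= 2 ^+ a * (2 * R0).
  by rewrite ler_peMl ?(ltW R20)// exprn_ege1// ler1n.
have rR : rho <= 2 * R0 by move: R00 rhoR; lra.
have AR : A z (2 ^+ a * (2 * R0)) `^ p^-1 <= (Gamma / vol z rho) `^ p^-1.
  rewrite ge0_ler_powR ?invr_ge0 ?nnegrE ?A0 ?divr_ge0 ?(ltW p0) ?(ltW (vol_gt0 _ _))//.
  apply: A_le => //; first exact: vol_gt0.
  by apply: (le_cc_vol conn topo dbl); apply: cc_ball_subset; exact: le_trans r2.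
have uz0 : avg z rho u = 0.
  rewrite /average (_ : Rintegral _ _ _ = Rintegral mu (B z rho) (cst 0)).
    by rewrite Rintegral_cst ?mul0r//; exact: cc_ball_measurable.
  by apply: eq_Rintegral => y; rewrite inE => /uz.
have step K y s : 0 < s -> B y s `<=` B z (2 * R0) -> vol z (2 * R0) <= K * vol y s ->
   `|avg y s u - avg z (2 * R0) u| <=
      K * (CP * (2 * R0) * (2 * (Gamma / vol z rho) `^ p^-1)).
  move=> s0 sub volK; apply: le_trans (average_oscillation R20 s0 sub volK) _.
  have K0 : 0 < K by rewrite -(pmulr_lgt0 _ (vol_gt0 y s0)) (lt_le_trans (vol_gt0 z R20)).
  by rewrite ler_pM2l// ler_pM2l ?mulr_gt0// ler_pM2l.
rewrite mulrDl -[avg x R0 u](subrK (avg z (2 * R0) u)).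
rewrite (le_trans (ler_normD _ _))// lerD//.
  apply: step => //; first by apply: (sub_cc_ball conn); lra.
  apply: le_trans (cc_vol_doubling conn topo dbl x 2 R00).
  apply: (le_cc_vol conn topo dbl); apply: (sub_cc_ball conn).
  by rewrite (cc_dist_sym X x); lra.
rewrite -normrN -sub0r -[in leLHS]uz0; apply: step => //; first exact: cc_ball_subset.
by rewrite divfK// lt0r_neq0// vol_gt0.
Qed.

(** There are two bounds on the averages of [g `^ p] along the chain: one by
    [Gamma] over the volume, which grows like [2 `^ (Q * i)], the other by [M]
    times [2 `^ (tau * q * i)]. Raising them to the powers [p^-1 - q^-1] and
    [q^-1] and multiplying, the radius [R0 / 2 ^+ i] wins exactly when
    [Q * (p^-1 - q^-1) < 1]; half of the margin is given to [M], and the factor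
    [2 `^ (- tau)] is left. *)
Lemma chain_pointwise q tau x M : p < q -> tau = (1 - Q * (p^-1 - q^-1)) / 2 ->
  0 < tau -> cc_dist X z x + rho <= R0 -> 0 <= M ->
  (forall i, A x (2 ^+ a * (R0 / 2 ^+ i)) <= M * (2 `^ (tau * q)) ^+ i) ->
  `|u x| <= 2 `^ Q * CP * 2 *
      (R0 * (vol z rho)^-1 `^ (p^-1 - q^-1) / (1 - 2 `^ (- tau))) *
      (Gamma `^ (p^-1 - q^-1) * M `^ q^-1) +
    ((2 `^ Q) ^+ 2 + vol z (2 * R0) / vol z rho) *
      (CP * (2 * R0) * (2 * (vol z rho)^-1 `^ p^-1)) * Gamma `^ p^-1.
Proof.
move=> pq tauE tau0 zx M0 hM.
have q0 : 0 < q by exact: lt_trans pq.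
set s := p^-1 - q^-1.
have s0 : 0 < s by rewrite subr_gt0 ltf_pV2 ?posrE.
have v0 : 0 < vol z rho by exact: vol_gt0.
have vV0 : 0 <= (vol z rho)^-1 by rewrite invr_ge0 ltW.
set H := R0 * (vol z rho)^-1 `^ s * (Gamma `^ s * M `^ q^-1).
have H0 : 0 <= H by rewrite !mulr_ge0 ?powR_ge0// ltW.
have th1 : 0 <= (2 : R) `^ (- tau) < 1.
  rewrite powR_ge0/= powRN invf_lt1 ?powR_gt0//.
  by rewrite -[ltLHS](congr1 (fun h => h tau) (powR1 R)) gt0_ltr_powR ?nnegrE// ltr1n.
have hi i : R0 / 2 ^+ i * A x (2 ^+ a * (R0 / 2 ^+ i)) `^ p^-1 <= H * (2 `^ (- tau)) ^+ i.
  have ri : 0 < R0 / 2 ^+ i by rewrite divr_gt0// exprn_gt0.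
  have ai : 0 < 2 ^+ a * (R0 / 2 ^+ i) by rewrite mulr_gt0// exprn_gt0.
  have b0 : 0 <= 2 `^ Q ^+ i by rewrite exprn_ge0// powR_ge0.
  have volx : vol z rho / 2 `^ Q ^+ i <= vol x (2 ^+ a * (R0 / 2 ^+ i)).
    rewrite ler_pdivrMr ?exprn_gt0 ?powR_gt0//.
    apply: (@le_trans _ _ (vol x R0)).
      apply: (le_cc_vol conn topo dbl); apply: (sub_cc_ball conn).
      by rewrite (cc_dist_sym X x).
    have e2 : R0 = 2 ^+ i * (R0 / 2 ^+ i) by rewrite mulrC divfK// expf_neq0.
    rewrite [in leLHS]e2 [leRHS]mulrC.
    apply: le_trans (cc_vol_doubling conn topo dbl _ _ ri) _.
    rewrite ler_wpM2l//; apply: (le_cc_vol conn topo dbl); apply: cc_ball_subset.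
    by rewrite ler_peMl ?(ltW ri)// exprn_ege1// ler1n.
  have A1 : A x (2 ^+ a * (R0 / 2 ^+ i)) <= Gamma * (vol z rho)^-1 * 2 `^ Q ^+ i.
    apply: le_trans (A_le ai _ volx) _; first by rewrite divr_gt0// exprn_gt0// powR_gt0.
    by rewrite invf_div mulrA mulrAC.
  have Ai0 := A0 x ai.
  have -> : p^-1 = s + q^-1 by rewrite subrK.
  rewrite powRD; last by rewrite subrK gt_eqF// invr_gt0.
  apply: (@le_trans _ _ (R0 / 2 ^+ i * ((Gamma * (vol z rho)^-1 * 2 `^ Q ^+ i) `^ s *
     (M * (2 `^ (tau * q)) ^+ i) `^ q^-1))).
    rewrite ler_wpM2l ?(ltW ri)// ler_pM ?powR_ge0//.
      by apply: ge0_ler_powR; rewrite ?nnegrE ?(ltW s0)// !mulr_ge0.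
    apply: ge0_ler_powR; rewrite ?nnegrE ?invr_ge0 ?(ltW q0)//.
    by rewrite mulr_ge0// exprn_ge0// powR_ge0.
  rewrite !powRM ?mulr_ge0 ?exprn_ge0 ?powR_ge0// !powR_exprn ?powR_ge0//.
  rewrite -!powRrM mulfK ?gt_eqF//.
  have -> : 2 `^ (- tau) = 2^-1 * 2 `^ (Q * s) * 2 `^ tau :> R.
    rewrite -powR_inv1// -!powRD ?pnatr_eq0 ?implybT//; congr powR.
    by rewrite tauE -/s; field.
  rewrite !exprMn exprVn /H le_eqVlt; apply/orP; left; apply/eqP; ring.
have zxR : cc_dist X z x <= R0.
  by rewrite (le_trans _ zx)// lerDl ltW.
have := lerD (chain_estimate R00 H0 th1 hi) (average_far zxR).
have := ler_normD (u x - avg x R0 u) (avg x R0 u); rewrite subrK.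
move=> /le_trans h /h; rewrite /H powRM//.
move=> /le_trans; apply; rewrite le_eqVlt; apply/orP; left; apply/eqP; ring.
Qed.

End one_pair.
End chains.

(** * Integrals of ball averages *)

Section average_integral.
Variables (R : realType) (N d : nat) (X : 'I_d -> 'rV[R]_N -> 'rV[R]_N) (Q : R).
Hypotheses (conn : cc_connected X) (topo : cc_topology X) (dbl : doubling X Q).
Variables (f : 'rV[R]_N -> R) (r : R).
Hypotheses (mf : measurable_fun setT f) (f0 : forall x, 0 <= f x) (r0 : 0 < r).
Local Notation B := (cc_ball X).
Local Notation vol x r := (fine (lebesgueN (cc_ball X x r))).
Local Notation mu := (@lebesgueN R N).

Let D : set ('rV[R]_N * 'rV[R]_N) := [set xy | cc_dist X xy.1 xy.2 < r].

Let mD : measurable D. Proof. exact: cc_dist_lt_measurable. Qed.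

Let measurable_vol : measurable_fun setT (fun x : 'rV[R]_N => vol x r).
Proof.
apply/measurable_EFinP; rewrite (_ : EFin \o _ = fun x => mu (xsection D x)).
  exact: (measurable_fun_xsection (lebesgueN : {sigma_finite_measure set _ -> \bar R}) mD).
apply/funext => x /=; rewrite (cc_volK conn topo dbl) xsectionE.
by congr mu; apply/seteqP; split.
Qed.

(** The inverse volume is written as a power, whose measurability is known. *)
Let kernel (xy : 'rV[R]_N * 'rV[R]_N) : \bar R :=
  ((vol xy.1 r) `^ (-1) * (\1_D xy * f xy.2))%:E.

Let kernel_ge0 xy : (0 <= kernel xy)%E.
Proof. by rewrite lee_fin mulr_ge0 ?powR_ge0// mulr_ge0. Qed.

Let measurable_kernel : measurable_fun setT kernel.
Proof.
apply/measurable_EFinP; apply: measurable_funM.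
  apply: (measurableT_comp (measurable_powR _)).
  exact: (measurableT_comp measurable_vol measurable_fst).
apply: measurable_funM; first exact/measurable_indicP.
exact: (measurableT_comp mf measurable_snd).
Qed.

Let kernel_fst x : (\int[mu]_y kernel (x, y) =
  ((vol x r)^-1)%:E * \int[mu]_(y in B x r) (f y)%:E)%E.
Proof.
rewrite [in RHS]integral_mkcond -ge0_integralZl_EFin ?invr_ge0 ?fine_ge0 ?measure_ge0//.
- apply: eq_integral => y _; rewrite /kernel/= powR_inv1 ?fine_ge0 ?measure_ge0//.
  rewrite EFinM; congr (_ * _)%E; rewrite patchE indicE.
  have -> : ((x, y) \in D) = (y \in B x r) by apply/idP/idP; rewrite !inE.
  by case: ifP => _; rewrite ?mul1r ?mul0r.
- by move=> y _; apply: erestrict_ge0 => z _; rewrite lee_fin.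
- apply/(measurable_restrictT _ _).1; first exact: cc_ball_measurable.
  by apply/measurable_EFinP; exact: measurable_funS mf.
Qed.

Lemma measurable_ball_average : measurable_fun setT (fun x =>
  ((vol x r)^-1)%:E * \int[mu]_(y in B x r) (f y)%:E)%E.
Proof.
have := measurable_fun_fubini_tonelli_F (m2 := mu) kernel measurable_kernel kernel_ge0.
by apply: eq_measurable_fun => x _; rewrite -kernel_fst.
Qed.

(** By Tonelli's theorem each value [f y] is counted with the weight given by the
    integral of the inverse volume of [B x r] over the [x] in [B y r]; for
    such [x] the volumes of [B x r] and [B y r] are comparable by doubling. *)
Lemma integral_ball_average :
  (\int[mu]_x (((vol x r)^-1)%:E * \int[mu]_(y in B x r) (f y)%:E) <=
   (2 `^ Q)%:E * \int[mu]_y (f y)%:E)%E.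
Proof.
under eq_integral do rewrite -kernel_fst.
rewrite (fubini_tonelli _ measurable_kernel kernel_ge0).
rewrite -ge0_integralZl_EFin ?powR_ge0//; last 2 first.
  by move=> y _; rewrite lee_fin.
  exact/measurable_EFinP.
apply: ge0_le_integral; first exact: measurableT.
- by move=> y _; apply: integral_ge0 => x _; exact: kernel_ge0.
- exact: (measurable_fun_fubini_tonelli_G (m1 := mu) kernel measurable_kernel kernel_ge0).
- by apply/measurable_EFinP; exact: measurable_funM.
move=> y _.
have vy : 0 < vol y r by exact: (cc_vol_gt0 conn topo dbl).
apply: (@le_trans _ _ (\int[mu]_x ((2 `^ Q * f y / vol y r)%:E * (\1_(B y r) x)%:E))%E).
  apply: ge0_le_integral; first exact: measurableT.
  - by move=> x _; exact: kernel_ge0.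
  - exact: (measurableT_comp measurable_kernel).
  - apply/measurable_EFinP/measurable_funM => //.
    exact/measurable_indicP/cc_ball_measurable.
  move=> x _; rewrite /kernel/= -EFinM lee_fin !indicE.
  have -> : ((x, y) \in D) = (x \in B y r).
    by apply/idP/idP; rewrite !inE /D /cc_ball/= cc_dist_sym.
  have [xy|_] := boolP (x \in B y r); last by rewrite /= mul0r !mulr0.
  rewrite mul1r mulr1 mulrAC ler_wpM2r// powR_inv1 ?fine_ge0 ?measure_ge0//.
  have vx : 0 < vol x r by exact: (cc_vol_gt0 conn topo dbl).
  rewrite ler_pdivlMr// mulrC ler_pdivrMr//.
  apply: le_trans (_ : _ <= vol x (2 ^+ 1 * r)) _; last first.
    by rewrite (le_trans (cc_vol_doubling conn topo dbl _ _ r0)).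
  apply: (le_cc_vol conn topo dbl); apply: (sub_cc_ball conn).
  by move: xy; rewrite inE /cc_ball/= cc_dist_sym expr1; lra.
have mi : measurable_fun setT (fun x : 'rV[R]_N => (\1_(B y r) x)%:E : \bar R).
  by apply/measurable_EFinP/measurable_indicP; exact: cc_ball_measurable.
have c0 : 0 <= 2 `^ Q * f y / vol y r by rewrite divr_ge0 ?mulr_ge0 ?powR_ge0 ?(ltW vy).
rewrite ge0_integralZl_EFin//.
rewrite integral_indic ?setIT//; last exact: cc_ball_measurable.
rewrite -[X in (_ * X <= _)%E]/(lebesgueN (B y r)) -(cc_volK conn topo dbl).
by rewrite -!EFinM lee_fin divfK// gt_eqF.
Qed.

End average_integral.

(** * The Sobolev inequality *)

Section sobolev_test_functions.
Variables (R : realType) (N d : nat) (X : 'I_d -> 'rV[R]_N -> 'rV[R]_N) (Q : R).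
Hypotheses (conn : cc_connected X) (topo : cc_topology X) (dbl : doubling X Q).
Hypotheses (N0 : (0 < N)%N) (lipX : forall j, locally_lipschitz (X j)).
Hypothesis HP : poincare X.
Variable Omega : set 'rV[R]_N.
Hypotheses (oO : open Omega) (bO : bounded_set Omega).
Variables (p q : R).
Hypotheses (p1 : 1 < p) (pq : p < q) (Qpq : Q * (p^-1 - q^-1) < 1).
Local Notation B := (cc_ball X).
Local Notation vol x r := (fine (lebesgueN (cc_ball X x r))).
Local Notation mu := (@lebesgueN R N).

Let p0 : 0 < p. Proof. exact: lt_trans p1. Qed.
Let q0 : 0 < q. Proof. exact: lt_trans pq. Qed.

Lemma lebesgueN_bounded_fin : lebesgueN Omega \is a fin_num.
Proof. by rewrite ge0_fin_numE ?measure_ge0//; exact: lebesgueN_bounded. Qed.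

(** Half of the margin left by [Qpq]: the rate of decay along the chains. *)
Let tau := (1 - Q * (p^-1 - q^-1)) / 2.
Let tau0 : 0 < tau. Proof. by rewrite divr_gt0// subr_gt0. Qed.
Let b := (2 : R) `^ (- (tau * q)).
Let b0 : 0 < b. Proof. exact: powR_gt0. Qed.
Let b1 : b < 1.
Proof.
rewrite /b powRN invf_lt1 ?powR_gt0//.
rewrite -[ltLHS](congr1 (fun h => h (tau * q)) (powR1 R)).
by have tq : 0 < tau * q by [rewrite mulr_gt0]; rewrite gt0_ltr_powR ?nnegrE// ltr1n.
Qed.

Let geo n c : 0 <= c -> \sum_(0 <= i < n) b ^+ i * c <= c / (1 - b).
Proof.
move=> c0; rewrite -mulr_suml mulrC ler_wpM2l//.
rewrite -[leRHS]mul1r ler_pdivlMr ?subr_gt0// mulrC big_mkord.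
by rewrite -opprB mulNr -subrX1 opprB lerBlDr lerDl exprn_ge0// ltW.
Qed.

(** Each average of [f] over a ball of the chain at [x] is at most the inverse of
    its weight times this sum; and as the weights are summable, the integral of
    the sum over [x] is at most a multiple of that of [f]. *)
Let chain_sum (a : nat) (R0 : R) (f : 'rV[R]_N -> R) x : \bar R :=
  (\sum_(i <oo) (b ^+ i)%:E * (((vol x (2 ^+ a * (R0 / 2 ^+ i)))^-1)%:E *
     \int[mu]_(y in B x (2 ^+ a * (R0 / 2 ^+ i))) (f y)%:E))%E.

Let chain_term_ge0 a (R0 : R) (f : 'rV[R]_N -> R) x i : (forall y, 0 <= f y) ->
  (0 <= (b ^+ i)%:E * (((vol x (2 ^+ a * (R0 / 2 ^+ i)))^-1)%:E *
     \int[mu]_(y in B x (2 ^+ a * (R0 / 2 ^+ i))) (f y)%:E))%E.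
Proof.
move=> f0; rewrite mule_ge0 ?lee_fin ?exprn_ge0 ?(ltW b0)// mule_ge0//.
  by rewrite lee_fin invr_ge0 fine_ge0.
by apply: integral_ge0 => y _; rewrite lee_fin.
Qed.

Let chain_sum_int a (R0 : R) (f : 'rV[R]_N -> R) : 0 < R0 -> measurable_fun setT f -> (forall y, 0 <= f y) ->
  measurable_fun setT (chain_sum a R0 f) /\
  (\int[mu]_(x in Omega) chain_sum a R0 f x <=
    (2 `^ Q / (1 - b))%:E * \int[mu]_y (f y)%:E)%E.
Proof.
move=> R00 mf f0.
have ri i : 0 < 2 ^+ a * (R0 / 2 ^+ i).
  by rewrite mulr_gt0 ?divr_gt0 ?exprn_gt0.
have mterm i : measurable_fun setT (fun x => (b ^+ i)%:E *
    (((vol x (2 ^+ a * (R0 / 2 ^+ i)))^-1)%:E *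
     \int[mu]_(y in B x (2 ^+ a * (R0 / 2 ^+ i))) (f y)%:E))%E.
  by apply: measurable_funeM; exact: (measurable_ball_average conn topo dbl).
have mchain : measurable_fun setT (chain_sum a R0 f).
  apply: (ge0_emeasurable_sum (P := xpredT)) => // i x _ _; exact: chain_term_ge0.
split=> //.
apply: (@le_trans _ _ (\int[mu]_x chain_sum a R0 f x)%E).
  apply: ge0_subset_integral => //; first exact: open_measurable_rV.
  by move=> x _; apply: nneseries_ge0 => i _ _; exact: chain_term_ge0.
rewrite integral_nneseries//; last by move=> i x _; exact: chain_term_ge0.
have If : (0 <= \int[mu]_y (f y)%:E)%E by apply: integral_ge0 => y _; rewrite lee_fin.
have b1' : 0 < 1 - b by rewrite subr_gt0.
apply: (@le_trans _ _ (\sum_(i <oo) (b ^+ i * 2 `^ Q)%:E * \int[mu]_y (f y)%:E)%E).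
  apply: lee_nneseries => i _.
    by move=> _; apply: integral_ge0 => x _; exact: chain_term_ge0.
  have mavg := measurable_ball_average conn topo dbl (2 ^+ a * (R0 / 2 ^+ i)) mf f0.
  rewrite (ge0_integralZl_EFin mu measurableT _ mavg (exprn_ge0 i (ltW b0))); last first.
    move=> x _; rewrite mule_ge0 ?lee_fin ?invr_ge0 ?fine_ge0//.
    by apply: integral_ge0 => y _; rewrite lee_fin.
  rewrite EFinM -muleA; apply: lee_wpmul2l; first by rewrite lee_fin exprn_ge0// ltW.
  exact: (integral_ball_average conn topo dbl).
apply: lime_le.
  apply: is_cvg_nneseries => i _ _.
  by rewrite mule_ge0// lee_fin mulr_ge0 ?exprn_ge0 ?powR_ge0 ?(ltW b0).
apply: nearW => n; rewrite -ge0_sume_distrl; last first.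
  by move=> i _; rewrite lee_fin mulr_ge0 ?exprn_ge0 ?powR_ge0 ?(ltW b0).
rewrite lee_wpmul2r// sumEFin lee_fin; apply: geo; exact: powR_ge0.
Qed.

Let chain_sum_term a (R0 : R) (f : 'rV[R]_N -> R) x i : (forall y, 0 <= f y) ->
  ((b ^+ i)%:E * (((vol x (2 ^+ a * (R0 / 2 ^+ i)))^-1)%:E *
     \int[mu]_(y in B x (2 ^+ a * (R0 / 2 ^+ i))) (f y)%:E) <= chain_sum a R0 f x)%E.
Proof.
move=> f0; apply: le_trans (nneseries_lim_ge (m := 0%N) i.+1 _); last first.
  by move=> j _ _; exact: chain_term_ge0.
rewrite big_nat_recr//= leeDr// big_mkord.
by apply: sume_ge0 => j _; exact: chain_term_ge0.
Qed.

(** The pointwise chain estimate is raised to the power [q] and integrated over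
    [Omega]. As [q] lies strictly below [p * Q / (Q - p)], there is room for the
    geometric weights of [chain_sum], which does the work of a maximal
    function. *)
Lemma sobolev_test_function : exists2 S : R, 0 < S &
  forall phi, test_function Omega phi ->
  (\int[mu]_(x in Omega) (`|phi x| `^ q)%:E <=
   S%:E * (\int[mu]_(x in Omega) (enorm (Xgrad X phi x) `^ p)%:E) `^ (q / p))%E.
Proof.
have mO : measurable Omega by exact: open_measurable_rV.
have [CP [a [CP0 hCP]]] := poincare_dyadic conn topo dbl HP.
have [z [rho rho0 zO]] := cc_ball_disjoint conn topo N0 bO.
have [D D0 zD] := bounded_cc_dist conn topo z bO.
(* Large enough for [B z rho] to lie in [B x R0] for every [x] in [Omega]. *)
pose R0 := D + rho; have R00 : 0 < R0 by rewrite addr_gt0.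
set s := p^-1 - q^-1.
have s0 : 0 < s by rewrite subr_gt0 ltf_pV2 ?posrE.
pose K1 := 2 `^ Q * CP * 2 * (R0 * (vol z rho)^-1 `^ s / (1 - 2 `^ (- tau))).
pose K2 := ((2 `^ Q) ^+ 2 + vol z (2 * R0) / vol z rho) *
      (CP * (2 * R0) * (2 * (vol z rho)^-1 `^ p^-1)).
have th1 : 2 `^ (- tau) < 1 :> R.
  rewrite powRN invf_lt1 ?powR_gt0//.
  by rewrite -[ltLHS](congr1 (fun h => h tau) (powR1 R)) gt0_ltr_powR ?nnegrE// ltr1n.
have v0 r : 0 <= vol z r by rewrite fine_ge0.
have K10 : 0 <= K1.
  by rewrite !mulr_ge0 ?powR_ge0 ?invr_ge0 ?subr_ge0 ?(ltW CP0) ?(ltW R00) ?(ltW th1).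
have K20 : 0 <= K2.
  by rewrite mulr_ge0 ?addr_ge0 ?exprn_ge0 ?divr_ge0 ?powR_ge0 ?v0//
    !mulr_ge0 ?powR_ge0 ?(ltW CP0) ?(ltW R00).
pose L := 2 `^ q * (K1 `^ q * (2 `^ Q / (1 - b)) + K2 `^ q * fine (lebesgueN Omega)).
exists (L + 1) => [|phi tphi].
  rewrite ltr_wpDl// /L mulr_ge0 ?powR_ge0// addr_ge0// mulr_ge0 ?powR_ge0 ?fine_ge0//.
  by rewrite divr_ge0 ?powR_ge0// subr_ge0 ltW.
pose g x := enorm (Xgrad X phi x).
have g0 x : 0 <= g x by exact: enorm_ge0.
have bphi : bounded_measurable phi.
  split; last exact: test_function_bounded tphi.
  exact/continuous_measurable_rV/(test_function_continuous tphi).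
have bg : bounded_measurable g.
  split; last exact: enorm_Xgrad_bounded lipX tphi.
  exact/continuous_measurable_rV/(enorm_Xgrad_continuous lipX tphi).
have bgp : bounded_measurable (fun y => g y `^ p) by exact: (bounded_measurable_powR (ltW p0)).
have gp0 y : 0 <= g y `^ p by exact: powR_ge0.
have mgp : measurable_fun setT (fun y => (g y `^ p)%:E) by apply/measurable_EFinP; case: bgp.
set I := (\int[mu]_(x in Omega) _)%E in |- *.
set J := (\int[mu]_(x in Omega) (g x `^ p)%:E)%E.
have JT : (\int[mu]_y (g y `^ p)%:E = J)%E.
  rewrite /J [in RHS]integral_mkcond; apply: eq_integral => y _.
  rewrite patchE; case: ifPn => // /negP; rewrite inE => yO.
  by rewrite /g (Xgrad_out X tphi yO) enorm0 powR0// gt_eqF.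
have Jfin : J \is a fin_num.
  apply: (integrable_fin_num mO); apply: measurable_bounded_integrable; first exact: mO.
  - exact: lebesgueN_bounded.
  - by case: bgp => mg _; exact: measurable_funS mg.
  - by case: bgp => _ [M hM]; exists M; split=> [|t Mt y _]; [exact: num_real|exact: le_trans (ltW Mt)].
pose Gamma := fine J.
have JE : J = Gamma%:E by rewrite fineK.
have Gamma0 : 0 <= Gamma by apply/fine_ge0/integral_ge0 => y _; rewrite lee_fin.
have volp x r : 0 < r -> 0 < vol x r by exact: (cc_vol_gt0 conn topo dbl).
have RI x r : (\int[mu]_(y in B x r) (g y `^ p)%:E)%E = (Rintegral mu (B x r) (fun y => g y `^ p))%:E.
  rewrite /Rintegral fineK//.
  exact: (integrable_fin_num (cc_ball_measurable conn topo x r)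
    (bounded_measurable_integrable conn topo dbl x r bgp)).
have GammaP x r : 0 < r -> vol x r * average (B x r) (fun y => g y `^ p) <= Gamma.
  move=> r0; rewrite /average mulrC divfK ?gt_eqF ?volp// -lee_fin -RI -JE -JT.
  by apply: ge0_subset_integral => //; [exact: cc_ball_measurable|by move=> w _; rewrite lee_fin].
have uz y : B z rho y -> phi y = 0.
  move=> yz; apply: (test_function_out tphi) => /zO; rewrite leNgt => /negP; apply; exact: yz.
have phiC1 : C1_on setT phi by case: tphi => sphi _ _; exact: (sphi [::]).
have rhoR : rho <= R0 by rewrite lerDr ltW.
have ri i : 0 < 2 ^+ a * (R0 / 2 ^+ i).
  by rewrite mulr_gt0 ?divr_gt0 ?exprn_gt0.
pose M := chain_sum a R0 (fun y => g y `^ p).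
have [mM intM] : measurable_fun setT M /\
    (\int[mu]_(x in Omega) M x <= (2 `^ Q / (1 - b) * Gamma)%:E)%E.
  have := chain_sum_int a R00 bgp.1 gp0.
  by rewrite EFinM JT JE.
have M0 x : (0 <= M x)%E by apply: nneseries_ge0 => i _ _; exact: chain_term_ge0.
have point x : Omega x -> M x \is a fin_num ->
    `|phi x| `^ q <= 2 `^ q * (K1 `^ q * (Gamma `^ (s * q) * fine (M x)) + K2 `^ q * Gamma `^ (q / p)).
  move=> Ox Mfin; have Mx0 : 0 <= fine (M x) by rewrite fine_ge0.
  have hM i : average (B x (2 ^+ a * (R0 / 2 ^+ i))) (fun y => g y `^ p) <=
      fine (M x) * (2 `^ (tau * q)) ^+ i.
    have := @chain_sum_term a R0 (fun y => g y `^ p) x i gp0.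
    rewrite -/(M x) RI -!EFinM -[M x]fineK// lee_fin /average [_^-1 * _]mulrC => h.
    have -> : 2 `^ (tau * q) = b^-1 :> R by rewrite /b powRN invrK.
    by rewrite exprVn ler_pdivlMr ?exprn_gt0// mulrC.
  have := chain_pointwise conn topo dbl CP0 p1 (test_function_continuous tphi) bphi bg g0
    (hCP _ phiC1 bphi bg) rho0 R00 rhoR GammaP uz pq erefl tau0 _ Mx0 hM.
  have -> : cc_dist X z x + rho <= R0 by rewrite lerD2r zD.
  move=> /(_ isT); rewrite -/s -/K1 -/K2 => h.
  have G1 : 0 <= Gamma `^ s * fine (M x) `^ q^-1 by rewrite mulr_ge0// powR_ge0.
  have t1 : 0 <= K1 * (Gamma `^ s * fine (M x) `^ q^-1) by exact: mulr_ge0.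
  have t2 : 0 <= K2 * Gamma `^ p^-1 by apply: mulr_ge0 => //; exact: powR_ge0.
  apply: (@le_trans _ _ ((K1 * (Gamma `^ s * fine (M x) `^ q^-1) + K2 * Gamma `^ p^-1) `^ q)).
    by apply: ge0_ler_powR; rewrite ?nnegrE ?(ltW q0) ?addr_ge0.
  apply: le_trans (powR_add_le t1 t2 q0) _.
  rewrite (powRM _ K10 G1) (powRM _ K20 (powR_ge0 _ _)) (powRM _ (powR_ge0 _ _) (powR_ge0 _ _)).
  by rewrite -!powRrM mulVf ?gt_eqF// powRr1// [p^-1 * q]mulrC.
have intMfin : mu.-integrable Omega M.
  apply/integrableP; split; first exact: measurable_funS mM.
  by under eq_integral do rewrite gee0_abs//; exact: le_lt_trans intM (ltry _).
have c1 : 0 <= 2 `^ q * K1 `^ q * Gamma `^ (s * q) by rewrite !mulr_ge0 ?powR_ge0.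
have c2 : 0 <= 2 `^ q * K2 `^ q * Gamma `^ (q / p) by rewrite !mulr_ge0 ?powR_ge0.
apply: (@le_trans _ _ (\int[mu]_(x in Omega)
    ((2 `^ q * K1 `^ q * Gamma `^ (s * q))%:E * M x + (2 `^ q * K2 `^ q * Gamma `^ (q / p))%:E))%E).
  apply: ae_ge0_le_integral; first exact: mO.
  - by move=> x _; rewrite lee_fin powR_ge0.
  - apply/measurable_EFinP; apply: (measurableT_comp (measurable_powR _)).
    by apply: measurableT_comp => //; exact: measurable_funS bphi.1.
  - by move=> x _; rewrite adde_ge0// mule_ge0.
  - apply: emeasurable_funD; last exact: measurable_cst.
    by apply: measurable_funeM; exact: measurable_funS mM.
  apply: (@filterS _ _ (ae_filter_ringOfSetsType mu) _ _ _ (integrable_ae mO intMfin)) => x h Ox.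
  have Mfin := h Ox; rewrite -[M x]fineK// -EFinM -EFinD lee_fin.
  apply: le_trans (point x Ox Mfin) _.
  by rewrite le_eqVlt; apply/orP; left; apply/eqP; ring.
have mMO : measurable_fun Omega M by exact: measurable_funS mM.
have mcM := measurable_funeM (2 `^ q * K1 `^ q * Gamma `^ (s * q))%:E mMO.
rewrite (ge0_integralD mu mO _ mcM _ (measurable_cst _)); last 2 first.
- by move=> x _; rewrite mule_ge0.
- by move=> x _; rewrite lee_fin.
rewrite (ge0_integralZl_EFin mu mO _ mMO c1)//.
rewrite integral_cst// -/J JE poweR_EFin -[X in (_ + _ * X)%E](fineK lebesgueN_bounded_fin).
apply: (@le_trans _ _ ((2 `^ q * K1 `^ q * Gamma `^ (s * q))%:E * (2 `^ Q / (1 - b) * Gamma)%:E +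
    (2 `^ q * K2 `^ q * Gamma `^ (q / p))%:E * (fine (lebesgueN Omega))%:E)%E).
  by apply: leeD2r; apply: lee_wpmul2l.
rewrite -!EFinM -EFinD lee_fin [leRHS]mulrDl mul1r.
apply: (@le_trans _ _ (L * Gamma `^ (q / p))); last by rewrite lerDl powR_ge0.
have -> : Gamma `^ (q / p) = Gamma `^ (s * q) * Gamma.
  rewrite -[X in _ = _ * X](powRr1 Gamma0).
  have sq1 : s * q + 1 = q / p by rewrite /s; field; rewrite !gt_eqF.
  by rewrite -powRD sq1// gt_eqF// divr_gt0.
by rewrite /L le_eqVlt; apply/orP; left; apply/eqP; ring.
Qed.

End sobolev_test_functions.

(** * Integral norms on a domain *)

Section measure_lemmas.
Context d (T : measurableType d) (R : realType).
Variables (mu : {measure set T -> \bar R}) (D : set T).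
Hypothesis mD : measurable D.

Lemma ge0_le_integral_EFin (f g : T -> R) :
  measurable_fun D f -> measurable_fun D g -> (forall x, 0 <= f x) ->
  (forall x, D x -> f x <= g x) ->
  (\int[mu]_(x in D) (f x)%:E <= \int[mu]_(x in D) (g x)%:E)%E.
Proof.
move=> mf mg f0 fg; apply: ge0_le_integral; first exact: mD.
- by move=> x _; rewrite lee_fin.
- exact/measurable_EFinP.
- exact/measurable_EFinP.
- by move=> x Dx; rewrite lee_fin fg.
Qed.

Lemma ge0_integralD_EFin (f g : T -> R) :
  measurable_fun D f -> measurable_fun D g -> (forall x, 0 <= f x) ->
  (forall x, 0 <= g x) ->
  (\int[mu]_(x in D) (f x + g x)%:E =
   \int[mu]_(x in D) (f x)%:E + \int[mu]_(x in D) (g x)%:E)%E.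
Proof.
move=> mf mg f0 g0; under eq_integral do rewrite EFinD.
have mf' : measurable_fun D (EFin \o f) by exact/measurable_EFinP.
have mg' : measurable_fun D (EFin \o g) by exact/measurable_EFinP.
by apply: (ge0_integralD mu mD _ mf' _ mg') => x _; rewrite lee_fin.
Qed.

Lemma ge0_integralZ_EFin (c : R) (f : T -> R) :
  measurable_fun D f -> 0 <= c -> (forall x, 0 <= f x) ->
  (\int[mu]_(x in D) (c * f x)%:E = c%:E * \int[mu]_(x in D) (f x)%:E)%E.
Proof.
move=> mf c0 f0; under eq_integral do rewrite EFinM.
have mf' : measurable_fun D (EFin \o f) by exact/measurable_EFinP.
by apply: (ge0_integralZl_EFin mu mD _ mf' c0) => x _; rewrite lee_fin.
Qed.

Lemma limn_einf_le_bound (v : (\bar R)^nat) (c : \bar R) n0 :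
  (forall n, (n0 <= n)%N -> (v n <= c)%E) -> (limn_einf v <= c)%E.
Proof.
move=> vc; rewrite limn_einf_lim; apply: lime_le; first exact: is_cvg_einfs.
apply: nearW => n; apply: le_trans (vc (maxn n n0) (leq_maxr _ _)).
by apply: ereal_inf_lbound; exists (maxn n n0) => //=; exact: leq_maxl.
Qed.

(** Fatou's lemma in the form used for passing to the limit in inequalities. *)
Lemma fatou_bound (f : nat -> T -> R) (g : T -> R) (c : \bar R) n0 :
  (forall n, measurable_fun D (f n)) -> measurable_fun D g ->
  (forall n x, 0 <= f n x) -> (forall x, 0 <= g x) ->
  {ae mu, forall x, D x -> f n x @[n --> \oo] --> g x} ->
  (forall n, (n0 <= n)%N -> (\int[mu]_(x in D) (f n x)%:E <= c)%E) ->
  (\int[mu]_(x in D) (g x)%:E <= c)%E.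
Proof.
move=> mf mg f0 g0 fg fc.
have mf' n : measurable_fun D (EFin \o f n) by exact/measurable_EFinP.
have f0' n x : D x -> (0 <= (EFin \o f n) x)%E by rewrite lee_fin.
apply: le_trans (le_trans (fatou mu mD mf' f0') (limn_einf_le_bound fc)).
apply: ae_ge0_le_integral => //.
- by move=> x _; rewrite lee_fin.
- exact/measurable_EFinP.
- move=> x Dx; rewrite limn_einf_lim; apply: lime_ge; first exact: is_cvg_einfs.
  by apply: nearW => n; apply: le_ereal_inf_tmp => _ [m _ <-]; rewrite /= lee_fin.
- apply: (measurableT_comp (f := oppe)); first exact: oppe_measurable.
  apply: measurable_fun_limn_esup => n.
  by apply: (measurableT_comp (f := oppe)); first exact: oppe_measurable.
apply: (@filterS _ _ (ae_filter_ringOfSetsType mu) _ _ _ fg) => x h Dx.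
have : (EFin \o f^~ x) @ \oo --> (g x)%:E by apply: cvg_EFin; [exact: nearW|exact: h].
by move=> /[dup] /cvgP /is_cvg_limn_einfE -> /cvg_lim ->.
Qed.

(** The series of the [f n] has a finite integral, hence a finite sum almost
    everywhere, and the terms of a convergent series tend to 0. *)
Lemma ae_cvg0_of_summable (f : nat -> T -> R) :
  (forall n, measurable_fun D (f n)) -> (forall n x, 0 <= f n x) ->
  (forall n, (\int[mu]_(x in D) (f n x)%:E <= (2^-1 ^+ n)%:E)%E) ->
  {ae mu, forall x, D x -> f n x @[n --> \oo] --> 0}.
Proof.
move=> mf f0 fI.
pose S x := (\sum_(n <oo) (f n x)%:E)%E.
have mf' n : measurable_fun D (EFin \o f n) by exact/measurable_EFinP.
have IS : mu.-integrable D S.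
  apply/integrableP; split.
    apply: (ge0_emeasurable_sum (P := xpredT)) => [n x _ _|n _]; last exact: mf'.
    by rewrite lee_fin.
  under eq_integral => x _.
    rewrite gee0_abs; last by apply: nneseries_ge0 => n _ _; rewrite lee_fin.
    over.
  rewrite integral_nneseries//; last by move=> n x _; rewrite lee_fin.
  apply: (@le_lt_trans _ _ (\sum_(n <oo) (2^-1 ^+ n : R)%:E)%E).
    by apply: lee_nneseries => n _ //; move=> _; apply: integral_ge0 => x _; rewrite lee_fin.
  apply: (@le_lt_trans _ _ 2%:E); last exact: ltry.
  apply: lime_le.
    by apply: is_cvg_nneseries => n _ _; rewrite lee_fin exprn_ge0.
  apply: nearW => n; rewrite sumEFin lee_fin big_mkord.
  have := subrX1 (2^-1 : R) n; have : 0 <= (2^-1 : R) ^+ n by rewrite exprn_ge0.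
  lra.
apply: (@filterS _ _ (ae_filter_ringOfSetsType mu) _ _ _ (integrable_ae mD IS)) => x h Dx.
have Sfin := h Dx.
apply: cvg_series_cvg_0; apply: nondecreasing_is_cvgn.
  by apply/nondecreasing_seqP => n; rewrite seriesSr lerDl.
exists (fine (S x)) => _ [n _ <-].
rewrite -lee_fin fineK// /series/= -sumEFin.
by apply: nneseries_lim_ge => j _ _; rewrite lee_fin.
Qed.

End measure_lemmas.

Section domain_norms.
Variables (R : realType) (N : nat) (Omega : set 'rV[R]_N).
Local Notation mu := (@lebesgueN R N).
Implicit Types f g u : 'rV[R]_N -> R.

Lemma Lnorm_onE (q : R) f : q != 0 -> Lnorm_on Omega q%:E f =
  ((\int[mu]_(x in Omega) (`|f x| `^ q)%:E) `^ q^-1)%E.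
Proof.
move=> q0; rewrite /Lnorm_on unlock; congr (_ `^ _)%E.
rewrite [RHS]integral_mkcond; apply: eq_integral => x _.
rewrite /= !patchE; case: ifP => // _.
by rewrite -[point]/(0 : R) normr0 powR0.
Qed.

Lemma Lnorm_on_int (q : R) f : 0 < q ->
  (\int[mu]_(x in Omega) (`|f x| `^ q)%:E = Lnorm_on Omega q%:E f `^ q)%E.
Proof.
move=> q0; rewrite Lnorm_onE ?gt_eqF// -poweRrM mulVf ?gt_eqF// poweRe1//.
by apply: integral_ge0 => x _; rewrite lee_fin powR_ge0.
Qed.

Lemma Lnorm_on_lty (q : R) f : 0 < q -> (Lnorm_on Omega q%:E f < +oo)%E <->
  (\int[mu]_(x in Omega) (`|f x| `^ q)%:E < +oo)%E.
Proof.
move=> q0; split; first by move=> h; rewrite Lnorm_on_int// poweR_lty.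
by move=> h; rewrite Lnorm_onE ?gt_eqF// poweR_lty.
Qed.

Lemma Lnorm_on_cvg0 (q : R) (f : nat -> 'rV[R]_N -> R) : 0 < q ->
  Lnorm_on Omega q%:E (f n) @[n --> \oo] --> 0%E <->
  (forall e, 0 < e -> exists n0, forall n, (n0 <= n)%N ->
    (\int[mu]_(x in Omega) (`|f n x| `^ q)%:E <= e%:E)%E).
Proof.
move=> q0; split=> [h e e0|h].
  have eq0 : 0 < e `^ q^-1 by rewrite powR_gt0.
  have /fine_cvgP[fin /cvgrPdist_lt/(_ _ eq0)] := h.
  move=> /(filterI fin)[n0 _ hn]; exists n0 => n /hn[nfin].
  rewrite /= sub0r normrN ger0_norm ?fine_ge0 ?Lnorm_ge0// => hlt.
  rewrite Lnorm_on_int// -[X in (X `^ _)%E](fineK nfin) poweR_EFin lee_fin.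
  rewrite -[leRHS](@powRr1 _ e) ?(ltW e0)// -(@mulVf _ q) ?gt_eqF// powRrM.
  by apply: ge0_ler_powR; rewrite ?nnegrE ?powR_ge0 ?fine_ge0 ?Lnorm_ge0 ?(ltW q0) ?(ltW hlt).
have L0 n : (0 <= Lnorm_on Omega q%:E (f n))%E by exact: Lnorm_ge0.
have key e : 0 < e -> exists n0, forall n, (n0 <= n)%N ->
    (Lnorm_on Omega q%:E (f n) <= e%:E)%E.
  move=> e0; have [n0 hn] := h (e `^ q) (powR_gt0 _ e0).
  exists n0 => n /hn hi; rewrite Lnorm_onE ?gt_eqF//.
  rewrite -[e]powRr1 ?(ltW e0)// -(@mulfV _ q) ?gt_eqF// powRrM -poweR_EFin.
  apply: gt0_ler_poweR; rewrite ?invr_ge0 ?(ltW q0)// in_itv/= leey andbT.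
    by apply: integral_ge0 => x _; rewrite lee_fin powR_ge0.
  by rewrite lee_fin powR_ge0.
apply/fine_cvgP; split.
  have [n0 hn] := key 1 ltr01; exists n0 => // n /hn hle.
  by rewrite ge0_fin_numE// (le_lt_trans hle)// ltry.
apply/cvgrPdist_le => e e0; have [n0 hn] := key e e0.
exists n0 => // n /hn hle; rewrite /= sub0r normrN ger0_norm ?fine_ge0//.
by rewrite -lee_fin fineK// ge0_fin_numE// (le_lt_trans hle)// ltry.
Qed.

End domain_norms.

Lemma enorm_powR_le (R : realType) n (x : 'rV[R]_n) p : 0 < p ->
  enorm x `^ p <= (2 `^ p) ^+ size (index_enum 'I_n) * \sum_i `|x ord0 i| `^ p.
Proof.
move=> p0; apply: le_trans (powR_sum_le _ _ p0) => //.
apply: ge0_ler_powR; rewrite ?nnegrE ?enorm_ge0 ?sumr_ge0 ?(ltW p0)//.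
exact: enorm_le_sum.
Qed.

Lemma measurable_enorm (R : realType) (N d : nat) (D : set 'rV[R]_N)
    (G : 'rV[R]_N -> 'rV[R]_d) : (forall j, measurable_fun D (fun x => G x ord0 j)) ->
  measurable_fun D (fun x => enorm (G x)).
Proof.
move=> mG; apply: (measurableT_comp (f := @Num.sqrt R)).
  by apply: continuous_measurable_fun; exact: sqrt_continuous.
apply: measurable_sum => j.
exact: measurable_funM.
Qed.

(** * The space [W^{1,p}_0] *)

Section sobolev_space.
Variables (R : realType) (N d : nat) (X : 'I_d -> 'rV[R]_N -> 'rV[R]_N).
Hypothesis lipX : forall j, locally_lipschitz (X j).
Variable Omega : set 'rV[R]_N.
Hypotheses (oO : open Omega).
Variable p : R.
Hypothesis p1 : 1 < p.
Local Notation mu := (@lebesgueN R N).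
Implicit Types (u : 'rV[R]_N -> R) (G : 'rV[R]_N -> 'rV[R]_d).

Let p0 : 0 < p. Proof. exact: lt_trans p1. Qed.
Let mO : measurable Omega. Proof. exact: open_measurable_rV. Qed.

Let measurable_test phi : test_function Omega phi -> measurable_fun Omega phi.
Proof.
move=> tphi; apply: (measurable_funS measurableT); first exact: subsetT.
exact/continuous_measurable_rV/(test_function_continuous tphi).
Qed.

Let measurable_Xgrad phi j : test_function Omega phi ->
  measurable_fun Omega (fun x => Xgrad X phi x ord0 j).
Proof.
move=> tphi; apply: (measurable_funS measurableT); first exact: subsetT.
exact/continuous_measurable_rV/(Xgrad_continuous lipX tphi).
Qed.

Let measurable_powR_norm (f : 'rV[R]_N -> R) : measurable_fun Omega f ->
  measurable_fun Omega (fun x => `|f x| `^ p : R).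
Proof.
by move=> mf; apply: (measurableT_comp (measurable_powR _)); exact: measurableT_comp.
Qed.

Lemma W0_measurable u G : W0_gradient Omega X p u G -> measurable_fun Omega u.
Proof. by move=> [[]]. Qed.

Lemma W0_gradient_measurable u G j : W0_gradient Omega X p u G ->
  measurable_fun Omega (fun x => G x ord0 j).
Proof. by move=> [_ /(_ j)[]]. Qed.

Let measurable_enorm_sub u G phi : W0_gradient Omega X p u G -> test_function Omega phi ->
  measurable_fun Omega (fun x => enorm (Xgrad X phi x - G x)).
Proof.
move=> uG tphi; apply: measurable_enorm => j.
rewrite (_ : (fun x => _) = fun x => Xgrad X phi x ord0 j - G x ord0 j).
  by apply: measurable_funB; [exact: measurable_Xgrad|exact: W0_gradient_measurable uG].
by apply/funext => x; rewrite !mxE.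
Qed.

(** A geometric rate of approximation makes the approximating sequence converge
    almost everywhere. *)
Lemma W0_approx u G : W0_gradient Omega X p u G ->
  exists phi : nat -> 'rV[R]_N -> R, forall n,
  [/\ test_function Omega (phi n),
      (\int[mu]_(x in Omega) (`|phi n x - u x| `^ p)%:E <= (2^-1 ^+ n)%:E)%E &
      (\int[mu]_(x in Omega) (enorm (Xgrad X (phi n) x - G x) `^ p)%:E <= (2^-1 ^+ n)%:E)%E].
Proof.
move=> [_ _ [phi [tphi /(Lnorm_on_cvg0 Omega _ p0) h1 /(Lnorm_on_cvg0 Omega _ p0) h2]]].
suff /choice[k kP] : forall n, exists k,
  (\int[mu]_(x in Omega) (`|phi k x - u x| `^ p)%:E <= (2^-1 ^+ n)%:E)%E /\
  (\int[mu]_(x in Omega) (enorm (Xgrad X (phi k) x - G x) `^ p)%:E <= (2^-1 ^+ n)%:E)%E.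
  by exists (phi \o k) => n; have [k1 k2] := kP n; split; [exact: tphi|exact: k1|exact: k2].
move=> n; have n0 : 0 < (2^-1 : R) ^+ n by rewrite exprn_gt0.
have [k1 hk1] := h1 _ n0; have [k2 hk2] := h2 _ n0.
exists (maxn k1 k2); split; first by apply: hk1; exact: leq_maxl.
have := hk2 (maxn k1 k2) (leq_maxr _ _).
by under eq_integral do rewrite (ger0_norm (enorm_ge0 _)).
Qed.

Lemma W0_energy_lty u G : W0_gradient Omega X p u G ->
  (\int[mu]_(x in Omega) (enorm (G x) `^ p)%:E < +oo)%E.
Proof.
move=> [_ LG _].
set c := (2 `^ p : R) ^+ size (index_enum 'I_d).
have c0 : 0 <= c by rewrite exprn_ge0// powR_ge0.
have mG j : measurable_fun Omega (fun x => `|G x ord0 j| `^ p).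
  by apply: measurable_powR_norm; case: (LG j).
have mGE j : measurable_fun Omega (fun x => (`|G x ord0 j| `^ p)%:E).
  exact/measurable_EFinP/mG.
have mS : measurable_fun Omega (fun x => \sum_j `|G x ord0 j| `^ p).
  by apply: measurable_sum => j; exact: mG.
apply: (@le_lt_trans _ _ (\int[mu]_(x in Omega) (c * \sum_j `|G x ord0 j| `^ p)%:E)%E).
  apply: (ge0_le_integral_EFin _ mO).
  - apply: (measurableT_comp (measurable_powR _)); apply: measurable_enorm => j.
    by case: (LG j).
  - exact: (measurable_funM (measurable_cst c) mS).
  - by move=> x; exact: powR_ge0.
  by move=> x _; exact: enorm_powR_le.
rewrite (ge0_integralZ_EFin _ mO mS c0); last first.
  by move=> x; apply: sumr_ge0 => j _; exact: powR_ge0.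
rewrite lte_mul_pinfty ?lee_fin//.
under eq_integral do rewrite -sumEFin.
rewrite (ge0_integral_sum mu mO mGE); last first.
  by move=> j x _; rewrite lee_fin powR_ge0.
apply: lte_sum_pinfty => j _.
exact/(Lnorm_on_lty Omega _ p0)/(LG j).2.
Qed.

Lemma W0_norm_lty u G : W0_gradient Omega X p u G ->
  (\int[mu]_(x in Omega) (`|u x| `^ p)%:E < +oo)%E.
Proof. by move=> [[_ /(Lnorm_on_lty Omega _ p0)]]. Qed.

(** Fatou's lemma along an almost everywhere convergent sequence of test
    functions; the numerical factor comes from comparing the energies of the
    approximations with that of the limit. *)
Lemma W0_sobolev S q u G : 0 <= S -> 0 < q ->
  (forall phi, test_function Omega phi ->
    (\int[mu]_(x in Omega) (`|phi x| `^ q)%:E <=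
     S%:E * (\int[mu]_(x in Omega) (enorm (Xgrad X phi x) `^ p)%:E) `^ (q / p))%E) ->
  W0_gradient Omega X p u G ->
  (\int[mu]_(x in Omega) (`|u x| `^ q)%:E <=
   (S * (2 `^ p * 2) `^ (q / p))%:E *
     (\int[mu]_(x in Omega) (enorm (G x) `^ p)%:E) `^ (q / p))%E.
Proof.
move=> S0 q0 sob uG; have [phi hphi] := W0_approx uG.
have tphi n : test_function Omega (phi n) by have [] := hphi n.
have mu' := W0_measurable uG.
set E := (\int[mu]_(x in Omega) (enorm (G x) `^ p)%:E)%E.
have Efin : E \is a fin_num.
  rewrite ge0_fin_numE; first exact: W0_energy_lty uG.
  by apply: integral_ge0 => x _; rewrite lee_fin powR_ge0.
have [e EE] : exists e, E = e%:E by exists (fine E); rewrite fineK.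
have e0 : 0 <= e.
  by rewrite -lee_fin -EE; apply: integral_ge0 => x _; rewrite lee_fin powR_ge0.
have mG : measurable_fun Omega (fun x => enorm (G x) `^ p).
  apply: (measurableT_comp (measurable_powR _)); apply: measurable_enorm => j.
  exact: W0_gradient_measurable uG.
have aecvg : {ae mu, forall x, Omega x -> `|phi n x| `^ q @[n --> \oo] --> `|u x| `^ q}.
  have h := @ae_cvg0_of_summable _ _ _ mu _ mO (fun n x => `|phi n x - u x| `^ p).
  have {}h : {ae mu, forall x, Omega x -> `|phi n x - u x| `^ p @[n --> \oo] --> 0}.
    apply: h => [n|n x|n]; last by have [] := hphi n.
      apply: measurable_powR_norm; apply: measurable_funB; last exact: mu'.
      exact: measurable_test.
    exact: powR_ge0.
  apply: (@filterS _ _ (ae_filter_ringOfSetsType mu) _ _ _ h) => x /[apply] hx.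
  have := cvg_of_powR_cvg0 p0 hx.
  by apply: (@continuous_cvg _ _ _ _ _ _ (fun a : R => `|a| `^ q)); exact: powR_norm_continuous.
have key eps : 0 < eps ->
    (\int[mu]_(x in Omega) (`|u x| `^ q)%:E <= (S * (2 `^ p * (eps + e)) `^ (q / p))%:E)%E.
  move=> eps0; have [n0 hn0] := le_pow2 eps^-1.
  apply: (@fatou_bound _ _ _ mu _ mO (fun n x => `|phi n x| `^ q) _ _ n0).
  - move=> n; apply: (measurableT_comp (measurable_powR _)).
    by apply: measurableT_comp => //; exact: measurable_test.
  - by apply: (measurableT_comp (measurable_powR _)); exact: measurableT_comp.
  - by move=> n x; exact: powR_ge0.
  - by move=> x; exact: powR_ge0.
  - exact: aecvg.
  move=> n n0n; apply: le_trans (sob _ (tphi n)) _.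
  rewrite EFinM; apply: lee_wpmul2l; first by rewrite lee_fin.
  rewrite -poweR_EFin; apply: gt0_ler_poweR.
  - by rewrite divr_ge0// ltW.
  - rewrite in_itv/= leey andbT; apply: integral_ge0 => x _; rewrite lee_fin powR_ge0//.
  - by rewrite in_itv/= leey andbT lee_fin mulr_ge0 ?powR_ge0// addr_ge0// ltW.
  have [_ _ hX] := hphi n.
  have mXG : measurable_fun Omega (fun x => enorm (Xgrad X (phi n) x - G x) `^ p).
    apply: (measurableT_comp (measurable_powR _)).
    exact: (measurable_enorm_sub uG (tphi n)).
  have mXGG := measurable_funD mXG mG.
  apply: (@le_trans _ _ (\int[mu]_(x in Omega) (2 `^ p *
      (enorm (Xgrad X (phi n) x - G x) `^ p + enorm (G x) `^ p))%:E)%E).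
    apply: (ge0_le_integral_EFin _ mO).
    - apply: (measurableT_comp (measurable_powR _)); apply: measurable_enorm => j.
      exact: measurable_Xgrad.
    - exact: (measurable_funM (measurable_cst _) mXGG).
    - by move=> x; exact: powR_ge0.
    move=> x _; apply: le_trans (powR_add_le _ _ p0) => //; rewrite ?enorm_ge0//.
    apply: ge0_ler_powR; rewrite ?nnegrE ?enorm_ge0 ?addr_ge0 ?enorm_ge0 ?(ltW p0)//.
    by rewrite -[X in enorm X <= _](subrK (G x)) enormD.
  rewrite (ge0_integralZ_EFin _ mO mXGG (powR_ge0 _ _)); last first.
    by move=> x; rewrite addr_ge0 ?powR_ge0.
  rewrite EFinM; apply: lee_wpmul2l; first by rewrite lee_fin powR_ge0.
  rewrite (ge0_integralD_EFin _ mO mXG mG); last 2 first.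
  - by move=> x; exact: powR_ge0.
  - by move=> x; exact: powR_ge0.
  rewrite -/E EE EFinD; apply: leeD2r; apply: le_trans hX _; rewrite lee_fin.
  rewrite exprVn -[leRHS]invrK lef_pV2 ?posrE ?invr_gt0 ?exprn_gt0//.
  by apply: le_trans hn0 _; rewrite ler_eXn2l// ltr1n.
rewrite EE poweR_EFin -EFinM -mulrA -powRM ?mulr_ge0 ?powR_ge0//.
rewrite -mulrA.
apply: (le_of_add_eps S0 e0); first by rewrite divr_gt0.
  by rewrite powR_gt0.
exact: key.
Qed.

End sobolev_space.

Section sobolev_space_operations.
Variables (R : realType) (N d : nat) (X : 'I_d -> 'rV[R]_N -> 'rV[R]_N).
Hypothesis lipX : forall j, locally_lipschitz (X j).
Variable Omega : set 'rV[R]_N.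
Hypotheses (oO : open Omega).
Variable p : R.
Hypothesis p1 : 1 < p.
Local Notation mu := (@lebesgueN R N).
Implicit Types (u phi : 'rV[R]_N -> R) (G : 'rV[R]_N -> 'rV[R]_d).

Let p0 : 0 < p. Proof. exact: lt_trans p1. Qed.
Let mO : measurable Omega. Proof. exact: open_measurable_rV. Qed.

Let partialN k phi : C1_on setT phi ->
  partial k (fun x => - phi x) = fun x => - partial k phi x.
Proof.
move=> Cphi; apply/funext => x; rewrite /partial deriveN//.
by case: (C1_is_derive k x Cphi).
Qed.

Lemma test_functionN phi : test_function Omega phi ->
  test_function Omega (fun x => - phi x).
Proof.
move=> [sphi cphi suppO].
have suppE : [set x | - phi x != 0] = [set x | phi x != 0].
  by apply/seteqP; split=> x /=; rewrite oppr_eq0.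
rewrite /test_function suppE; split=> // s.
have -> : foldr (@partial R N) (fun x => - phi x) s =
    fun x => - foldr (@partial R N) phi s x.
  by elim: s => //= k s ->; rewrite partialN//; exact: sphi.
move=> k x _; split.
  by apply: derivableN; case: (C1_is_derive k x (sphi s)).
rewrite partialN; last exact: sphi.
by apply: continuousN; exact: (C1_continuous (sphi (k :: s))).
Qed.

Lemma XgradN phi x : smooth phi -> Xgrad X (fun y => - phi y) x = - Xgrad X phi x.
Proof.
move=> sphi; apply/rowP => j; rewrite !mxE -sumrN; apply: eq_bigr => k _.
by rewrite partialN ?mulrN//; exact: (sphi [::]).
Qed.

Let Lnorm_on_ext (f g : 'rV[R]_N -> R) : (forall x, `|f x| = `|g x|) ->
  Lnorm_on Omega p%:E f = Lnorm_on Omega p%:E g.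
Proof.
have pn0 : p != 0 by rewrite gt_eqF.
move=> fg; rewrite (Lnorm_onE _ _ pn0) (Lnorm_onE _ _ pn0); congr (_ `^ _)%E.
by apply: eq_integral => x _; rewrite fg.
Qed.

Lemma W0_gradientN u G : W0_gradient Omega X p u G ->
  W0_gradient Omega X p (fun x => - u x) (fun x => - G x).
Proof.
move=> [[mu' Lu] LG [phi [tphi cphi cX]]]; split.
- split; first exact: measurableT_comp.
  by rewrite (@Lnorm_on_ext _ u)// => x; rewrite normrN.
- move=> j; have [mG Lj] := LG j.
  have -> : (fun x => (- G x) ord0 j) = fun x => - G x ord0 j.
    by apply/funext => x; rewrite mxE.
  split; first exact: measurableT_comp.
  by rewrite (@Lnorm_on_ext _ (fun x => G x ord0 j))// => x; rewrite normrN.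
exists (fun n x => - phi n x); split.
- by move=> n; exact: test_functionN.
- apply: cvg_trans cphi; apply: near_eq_cvg; apply: nearW => n.
  by apply: Lnorm_on_ext => x; rewrite -opprD normrN.
- apply: cvg_trans cX; apply: near_eq_cvg; apply: nearW => n.
  apply: Lnorm_on_ext => x; rewrite XgradN; last by case: (tphi n).
  by rewrite -opprD enormN.
Qed.

Section soft_trunc.
Variables (k e : R) (u : 'rV[R]_N -> R) (G : 'rV[R]_N -> 'rV[R]_d).
Hypotheses (e0 : 0 < e) (uG : W0_gradient Omega X p u G).
Local Notation psi := (soft_trunc k e).
Local Notation dpsi := (soft_step k e).

Let mu' : measurable_fun Omega u. Proof. exact: W0_measurable uG. Qed.
Let mG j : measurable_fun Omega (fun x => G x ord0 j).
Proof. exact: W0_gradient_measurable uG. Qed.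

Lemma measurable_soft_trunc : measurable_fun Omega (psi \o u).
Proof.
apply: measurableT_comp mu'; apply: continuous_measurable_fun => s.
apply/differentiable_continuous/derivable1_diffP.
by case: (is_derive_soft_trunc k e0 s).
Qed.

Lemma measurable_soft_step (v : 'rV[R]_N -> R) : measurable_fun Omega v ->
  measurable_fun Omega (dpsi \o v).
Proof.
move=> mv; apply: measurableT_comp mv; apply: continuous_measurable_fun.
exact: continuous_soft_step.
Qed.

Let mpow (f : 'rV[R]_N -> R) : measurable_fun Omega f ->
  measurable_fun Omega (fun x => `|f x| `^ p).
Proof.
by move=> mf; apply: (measurableT_comp (measurable_powR _)); exact: measurableT_comp.
Qed.

Let menorm (F : 'rV[R]_N -> 'rV[R]_d) :
  (forall j, measurable_fun Omega (fun x => F x ord0 j)) ->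
  measurable_fun Omega (fun x => enorm (F x) `^ p).
Proof.
by move=> mF; apply: (measurableT_comp (measurable_powR _)); exact: measurable_enorm.
Qed.

Let le_int (f g : 'rV[R]_N -> R) : measurable_fun Omega f -> measurable_fun Omega g ->
  (forall x, `|f x| <= `|g x|) ->
  (\int[mu]_(x in Omega) (`|f x| `^ p)%:E <= \int[mu]_(x in Omega) (`|g x| `^ p)%:E)%E.
Proof.
move=> mf mg fg; apply: (ge0_le_integral_EFin _ mO); [exact: mpow|exact: mpow| |].
  by move=> x; exact: powR_ge0.
by move=> x _; apply: ge0_ler_powR; rewrite ?nnegrE// ltW.
Qed.

Let mtest phi : test_function Omega phi -> measurable_fun Omega phi.
Proof.
move=> tphi; apply: (measurable_funS measurableT); first exact: subsetT.
exact/continuous_measurable_rV/(test_function_continuous tphi).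
Qed.

Let soft_step_dist s t : `|dpsi s - dpsi t| <= 1.
Proof.
have := soft_step_bounds k e0 s; have := soft_step_bounds k e0 t.
by rewrite ler_norml; lra.
Qed.

(** By dominated convergence: the differences of the factors [dpsi] are at most 1
    and tend to 0 almost everywhere. *)
Let soft_step_defect (phi : nat -> 'rV[R]_N -> R) :
  (forall n, test_function Omega (phi n)) ->
  (forall n, (\int[mu]_(x in Omega) (`|phi n x - u x| `^ p)%:E <= (2^-1 ^+ n)%:E)%E) ->
  forall eps, 0 < eps -> exists n0, forall n, (n0 <= n)%N ->
  (\int[mu]_(x in Omega)
     (`|dpsi (phi n x) - dpsi (u x)| `^ p * enorm (G x) `^ p)%:E <= eps%:E)%E.
Proof.
move=> tphi hphi eps eps0.
have mGp := menorm mG.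
pose F n x := (`|dpsi (phi n x) - dpsi (u x)| `^ p * enorm (G x) `^ p)%:E.
have F0 n x : (0 <= F n x)%E by rewrite lee_fin mulr_ge0 ?powR_ge0.
have mF n : measurable_fun Omega (F n).
  apply/measurable_EFinP; apply: measurable_funM; last exact: mGp.
  apply: mpow; apply: measurable_funB; apply: measurable_soft_step; last exact: mu'.
  exact: mtest.
have iG : mu.-integrable Omega (fun x => (enorm (G x) `^ p)%:E).
  apply/integrableP; split; first exact/measurable_EFinP/mGp.
  under eq_integral do rewrite gee0_abs ?lee_fin ?powR_ge0//.
  exact: (W0_energy_lty oO p1 uG).
have Fcvg : {ae mu, forall x, Omega x -> F n x @[n --> \oo] --> 0%E}.
  have h := @ae_cvg0_of_summable _ _ _ mu _ mO (fun n x => `|phi n x - u x| `^ p).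
  have {}h : {ae mu, forall x, Omega x -> `|phi n x - u x| `^ p @[n --> \oo] --> 0}.
    apply: h => [n|n x|n]; last exact: hphi.
      by apply: mpow; apply: measurable_funB; [exact: mtest|exact: mu'].
    exact: powR_ge0.
  apply: (@filterS _ _ (ae_filter_ringOfSetsType mu) _ _ _ h) => x /[apply] hx.
  have hu := cvg_of_powR_cvg0 p0 hx.
  have hd : dpsi (phi n x) - dpsi (u x) @[n --> \oo] --> 0.
    rewrite -(subrr (dpsi (u x))); apply: cvgB; last exact: cvg_cst.
    by apply: continuous_cvg => //; exact: continuous_soft_step.
  apply: cvg_EFin; first exact: nearW.
  rewrite -[0](mul0r (enorm (G x) `^ p)); apply: cvgMr_tmp.
  rewrite -[0](@powR0 _ p) ?gt_eqF// -[X in X `^ p](normr0 R).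
  by apply: (@continuous_cvg _ _ _ _ _ _ (fun a : R => `|a| `^ p)); [exact: powR_norm_continuous|].
have Fdom : {ae mu, forall x n, Omega x -> (`|F n x| <= (enorm (G x) `^ p)%:E)%E}.
  apply: aeW => x n _; rewrite gee0_abs// lee_fin ler_piMl ?powR_ge0//.
  rewrite -[leRHS](congr1 (fun h => h p) (powR1 R)).
  by apply: ge0_ler_powR; rewrite ?nnegrE ?(ltW p0).
have [_ _] := dominated_convergence mO mF (measurable_cst _) Fcvg iG Fdom.
rewrite integral0 => /fine_cvgP[fin /cvgrPdist_lt/(_ eps eps0)].
move=> /(filterI fin)[n0 _ hn]; exists n0 => n /hn[nfin].
rewrite /= sub0r normrN ger0_norm ?fine_ge0 ?integral_ge0// => /ltW.
by rewrite -lee_fin fineK.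
Qed.

(** The chain rule. The truncated approximations are test functions, and the error
    on their gradients splits into the error on the gradients, multiplied by a
    factor at most 1, and the defect of the factors applied to [G]. *)
Lemma W0_soft_trunc :
  W0_gradient Omega X p (psi \o u) (fun x => dpsi (u x) *: G x).
Proof.
have [phi hphi] := W0_approx p1 uG.
have tphi n : test_function Omega (phi n) by have [] := hphi n.
have tpsi n : test_function Omega (psi \o phi n) by exact: test_function_soft_trunc.
have half eps : 0 < eps -> exists n0, forall n, (n0 <= n)%N -> (2^-1 : R) ^+ n <= eps.
  move=> eps0; have [n0 hn0] := le_pow2 eps^-1; exists n0 => n n0n.
  rewrite exprVn -[leRHS]invrK lef_pV2 ?posrE ?invr_gt0 ?exprn_gt0//.
  by apply: le_trans hn0 _; rewrite ler_eXn2l// ltr1n.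
split.
- split; first exact: measurable_soft_trunc.
  apply/(Lnorm_on_lty Omega _ p0); apply: le_lt_trans (W0_norm_lty p1 uG).
  by apply: le_int; [exact: measurable_soft_trunc|exact: mu'|move=> x; exact: soft_trunc_le].
- move=> j; have -> : (fun x => (dpsi (u x) *: G x) ord0 j) = fun x => dpsi (u x) * G x ord0 j.
    by apply/funext => x; rewrite mxE.
  have mH : measurable_fun Omega (fun x => dpsi (u x) * G x ord0 j).
    by apply: measurable_funM; [exact: measurable_soft_step|exact: mG].
  split; first exact: mH.
  apply/(Lnorm_on_lty Omega _ p0).
  have : (\int[mu]_(x in Omega) (`|G x ord0 j| `^ p)%:E < +oo)%E.
    by apply/(Lnorm_on_lty Omega _ p0); case: uG => _ /(_ j)[].
  apply: le_lt_trans; apply: le_int; [exact: mH|exact: mG|move=> x].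
  have /andP[d0 d1] := soft_step_bounds k e0 (u x).
  by rewrite normrM (ger0_norm d0) ler_piMl.
exists (fun n => psi \o phi n); split; first exact: tpsi.
  apply/(Lnorm_on_cvg0 Omega _ p0) => eps /half[n0 hn0]; exists n0 => n /hn0 h.
  apply: (@le_trans _ _ (\int[mu]_(x in Omega) (`|phi n x - u x| `^ p)%:E)%E).
    apply: le_int.
    - by apply: measurable_funB; [exact: mtest|exact: measurable_soft_trunc].
    - by apply: measurable_funB; [exact: mtest|exact: mu'].
    by move=> x; exact: soft_trunc_lipschitz.
  by have [_ + _] := hphi n; move=> /le_trans; apply; rewrite lee_fin.
apply/(Lnorm_on_cvg0 Omega _ p0) => eps eps0.
have c0 : 0 < 2 `^ p :> R by rewrite powR_gt0.
have h20 : 0 < eps / 2 `^ p / 2 by rewrite !divr_gt0.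
have [n1 hn1] := half _ h20.
have [n2 hn2] := soft_step_defect tphi (fun n => let: And3 _ h _ := hphi n in h) h20.
exists (maxn n1 n2) => n; rewrite geq_max => /andP[/hn1 h1 /hn2 h2].
have mX (chi : 'rV[R]_N -> R) j : test_function Omega chi ->
    measurable_fun Omega (fun x => Xgrad X chi x ord0 j).
  move=> tchi; apply: (measurable_funS measurableT); first exact: subsetT.
  exact/continuous_measurable_rV/(Xgrad_continuous lipX tchi).
have mXG : measurable_fun Omega (fun x => enorm (Xgrad X (phi n) x - G x) `^ p).
  apply: menorm => j.
  rewrite (_ : (fun x => _) = fun x => Xgrad X (phi n) x ord0 j - G x ord0 j).
    by apply: measurable_funB; [exact: mX|exact: mG].
  by apply/funext => x; rewrite !mxE.
have mD : measurable_fun Omega (fun x =>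
    `|dpsi (phi n x) - dpsi (u x)| `^ p * enorm (G x) `^ p).
  apply: measurable_funM; last exact: menorm.
  apply: mpow; apply: measurable_funB; apply: measurable_soft_step; last exact: mu'.
  exact: mtest.
have mXD := measurable_funD mXG mD.
apply: (@le_trans _ _ (\int[mu]_(x in Omega) (2 `^ p *
    (enorm (Xgrad X (phi n) x - G x) `^ p +
     `|dpsi (phi n x) - dpsi (u x)| `^ p * enorm (G x) `^ p))%:E)%E).
  apply: (ge0_le_integral_EFin _ mO).
  - apply: mpow; apply: measurable_enorm => j.
    rewrite (_ : (fun x => _) = fun x => Xgrad X (psi \o phi n) x ord0 j - dpsi (u x) * G x ord0 j).
      apply: measurable_funB; first exact: mX.
      by apply: measurable_funM; [exact: measurable_soft_step|exact: mG].
    by apply/funext => x; rewrite !mxE.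
  - exact: (measurable_funM (measurable_cst _) mXD).
  - by move=> x; exact: powR_ge0.
  move=> x _; rewrite (ger0_norm (enorm_ge0 _)).
  rewrite Xgrad_soft_trunc//; last by case: (tphi n).
  rewrite -powRM ?enorm_ge0//.
  apply: le_trans (powR_add_le _ _ p0); rewrite ?mulr_ge0 ?enorm_ge0//.
  apply: ge0_ler_powR; rewrite ?nnegrE ?addr_ge0 ?mulr_ge0 ?enorm_ge0 ?(ltW p0)//.
  rewrite -(enormZ (dpsi (phi n x) - dpsi (u x))).
  apply: (@le_trans _ _ (enorm (dpsi (phi n x) *: (Xgrad X (phi n) x - G x)) +
      enorm ((dpsi (phi n x) - dpsi (u x)) *: G x))).
    apply: le_trans (enormD _ _); rewrite le_eqVlt; apply/orP; left; apply/eqP.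
    by congr enorm; rewrite scalerBr scalerBl addrA subrK.
  rewrite lerD2r enormZ; have /andP[d0 d1] := soft_step_bounds k e0 (phi n x).
  by rewrite (ger0_norm d0) ler_piMl ?enorm_ge0.
rewrite (ge0_integralZ_EFin _ mO mXD (powR_ge0 _ _)); last first.
  by move=> x; rewrite addr_ge0 ?mulr_ge0 ?powR_ge0.
rewrite (ge0_integralD_EFin _ mO mXG mD); last 2 first.
- by move=> x; exact: powR_ge0.
- by move=> x; rewrite mulr_ge0 ?powR_ge0.
apply: (@le_trans _ _ ((2 `^ p)%:E * ((eps / 2 `^ p / 2)%:E + (eps / 2 `^ p / 2)%:E))%E).
  apply: lee_wpmul2l; first by rewrite lee_fin ltW.
  apply: leeD => //; have [_ _ hX] := hphi n; apply: le_trans hX _.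
  by rewrite lee_fin.
rewrite -EFinD -splitr -EFinM lee_fin mulrC divfK// gt_eqF//.
Qed.

End soft_trunc.
End sobolev_space_operations.

(** * The energy inequality *)

Section sandwich.
Context d (T : measurableType d) (R : realType).
Variables (mu : {measure set T -> \bar R}) (D : set T).
Hypothesis mD : measurable D.

Let le_integral_ge0 (f g : T -> \bar R) : (forall x, (0 <= f x)%E) ->
  (forall x, (f x <= g x)%E) -> (\int[mu]_x f x <= \int[mu]_x g x)%E.
Proof.
move=> f0 fg; have g0 x : (0 <= g x)%E by exact: le_trans (f0 x) (fg x).
rewrite (ge0_integralTE mu f0) (ge0_integralTE mu g0).
apply: le_ereal_sup => _ [h /= hf <-]; exists h => // x.
exact: le_trans (hf x) (fg x).
Qed.

(** Meant for [F x = dotv (a x (u x) (G x)) (H x)], where the Caratheodory function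
    [a] is composed with functions that are only measurable. The integral of a
    nonnegative function is a supremum over simple functions below it, hence
    monotone without any measurability, so that the bounds of [F] by the
    measurable [l] and [b] pass to the integrals. *)
Lemma Rintegral_sandwich (F l b : T -> R) :
  measurable_fun D l -> measurable_fun D b ->
  (forall x, 0 <= l x) -> (forall x, 0 <= b x) ->
  (\int[mu]_(x in D) (b x)%:E < +oo)%E ->
  {ae mu, forall x, D x -> l x <= F x <= b x} ->
  (\int[mu]_(x in D) (l x)%:E <= (Rintegral mu D F)%:E)%E.
Proof.
move=> ml mb l0 b0 bfin [A [mA A0 hA]].
have hF x : D x -> ~ A x -> l x <= F x <= b x.
  by move=> Dx nA; apply: contrapT => h; apply: nA; apply: hA => /= /(_ Dx).
pose E := D `\` A; have mE : measurable E by exact: measurableD.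
have ED (f : T -> R) : measurable_fun D f -> (forall x, 0 <= f x) ->
    (\int[mu]_(x in D) (f x)%:E = \int[mu]_(x in E) (f x)%:E)%E.
  move=> mf f0; apply/esym; rewrite /E.
  have mf' : measurable_fun D (EFin \o f) by exact/measurable_EFinP.
  by rewrite -(ge0_negligible_integral mA mD mf' _ A0)// => x _; rewrite lee_fin.
pose Fr : T -> \bar R := (EFin \o F) \_ D.
(* The values of [F] on the null set [A] are dominated by an infinite function
   carried by [A], whose integral is 0. *)
pose oA : T -> \bar R := (cst +oo%E) \_ A.
have oA0 x : (0 <= oA x)%E by rewrite /oA patchE; case: ifP => _; [exact: leey|exact: lexx].
have moA : measurable_fun setT oA.
  by apply/(measurable_restrictT _ mA).1; exact: measurable_cst.
have oA1 x : A x -> oA x = +oo%E by move=> Ax; rewrite /oA patchE mem_set.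
have IoA : (\int[mu]_x oA x = 0)%E.
  by rewrite /oA -integral_mkcond integral_cst// A0 mule0.
pose bE : T -> \bar R := (EFin \o b) \_ E.
have bE0 x : (0 <= bE x)%E by rewrite /bE patchE; case: ifP => _; [rewrite lee_fin|exact: lexx].
have mbE : measurable_fun setT bE.
  apply/(measurable_restrictT _ mE).1/measurable_EFinP.
  by apply: measurable_funS mb => //; exact: subDsetl.
have Fpos : (\int[mu]_(x in E) (l x)%:E <= \int[mu]_x Fr^\+ x <= \int[mu]_(x in D) (b x)%:E)%E.
  apply/andP; split.
    rewrite integral_mkcond; apply: le_integral_ge0 => x.
      by apply: erestrict_ge0 => y _; rewrite lee_fin.
    rewrite patchE; case: ifPn => [|_]; last exact: funepos_ge0.
    rewrite inE => -[Dx nA]; rewrite funeposE /Fr patchE mem_set//= le_max.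
    by have /andP[lF _] := hF x Dx nA; rewrite lee_fin lF.
  rewrite (ED _ mb b0) [leRHS]integral_mkcond -[leRHS]adde0 -IoA -ge0_integralD//.
  apply: le_integral_ge0 => [x|x]; first exact: funepos_ge0.
  have [Ax|nA] := pselect (A x).
    by rewrite oA1// addey ?leey// gt_eqF// (lt_le_trans _ (bE0 x))// ltNy0.
  have [Dx|nD] := pselect (D x); last first.
    rewrite funeposE /Fr patchE memNset//= maxxx.
    by apply: adde_ge0; [exact: bE0|exact: oA0].
  rewrite funeposE /Fr patchE mem_set//= ge_max; apply/andP; split.
    rewrite -[leLHS]adde0; apply: leeD => //.
    rewrite patchE mem_set//= lee_fin.
    by have /andP[_ Fb] := hF x Dx nA.
  by apply: adde_ge0; [exact: bE0|exact: oA0].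
have Fneg : (\int[mu]_x Fr^\- x = 0)%E.
  apply/eqP; rewrite eq_le; apply/andP; split; last first.
    by apply: integral_ge0 => x _; rewrite funeneg_ge0.
  rewrite -IoA; apply: le_integral_ge0 => [x|x]; first exact: funeneg_ge0.
  have [Ax|nA] := pselect (A x); first by rewrite /oA patchE mem_set// leey.
  rewrite /oA patchE memNset// funenegE /Fr patchE; case: ifPn => [|_]; last first.
    by rewrite oppe0 maxxx.
  rewrite inE => Dx; have /andP[lF _] := hF x Dx nA.
  by rewrite ge_max lexx andbT -EFinN lee_fin oppr_le0 (le_trans (l0 x)).
have FE : (\int[mu]_(x in D) (F x)%:E = \int[mu]_x Fr^\+ x)%E.
  by rewrite integral_mkcond integralE Fneg sube0.
rewrite /Rintegral FE fineK; last first.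
  have /andP[_ h2] := Fpos; rewrite ge0_fin_numE ?(le_lt_trans h2)//.
  by apply: integral_ge0 => x _; rewrite funepos_ge0.
by rewrite (ED _ ml l0); have /andP[] := Fpos.
Qed.

End sandwich.

Section energy.
Variables (R : realType) (N d : nat) (X : 'I_d -> 'rV[R]_N -> 'rV[R]_N).
Hypothesis lipX : forall j, locally_lipschitz (X j).
Variable Omega : set 'rV[R]_N.
Hypotheses (oO : open Omega).
Variables (p alpha beta : R) (h f u : 'rV[R]_N -> R) (G : 'rV[R]_N -> 'rV[R]_d).
Variable a : 'rV[R]_N -> R -> 'rV[R]_d -> 'rV[R]_d.
Hypotheses (p1 : 1 < p) (alpha0 : 0 < alpha) (beta0 : 0 < beta).
Hypotheses (Lh : Lspace_on Omega (p / (p - 1))%:E h)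
  (aP : structure_conditions Omega p alpha beta h a).
Hypotheses (mf : measurable_fun Omega f) (uG : W0_gradient Omega X p u G).
Hypothesis weak : forall v H, W0_gradient Omega X p v H ->
  Rintegral lebesgueN Omega (fun x => dotv (a x (u x) (G x)) (H x)) =
  Rintegral lebesgueN Omega (fun x => f x * v x).
Local Notation mu := (@lebesgueN R N).

Let p0 : 0 < p. Proof. exact: lt_trans p1. Qed.
Let mO : measurable Omega. Proof. exact: open_measurable_rV. Qed.

Lemma W0_gradient_sign c : c = 1 \/ c = -1 ->
  W0_gradient Omega X p (fun x => c * u x) (fun x => c *: G x).
Proof.
case=> ->.
  have -> : (fun x => 1 * u x) = u by apply/funext => x; rewrite mul1r.
  by have -> : (fun x => 1 *: G x) = G by apply/funext => x; rewrite scale1r.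
have -> : (fun x => -1 * u x) = (fun x => - u x) by apply/funext => x; rewrite mulN1r.
have -> : (fun x => -1 *: G x) = (fun x => - G x) by apply/funext => x; rewrite scaleN1r.
exact: W0_gradientN.
Qed.

(** The equation is tested with [c * soft_trunc k e (c * u)], whose gradient is
    [soft_step k e (c * u) *: G] because [c * c = 1]; the sign [c] gives access
    to the positive and to the negative part of [u]. *)
Lemma energy_inequality c k e : c = 1 \/ c = -1 -> 0 < e ->
  (alpha%:E * \int[mu]_(x in Omega) (soft_step k e (c * u x) * enorm (G x) `^ p)%:E <=
   \int[mu]_(x in Omega) (`|f x| * `|soft_trunc k e (c * u x)|)%:E)%E.
Proof.
move=> c1 e0.
have cc : c * c = 1 by case: c1 => ->; ring.
have cuG := W0_gradient_sign c1.
have mcu := W0_measurable cuG.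
have vH := W0_soft_trunc lipX oO p1 k e0 cuG.
pose v x := c * soft_trunc k e (c * u x).
pose H x := c *: (soft_step k e (c * u x) *: (c *: G x)).
have {}vH : W0_gradient Omega X p v H.
  rewrite /v /H; case: c1 vH => -> vH.
    have -> : (fun x => 1 * soft_trunc k e (1 * u x)) = fun x => soft_trunc k e (1 * u x).
      by apply/funext => x; rewrite mul1r.
    have -> // : (fun x => 1 *: (soft_step k e (1 * u x) *: (1 *: G x))) =
        fun x => soft_step k e (1 * u x) *: (1 *: G x).
    by apply/funext => x; rewrite scale1r.
  have -> : (fun x => -1 * soft_trunc k e (-1 * u x)) = fun x => - soft_trunc k e (-1 * u x).
    by apply/funext => x; rewrite mulN1r.
  have -> : (fun x => -1 *: (soft_step k e (-1 * u x) *: (-1 *: G x))) =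
      fun x => - (soft_step k e (-1 * u x) *: (-1 *: G x)).
    by apply/funext => x; rewrite scaleN1r.
  exact: W0_gradientN vH.
have mGp : measurable_fun Omega (fun x => enorm (G x) `^ p).
  apply: (measurableT_comp (measurable_powR _)); apply: measurable_enorm => j.
  exact: W0_gradient_measurable uG.
have mstep := measurable_soft_step k e0 mcu.
have d01 x : 0 <= soft_step k e (c * u x) <= 1 by exact: soft_step_bounds.
have d0 x : 0 <= soft_step k e (c * u x) by have /andP[] := d01 x.
have ml0 : measurable_fun Omega (fun x => soft_step k e (c * u x) * enorm (G x) `^ p).
  exact: measurable_funM mstep mGp.
pose l x := alpha * (soft_step k e (c * u x) * enorm (G x) `^ p).
have ml : measurable_fun Omega l by exact: (measurable_funM (measurable_cst _) ml0).
have l0 x : 0 <= l x by rewrite mulr_ge0 ?(ltW alpha0)// mulr_ge0 ?powR_ge0.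
have p'0 : 0 < p / (p - 1) by rewrite divr_gt0// subr_gt0.
pose b1 x := `|h x| `^ (p / (p - 1)) + `|u x| `^ p.
(* The growth condition and Young's inequality bound [dotv (a x (u x) (G x)) (G x)]
   by [b x]: each of the three terms of the condition contributes one
   [enorm (G x) `^ p], and the first two also the terms of [b1 x]. *)
pose b x := beta * (b1 x + 3 * enorm (G x) `^ p).
have mh : measurable_fun Omega (fun x => `|h x| `^ (p / (p - 1))).
  by apply: (measurableT_comp (measurable_powR _)); apply: measurableT_comp => //; case: Lh.
have mup : measurable_fun Omega (fun x => `|u x| `^ p).
  apply: (measurableT_comp (measurable_powR _)); apply: measurableT_comp => //.
  exact: W0_measurable uG.
have mb1 : measurable_fun Omega b1 by exact: measurable_funD.
have m3 : measurable_fun Omega (fun x => 3 * enorm (G x) `^ p).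
  exact: (measurable_funM (measurable_cst _) mGp).
have mb2 : measurable_fun Omega (fun x => b1 x + 3 * enorm (G x) `^ p).
  exact: measurable_funD.
have mb : measurable_fun Omega b by exact: (measurable_funM (measurable_cst _) mb2).
have b10 x : 0 <= b1 x by rewrite addr_ge0 ?powR_ge0.
have b30 x : 0 <= 3 * enorm (G x) `^ p by rewrite mulr_ge0 ?powR_ge0.
have b20 x : 0 <= b1 x + 3 * enorm (G x) `^ p by rewrite addr_ge0.
have b0 x : 0 <= b x by rewrite mulr_ge0 ?(ltW beta0).
have bfin : (\int[mu]_(x in Omega) (b x)%:E < +oo)%E.
  rewrite (ge0_integralZ_EFin _ mO mb2 (ltW beta0) b20).
  rewrite lte_mul_pinfty ?lee_fin ?(ltW beta0)//.
  rewrite (ge0_integralD_EFin _ mO mb1 m3 b10 b30).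
  rewrite (ge0_integralD_EFin _ mO mh mup (fun=> powR_ge0 _ _) (fun=> powR_ge0 _ _)).
  rewrite (ge0_integralZ_EFin _ mO mGp (ler0n R 3) (fun=> powR_ge0 _ _)).
  apply: lte_add_pinfty; first apply: lte_add_pinfty.
  - by apply/(Lnorm_on_lty Omega _ p'0); case: Lh.
  - exact: (W0_norm_lty p1 uG).
  - by rewrite lte_mul_pinfty ?lee_fin//; exact: (W0_energy_lty oO p1 uG).
pose F x := dotv (a x (u x) (G x)) (H x).
have FE x : F x = soft_step k e (c * u x) * dotv (a x (u x) (G x)) (G x).
  rewrite /F /H !scalerA dotvZr; congr (_ * _).
  by rewrite mulrAC cc mul1r.
have Fb : {ae mu, forall x, Omega x -> l x <= F x <= b x}.
  case: aP => _ _; apply: (@filterS _ _ (ae_filter_ringOfSetsType mu)) => x aPx Ox.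
  have [coer grow _] := aPx Ox (u x) (G x).
  rewrite FE; apply/andP; split; first by rewrite /l mulrCA ler_wpM2l.
  have g0 := enorm_ge0 (G x).
  have dotb : dotv (a x (u x) (G x)) (G x) <= b x.
    apply: le_trans (le_trans (ler_norm _) (dotv_le_enorm _ _)) _.
    apply: le_trans (ler_wpM2r g0 grow) _.
    rewrite -mulrA ler_pM2l// !mulrDl.
    have e1 : h x * enorm (G x) <= `|h x| `^ (p / (p - 1)) + enorm (G x) `^ p.
      apply: le_trans (conjugate_powR_le (normr_ge0 (h x)) g0 p1).
      by rewrite ler_wpM2r// ler_norm.
    have e2 := powRB1_mul_le (normr_ge0 (u x)) g0 p1.
    have e3 : enorm (G x) `^ (p - 1) * enorm (G x) = enorm (G x) `^ p.
      by rewrite mulrC mulr_powRB1.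
    rewrite e3 /b1; lra.
  have [dot0|/ltW dot0] := leP 0 (dotv (a x (u x) (G x)) (G x)).
    by apply: le_trans dotb; rewrite ler_piMl//; have /andP[] := d01 x.
  by apply: le_trans (b0 x); rewrite mulr_ge0_le0.
have := Rintegral_sandwich mO ml mb l0 b0 bfin Fb.
rewrite (ge0_integralZ_EFin _ mO ml0 (ltW alpha0)); last first.
  by move=> x; rewrite mulr_ge0 ?powR_ge0.
move=> /le_trans; apply; rewrite /F (weak vH).
have mfv : measurable_fun Omega (fun x => (f x * v x)%:E).
  by apply/measurable_EFinP/measurable_funM => //; exact: W0_measurable vH.
apply: (@le_trans _ _ (`|\int[mu]_(x in Omega) (f x * v x)%:E|)%E).
  by rewrite /Rintegral; case: (\int[mu]_(x in Omega) _)%E => [r| |] /=; rewrite ?leey// lee_fin ler_norm.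
apply: le_trans (le_abse_integral _ mO mfv) _.
rewrite le_eqVlt; apply/orP; left; apply/eqP; apply: eq_integral => x _.
rewrite /v abse_EFin !normrM; congr (_ * _)%:E.
have -> : `|c| = 1 by case: c1 => ->; rewrite ?normrN normr1.
by rewrite mul1r.
Qed.

End energy.

(** * Level sets *)

(** Stampacchia's lemma. Along the levels [d * (1 - 2 ^- n)] the assumed inequality
    is a superlinear recurrence for [A], and the size condition on [d] is what
    the induction step of the decay [A (lev n) <= V * 2 `^ (- nu * n)] asks for;
    the exponent [nu] balances the factor [2 `^ q] lost at each step. *)
Lemma stampacchia (R : realType) (A : R -> R) (q gamma K V d : R) :
  (forall k, 0 <= A k) -> (forall k l, k <= l -> A l <= A k) ->
  0 < q -> 1 < gamma -> 0 < V -> A 0 <= V -> 0 < d ->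
  (forall k l, 0 <= k -> k < l -> (l - k) `^ q * A l <= K * A k `^ gamma) ->
  K * (2 `^ (q + q / (gamma - 1)) * V `^ (gamma - 1)) <= d `^ q ->
  A d = 0.
Proof.
move=> A0 Amono q0 g1 V0 AV d0 hA hd.
have g0 : 0 < gamma - 1 by rewrite subr_gt0.
set nu := q / (gamma - 1); have nu0 : 0 < nu by rewrite divr_gt0.
pose lev n := d * (1 - 2^-1 ^+ n).
have lev_ge0 n : 0 <= lev n.
  by rewrite mulr_ge0 ?(ltW d0)// subr_ge0 exprn_ile1// invf_le1// ler1n.
have key n : A (lev n) <= V * (2 `^ (- nu)) ^+ n.
  elim: n => [|n IH]; first by rewrite /lev expr0 subrr mulr0 mulr1.
  have gap : lev n.+1 - lev n = d * 2^-1 ^+ n.+1.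
    by rewrite /lev exprS; field.
  have gap0 : 0 < lev n.+1 - lev n by rewrite gap mulr_gt0// exprn_gt0.
  have := hA (lev n) (lev n.+1) (lev_ge0 n); rewrite -subr_gt0 => /(_ gap0).
  rewrite gap powRM ?(ltW d0) ?exprn_ge0// powR_exprn//.
  have -> : (2^-1 : R) `^ q = (2 `^ q)^-1 by rewrite -powRN -powR_inv1// -powRrM mulN1r.
  rewrite exprVn => h.
  have c0 : 0 < (2 `^ q) ^+ n.+1 :> R by rewrite exprn_gt0// powR_gt0.
  have dq0 : 0 < d `^ q by rewrite powR_gt0.
  have {}h : A (lev n.+1) * d `^ q <= (2 `^ q) ^+ n.+1 * (K * A (lev n) `^ gamma).
    by rewrite mulrC -ler_pdivrMl// mulrA [_^-1 * _]mulrC.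
  have [K0|K0] := ltP K 0.
    have : A (lev n.+1) * d `^ q <= 0.
      apply: le_trans h _; rewrite mulr_ge0_le0 ?(ltW c0)//.
      by rewrite mulr_le0_ge0 ?powR_ge0// ltW.
    rewrite pmulr_lle0// => /le_trans; apply.
    by rewrite mulr_ge0 ?(ltW V0)// exprn_ge0// powR_ge0.
  have hI : A (lev n) `^ gamma <= V `^ gamma * (2 `^ (- nu * gamma)) ^+ n.
    apply: (@le_trans _ _ ((V * (2 `^ (- nu)) ^+ n) `^ gamma)).
      apply: ge0_ler_powR; rewrite ?nnegrE//; first by rewrite (le_trans _ (ltW g1)).
      by rewrite mulr_ge0 ?(ltW V0)// exprn_ge0// powR_ge0.
    by rewrite powRM ?(ltW V0) ?exprn_ge0 ?powR_ge0// powR_exprn ?powR_ge0// -powRrM.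
  rewrite -(ler_pM2r dq0); apply: le_trans h _.
  apply: (@le_trans _ _ ((2 `^ q) ^+ n.+1 * (K * (V `^ gamma * (2 `^ (- nu * gamma)) ^+ n)))).
    by rewrite ler_wpM2l ?(ltW c0)// ler_wpM2l.
  apply: (@le_trans _ _ (V * 2 `^ (- nu) ^+ n.+1 *
      (K * (2 `^ (q + nu) * V `^ (gamma - 1))))); last first.
    by rewrite ler_wpM2l// mulr_ge0 ?(ltW V0)// exprn_ge0// powR_ge0.
  have -> : V `^ gamma = V * V `^ (gamma - 1).
    by rewrite mulr_powRB1 ?(ltW V0)// (lt_trans _ g1).
  have -> : 2 `^ (- nu * gamma) = 2 `^ (- nu) * (2 `^ q)^-1 :> R.
    rewrite -powRN -powRD; last by rewrite pnatr_eq0 implybT.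
    by congr powR; rewrite /nu; field; rewrite gt_eqF.
  have -> : 2 `^ (q + nu) = 2 `^ q * (2 `^ (- nu))^-1 :> R.
    by rewrite -powRN opprK -powRD// pnatr_eq0 implybT.
  rewrite !exprS exprMn exprVn le_eqVlt; apply/orP; left; apply/eqP.
  by field; rewrite !gt_eqF ?exprn_gt0 ?powR_gt0.
apply/eqP; rewrite eq_le A0 andbT; apply/ler_addgt0Pr => e e0; rewrite add0r.
have th0 : 0 <= 2 `^ (- nu) :> R by exact: powR_ge0.
have th1 : `|2 `^ (- nu)| < 1 :> R.
  rewrite ger0_norm// powRN invf_lt1 ?powR_gt0//.
  by rewrite -[ltLHS](congr1 (fun h => h nu) (powR1 R)) gt0_ltr_powR ?nnegrE// ltr1n.
have /cvgrPdist_lt/(_ e e0)[n _ /(_ n (leqnn n))] := cvg_geometric V th1.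
rewrite /= sub0r normrN ger0_norm; last by rewrite mulr_ge0 ?(ltW V0)// exprn_ge0.
move=> /ltW hn; apply: le_trans (le_trans (key n) hn).
by apply: Amono; rewrite /lev ler_piMr ?(ltW d0)// lerBlDr lerDl exprn_ge0.
Qed.

Section hoelder_on.
Context d (T : measurableType d) (R : realType).
Variables (mu : {measure set T -> \bar R}) (D : set T).
Hypothesis mD : measurable D.

(** Hoelder's inequality with the integrals over a domain written out. *)
Lemma hoelder_on (f g : T -> R) (p q : R) :
  measurable_fun D f -> measurable_fun D g -> 0 < p -> 0 < q ->
  p^-1 + q^-1 = 1 ->
  (\int[mu]_(x in D) (`|f x| * `|g x|)%:E <=
   (\int[mu]_(x in D) (`|f x| `^ p)%:E) `^ p^-1 *
   (\int[mu]_(x in D) (`|g x| `^ q)%:E) `^ q^-1)%E.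
Proof.
move=> mf mg p0 q0 pq.
have E (r : R) (v : T -> R) : r != 0 -> 'N[mu]_r%:E[EFin \o (v \_ D)]%E =
    ((\int[mu]_(x in D) (`|v x| `^ r)%:E) `^ r^-1)%E.
  move=> r0; rewrite unlock; congr (_ `^ _)%E; rewrite [RHS]integral_mkcond.
  apply: eq_integral => x _; rewrite /= !patchE; case: ifP => // _.
  by rewrite -[point]/(0 : R) normr0 powR0.
have mf' : measurable_fun setT (f \_ D) by exact/(measurable_restrictT _ mD).1.
have mg' : measurable_fun setT (g \_ D) by exact/(measurable_restrictT _ mD).1.
have := hoelder mu mf' mg' p0 q0 pq; rewrite !E ?gt_eqF//; apply: le_trans.
rewrite Lnorm1 le_eqVlt; apply/orP; left; apply/eqP; rewrite integral_mkcond.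
apply: eq_integral => x _; rewrite /= !patchE; case: ifP => _; last first.
  by rewrite [X in (`|X * _|)%R](_ : point = 0)// mul0r normr0.
by rewrite normrM.
Qed.

End hoelder_on.

(** The [q]-th power of the bound of the solution is the size required by
    Stampacchia's lemma. *)
Lemma level_constant_powR (R : realType) (S P W p q : R) :
  0 < q -> 0 <= P -> 0 <= W ->
  S `^ (p / (p - 1)) * (2 * P) `^ (q / (p - 1)) * W =
  (S `^ (p / (p - 1) / q) * 2 `^ (p - 1)^-1 * W `^ q^-1 * P `^ (p - 1)^-1) `^ q.
Proof.
move=> q0 P0 W0.
have A0 : 0 <= S `^ (p / (p - 1) / q) by exact: powR_ge0.
have B0 : 0 <= 2 `^ (p - 1)^-1 :> R by exact: powR_ge0.
have C0 : 0 <= W `^ q^-1 by exact: powR_ge0.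
have D0 : 0 <= P `^ (p - 1)^-1 by exact: powR_ge0.
rewrite (powRM _ (mulr_ge0 (mulr_ge0 A0 B0) C0) D0).
rewrite (powRM _ (mulr_ge0 A0 B0) C0) (powRM _ A0 B0) (powRM _ (ler0n R 2) P0) -!powRrM.
rewrite divfK ?gt_eqF// [q^-1 * q]mulVf ?gt_eqF// (powRr1 W0) ![_^-1 * q]mulrC.
by ring.
Qed.

(** The abstract part of the argument: [U] stands for [u] or [- u], and the only
    information about the equation is the bound [trunc_bound] of the truncations
    of [U] by their products with the datum [f]. *)
Section level_sets.
Context d (T : measurableType d) (R : realType).
Variables (mu : {measure set T -> \bar R}) (D : set T) (U f : T -> R) (p q m S : R).
Hypotheses (mD : measurable D) (muD : mu D \is a fin_num).
Hypotheses (mU : measurable_fun D U) (mf : measurable_fun D f).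
Hypotheses (p1 : 1 < p) (m1 : 1 < m) (S0 : 0 <= S).
Let mc := m / (m - 1).
Hypothesis qm : mc * p < q.
Hypotheses (If : (\int[mu]_(x in D) (`|f x| `^ m)%:E < +oo)%E)
  (IU : (\int[mu]_(x in D) (`|U x| `^ q)%:E < +oo)%E).
Hypothesis trunc_bound : forall k e, 0 <= k -> 0 < e ->
  (\int[mu]_(x in D) (`|soft_trunc k e (U x)| `^ q)%:E <=
   S%:E * (\int[mu]_(x in D) (`|f x| * `|soft_trunc k e (U x)|)%:E) `^ (q / p))%E.

Let excess k x := Num.max 0 (U x - k).
Let level k := D `&` [set x | k < U x].
Let area k := fine (mu (level k)).
Let W k := fine (\int[mu]_(x in D) (excess k x `^ q)%:E).
Let Phi := fine (\int[mu]_(x in D) (`|f x| `^ m)%:E) `^ m^-1.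

Let p0 : 0 < p. Proof. exact: lt_trans p1. Qed.
Let m0 : 0 < m. Proof. exact: lt_trans m1. Qed.
Let mm0 : 0 < m - 1. Proof. by rewrite subr_gt0. Qed.
Let mc1 : 1 < mc. Proof. by rewrite /mc ltr_pdivlMr// mul1r gtrBl. Qed.
Let mc0 : 0 < mc. Proof. exact: lt_trans mc1. Qed.
Let mcq : mc < q.
Proof. by apply: lt_trans qm; rewrite ltr_pMr. Qed.
Let q0 : 0 < q. Proof. exact: lt_trans mcq. Qed.

Let excess_ge0 k x : 0 <= excess k x.
Proof. by rewrite /excess le_max lexx. Qed.

Let excess_le k x : 0 <= k -> excess k x <= `|U x|.
Proof.
move=> k0; rewrite /excess ge_max normr_ge0/= (le_trans _ (ler_norm _))//.
by rewrite lerBlDr lerDl.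
Qed.

Let measurable_excess k : measurable_fun D (excess k).
Proof.
apply: measurable_maxr; first exact: measurable_cst.
exact: measurable_funB mU (measurable_cst _).
Qed.

Let mpow r (v : T -> R) : measurable_fun D v -> measurable_fun D (fun x => v x `^ r).
Proof. by move=> mv; exact: (measurableT_comp (measurable_powR _)). Qed.

Let mnorm (v : T -> R) : measurable_fun D v -> measurable_fun D (fun x => `|v x|).
Proof. by move=> mv; exact: measurableT_comp. Qed.

Let measurable_level k : measurable (level k).
Proof.
have := mU mD (measurable_itv `]k, +oo[).
by rewrite /level; congr measurable; apply/seteqP; split=> x /=; rewrite in_itv/= andbT.
Qed.

Let area_fin k : mu (level k) \is a fin_num.
Proof.
rewrite ge0_fin_numE ?measure_ge0//; apply: (@le_lt_trans _ _ (mu D)).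
  by apply: le_measure; rewrite ?inE//; exact: subIsetl.
by rewrite -ge0_fin_numE ?measure_ge0.
Qed.

Let int_fin (v : T -> R) : (forall x, 0 <= v x) ->
  (\int[mu]_(x in D) (v x)%:E < +oo)%E ->
  ((fine (\int[mu]_(x in D) (v x)%:E))%:E = \int[mu]_(x in D) (v x)%:E)%E.
Proof.
move=> v0 h; rewrite fineK// ge0_fin_numE//.
by apply: integral_ge0 => x _; rewrite lee_fin.
Qed.

Let WE k : 0 <= k -> ((W k)%:E = \int[mu]_(x in D) (excess k x `^ q)%:E)%E.
Proof.
move=> k0; apply: int_fin; first by move=> x; exact: powR_ge0.
apply: le_lt_trans IU; apply: (ge0_le_integral_EFin _ mD).
- exact: mpow.
- by apply: mpow; exact: mnorm.
- by move=> x; exact: powR_ge0.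
by move=> x _; apply: ge0_ler_powR; rewrite ?nnegrE ?(ltW q0) ?excess_le.
Qed.

Let W0 k : 0 <= W k.
Proof. by apply/fine_ge0/integral_ge0 => x _; rewrite lee_fin powR_ge0. Qed.

Let area0 k : 0 <= area k. Proof. by rewrite fine_ge0. Qed.

Let PhiE : ((\int[mu]_(x in D) (`|f x| `^ m)%:E) `^ m^-1 = Phi%:E)%E.
Proof.
rewrite /Phi -poweR_EFin; congr (_ `^ _)%E; apply/esym/int_fin; last exact: If.
by move=> x; exact: powR_ge0.
Qed.

Let Phi0 : 0 <= Phi. Proof. exact: powR_ge0. Qed.

Let measurable_indic_level k : measurable_fun D (\1_(level k) : T -> R).
Proof. by apply: measurable_indic; exact: measurable_level. Qed.

(** The excess over [k] is carried by the level set, and [mc < q]. *)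
Let excess_mc k : 0 <= k ->
  (\int[mu]_(x in D) (excess k x `^ mc)%:E <=
   (W k `^ (mc / q) * area k `^ (1 - mc / q))%:E)%E.
Proof.
move=> k0.
have t1 : 0 < 1 - mc / q by rewrite subr_gt0 ltr_pdivrMr// mul1r.
have qmc0 : 0 < q / mc by rewrite divr_gt0.
have t'0 : 0 < (1 - mc / q)^-1 by rewrite invr_gt0.
have conj : (q / mc)^-1 + ((1 - mc / q)^-1)^-1 = 1 by rewrite invrK [(q / mc)^-1]invf_div addrC subrK.
have := hoelder_on mu mD (mpow mc (measurable_excess k)) (measurable_indic_level k)
  qmc0 t'0 conj.
rewrite invrK [(q / mc)^-1]invf_div.
have -> : (\int[mu]_(x in D) (`|excess k x `^ mc| * `|\1_(level k) x|)%:E =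
    \int[mu]_(x in D) (excess k x `^ mc)%:E)%E.
  apply: eq_integral => x; rewrite inE => Dx.
  rewrite ger0_norm ?powR_ge0// indicE.
  have [xk|xk] := boolP (x \in level k); first by rewrite normr1 mulr1.
  rewrite normr0 mulr0; have -> : excess k x = 0.
    apply/max_idPl; rewrite subr_le0 leNgt; apply/negP => kx.
    by move/negP: xk; apply; rewrite inE.
  by rewrite powR0// gt_eqF.
have -> : (\int[mu]_(x in D) (`|excess k x `^ mc| `^ (q / mc))%:E = (W k)%:E)%E.
  rewrite (WE k0); apply: eq_integral => x _; rewrite ger0_norm ?powR_ge0// -powRrM.
  by rewrite mulrC divfK// gt_eqF.
have -> : (\int[mu]_(x in D) (`|\1_(level k) x| `^ (1 - mc / q)^-1)%:E = (area k)%:E)%E.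
  rewrite /area fineK// -[in RHS](_ : level k `&` D = level k); last first.
    by apply/setIidPl; exact: subIsetl.
  rewrite -integral_indic//; apply: eq_integral => x _; rewrite indicE.
  by case: (x \in level k); rewrite ?normr1 ?powR1 ?normr0 ?powR0// gt_eqF.
by rewrite !poweR_EFin -EFinM.
Qed.

Let int_f_excess k : 0 <= k ->
  (\int[mu]_(x in D) (`|f x| * excess k x)%:E <=
   (Phi * (W k `^ q^-1 * area k `^ (mc^-1 - q^-1)))%:E)%E.
Proof.
move=> k0.
have conj : m^-1 + mc^-1 = 1.
  by rewrite /mc; field; rewrite !gt_eqF.
have := hoelder_on mu mD mf (measurable_excess k) m0 mc0 conj.
have -> : (\int[mu]_(x in D) (`|f x| * `|excess k x|)%:E =
    \int[mu]_(x in D) (`|f x| * excess k x)%:E)%E.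
  by apply: eq_integral => x _; rewrite (ger0_norm (excess_ge0 k x)).
have -> : (\int[mu]_(x in D) (`|excess k x| `^ mc)%:E =
    \int[mu]_(x in D) (excess k x `^ mc)%:E)%E.
  by apply: eq_integral => x _; rewrite (ger0_norm (excess_ge0 k x)).
rewrite PhiE => /le_trans; apply; rewrite EFinM; apply: lee_wpmul2l; first by rewrite lee_fin.
apply: (@le_trans _ _ ((W k `^ (mc / q) * area k `^ (1 - mc / q))%:E `^ mc^-1)%E).
  apply: gt0_ler_poweR; rewrite ?invr_ge0 ?(ltW mc0) ?in_itv/= ?leey ?andbT//.
  - by apply: integral_ge0 => x _; rewrite lee_fin powR_ge0.
  - by rewrite lee_fin mulr_ge0 ?powR_ge0.
  - exact: excess_mc.
rewrite poweR_EFin lee_fin powRM ?powR_ge0// -!powRrM.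
rewrite le_eqVlt; apply/orP; left; apply/eqP; congr (_ `^ _ * _ `^ _).
  by field; rewrite !gt_eqF.
by rewrite mulrBl mul1r mulrAC divff ?gt_eqF// mul1r.
Qed.

(** The truncation of parameter [e] differs from the excess by at most [e]; as [f]
    is integrable on [D], of finite measure, [e] can be sent to 0. *)
Let excess_bound k : 0 <= k ->
  W k <= S * (2 * (Phi * (W k `^ q^-1 * area k `^ (mc^-1 - q^-1)))) `^ (q / p).
Proof.
move=> k0; set j := Phi * _.
have j0 : 0 <= j by rewrite mulr_ge0// mulr_ge0 ?powR_ge0.
have mff : measurable_fun D (fun x => `|f x|) by exact: mnorm.
have mfe : measurable_fun D (fun x => `|f x| * excess k x).
  exact: measurable_funM mff (measurable_excess k).
have F1 : (\int[mu]_(x in D) (`|f x|)%:E < +oo)%E.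
  apply: (@le_lt_trans _ _ (\int[mu]_(x in D) (1 + `|f x| `^ m)%:E)%E).
    apply: (ge0_le_integral_EFin _ mD) => //.
      exact: measurable_funD (measurable_cst _) (mpow m mff).
    move=> x _; have [f1|/ltW f1] := leP `|f x| 1; first by rewrite ler_wpDr ?powR_ge0.
    by rewrite ler_wpDl// le1r_powR// ltW.
  have m1c : measurable_fun D (fun=> 1 : R) by exact: measurable_cst.
  rewrite (ge0_integralD_EFin _ mD m1c (mpow m mff) (fun=> ler01) (fun=> powR_ge0 _ _)).
  apply: lte_add_pinfty; last exact: If.
  rewrite (integral_cst mu mD 1%:E) mul1e -ge0_fin_numE; [exact: muD|exact: measure_ge0].
pose F := fine (\int[mu]_(x in D) (`|f x|)%:E).
have FE : (\int[mu]_(x in D) (`|f x|)%:E = F%:E)%E by rewrite /F int_fin.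
have F0 : 0 <= F by apply/fine_ge0/integral_ge0 => x _; rewrite lee_fin.
have mtr e : 0 < e -> measurable_fun D (fun x => soft_trunc k e (U x)).
  move=> e0; apply: measurableT_comp mU; apply: continuous_measurable_fun => s.
  by apply/differentiable_continuous/derivable1_diffP; case: (is_derive_soft_trunc k e0 s).
have e_gt0 n : 0 < (2^-1 : R) ^+ n by rewrite exprn_gt0.
have approx e x : 0 < e -> `|soft_trunc k e (U x) - excess k x| <= e.
  by move=> e0; exact: soft_trunc_approx.
have limit x : soft_trunc k (2^-1 ^+ n) (U x) @[n --> \oo] --> excess k x.
  apply/cvgrPdist_le => e e0; have h1 : `|2^-1 : R| < 1.
    by rewrite ger0_norm// invf_lt1// ltr1n.
  have /cvgrPdist_lt/(_ e e0)[n0 _ hn0] := cvg_geometric (1 : R) h1.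
  exists n0 => // n /hn0; rewrite /= sub0r normrN mul1r (gtr0_norm (e_gt0 n)) => /ltW.
  by apply: le_trans; rewrite distrC; exact: approx.
have key eps : 0 < eps ->
    (\int[mu]_(x in D) (excess k x `^ q)%:E <= (S * (1 * (eps + j)) `^ (q / p))%:E)%E.
  move=> eps0; have [n0 hn0] := le_pow2 ((F + 1) / eps).
  apply: (@fatou_bound _ _ _ mu _ mD
    (fun n x => `|soft_trunc k (2^-1 ^+ n) (U x)| `^ q) _ _ n0).
  - by move=> n; apply: mpow; apply: mnorm; exact: mtr.
  - exact: mpow.
  - by move=> n x; exact: powR_ge0.
  - by move=> x; exact: powR_ge0.
  - apply: aeW => x _; rewrite -[X in _ --> X `^ _](ger0_norm (excess_ge0 k x)).
    by apply: (@continuous_cvg _ _ _ _ _ _ (fun a : R => `|a| `^ q)); [exact: powR_norm_continuous|].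
  move=> n n0n; apply: le_trans (trunc_bound k0 (e_gt0 n)) _.
  rewrite EFinM; apply: lee_wpmul2l; first by rewrite lee_fin.
  rewrite mul1r -poweR_EFin; apply: gt0_ler_poweR.
  - by rewrite divr_ge0// ltW.
  - rewrite in_itv/= leey andbT; apply: integral_ge0 => x _.
    by rewrite lee_fin mulr_ge0.
  - by rewrite in_itv/= leey andbT lee_fin addr_ge0// ltW.
  have mfe2 : measurable_fun D (fun x => 2^-1 ^+ n * `|f x|).
    exact: measurable_funM (measurable_cst _) mff.
  apply: (@le_trans _ _ (\int[mu]_(x in D) (2^-1 ^+ n * `|f x| + `|f x| * excess k x)%:E)%E).
    apply: (ge0_le_integral_EFin _ mD).
    - exact: measurable_funM mff (mnorm (mtr _ (e_gt0 n))).
    - exact: measurable_funD mfe2 mfe.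
    - by move=> x; rewrite mulr_ge0.
    move=> x _; rewrite [2^-1 ^+ n * _]mulrC -mulrDr ler_wpM2l//.
    have := approx (2^-1 ^+ n) x (e_gt0 n); have := ler_normD (soft_trunc k (2^-1 ^+ n) (U x) - excess k x) (excess k x).
    rewrite subrK (ger0_norm (excess_ge0 k x)) => h1 h2.
    by apply: le_trans h1 _; rewrite lerD2r.
  rewrite (ge0_integralD_EFin _ mD mfe2 mfe); last 2 first.
  - by move=> x; rewrite mulr_ge0// ltW.
  - by move=> x; rewrite mulr_ge0.
  rewrite EFinD; apply: leeD; last exact: int_f_excess.
  rewrite (ge0_integralZ_EFin _ mD mff (ltW (e_gt0 n)) (fun=> normr_ge0 _)) FE -EFinM lee_fin.
  rewrite exprVn mulrC ler_pdivrMr ?exprn_gt0//.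
  have h2 : (F + 1) / eps <= 2 ^+ n.
    by apply: le_trans hn0 _; rewrite ler_eXn2l// ltr1n.
  move: h2; rewrite ler_pdivrMr// mulrC => h2; apply: le_trans h2.
  by rewrite lerDl.
have qp0 : 0 < q / p by rewrite divr_gt0.
have := le_of_add_eps S0 j0 qp0 ltr01 key.
by rewrite -WE// lee_fin mul1r.
Qed.

(** The exponent of the recurrence between areas of level sets; it exceeds 1
    because [mc * p < q]. *)
Let gamma := (q / mc - 1) / (p - 1).
Let K := S `^ (p / (p - 1)) * (2 * Phi) `^ (q / (p - 1)).

Let pm0 : 0 < p - 1. Proof. by rewrite subr_gt0. Qed.

Let gamma1 : 1 < gamma.
Proof.
by rewrite /gamma ltr_pdivlMr// mul1r ltrD2r ltr_pdivlMr// mulrC.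
Qed.

Let excess_area k : 0 <= k -> W k <= K * area k `^ gamma.
Proof.
move=> k0; have s0 : 0 < mc^-1 - q^-1 by rewrite subr_gt0 ltf_pV2 ?posrE.
set Z := S * (2 * Phi) `^ (q / p) * area k `^ ((mc^-1 - q^-1) * (q / p)).
have Z0 : 0 <= Z by rewrite mulr_ge0 ?powR_ge0// mulr_ge0 ?powR_ge0.
have h : W k <= Z * W k `^ p^-1.
  apply: le_trans (excess_bound k0) _.
  rewrite mulrA powRM ?mulr_ge0 ?powR_ge0// [X in _ * (_ * X)]powRM ?powR_ge0//.
  rewrite -!powRrM (_ : q^-1 * (q / p) = p^-1); last by field; rewrite !gt_eqF.
  by rewrite le_eqVlt; apply/orP; left; apply/eqP; rewrite /Z; ring.
apply: le_trans (powR_absorb (W0 k) Z0 p1 h) _.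
rewrite /Z [(_ * _ * _) `^ _]powRM ?mulr_ge0 ?powR_ge0// [(S * _) `^ _]powRM ?powR_ge0// -!powRrM /K.
rewrite (_ : q / p * (p / (p - 1)) = q / (p - 1)); last by field; rewrite !gt_eqF.
rewrite (_ : _ * (q / p) * (p / (p - 1)) = gamma)//.
have aux c : 0 < c -> (c^-1 - q^-1) * (q / p) * (p / (p - 1)) = (q / c - 1) / (p - 1).
  by move=> c0; field; rewrite !gt_eqF.
exact: aux.
Qed.

Let chebyshev k l : 0 <= k -> k < l -> (l - k) `^ q * area l <= W k.
Proof.
move=> k0 kl; have lk0 : 0 <= (l - k) `^ q by exact: powR_ge0.
rewrite -lee_fin WE// EFinM /area fineK//.
rewrite -[level l](_ : level l `&` D = level l); last first.
  by apply/setIidPl; exact: subIsetl.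
rewrite -integral_indic// -(ge0_integralZ_EFin mu mD (measurable_indic_level l) lk0 (fun x => ler0n _ _)).
apply: (ge0_le_integral_EFin _ mD).
- exact: measurable_funM (measurable_cst _) (measurable_indic_level l).
- exact: mpow.
- by move=> x; rewrite mulr_ge0.
move=> x _; rewrite indicE; have [|_] := boolP (x \in level l); last first.
  by rewrite mulr0 powR_ge0.
rewrite inE => -[_ /= lU]; rewrite mulr1; apply: ge0_ler_powR.
- exact: ltW.
- by rewrite nnegrE subr_ge0 ltW.
- by rewrite nnegrE.
- by rewrite /excess le_max lerD2r (ltW lU) orbT.
Qed.

(** Stampacchia's condition solved for the level, [fine (mu D) + 1] being a positive
    upper bound of all areas. *)
Definition level_constant : R :=
  S `^ (p / (p - 1) / q) * 2 `^ (p - 1)^-1 *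
  (2 `^ (q + q / (gamma - 1)) * (fine (mu D) + 1) `^ (gamma - 1)) `^ q^-1.

(** Chebyshev's inequality and [excess_area] give the recurrence of Stampacchia's
    lemma for the areas of the level sets of [U]. *)
Lemma ae_le_level_constant b : 0 < b ->
  level_constant * fine (\int[mu]_(x in D) (`|f x| `^ m)%:E) `^ m^-1 `^ (p - 1)^-1 <= b ->
  {ae mu, forall x, D x -> U x <= b}.
Proof.
rewrite -/Phi => b0 hb.
have V0 : 0 < fine (mu D) + 1 by rewrite ltr_wpDl.
have Cq : K * (2 `^ (q + q / (gamma - 1)) * (fine (mu D) + 1) `^ (gamma - 1)) <= b `^ q.
  have cP0 : 0 <= level_constant * Phi `^ (p - 1)^-1.
    by rewrite mulr_ge0 ?powR_ge0// mulr_ge0 ?powR_ge0// mulr_ge0 ?powR_ge0.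
  apply: (@le_trans _ _ ((level_constant * Phi `^ (p - 1)^-1) `^ q)); last first.
    by apply: ge0_ler_powR; rewrite ?nnegrE ?(ltW q0) ?(ltW b0).
  rewrite le_eqVlt; apply/orP; left; apply/eqP.
  by apply: level_constant_powR => //; rewrite mulr_ge0 ?powR_ge0.
have A0 : area b = 0.
  apply: (stampacchia area0 _ q0 gamma1 V0 _ b0 _ Cq).
  - move=> k l kl; apply: fine_le => //; apply: le_measure; rewrite ?inE//.
    by move=> x [Dx /= lx]; split=> //=; exact: le_lt_trans lx.
  - apply: (@le_trans _ _ (fine (mu D))); last by rewrite lerDl.
    apply: fine_le => //; apply: le_measure; rewrite ?inE//; exact: subIsetl.
  move=> k l k0 kl; exact: le_trans (chebyshev k0 kl) (excess_area k0).
exists (level b); split; first exact: measurable_level.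
  by rewrite -[LHS](fineK (area_fin b)) -/(area b) A0.
move=> x /= h; split; first by apply: contrapT => nD; apply: h => /nD.
by rewrite /= ltNge; apply/negP => Ub; apply: h.
Qed.

End level_sets.

(** * The bound for weak solutions *)

(** Between [m / (m - 1) * p] and the Sobolev exponent [p * Q / (Q - p)] there is
    room for [q] exactly because [Q / p < m]: in terms of [q^-1], the two ends
    are [p^-1 - (m * p)^-1] and [p^-1 - Q^-1]. *)
Lemma intermediate_exponent (R : realType) (p m Q : R) :
  1 < p -> p < Q -> Q / p < m ->
  exists q, [/\ p < q, Q * (p^-1 - q^-1) < 1 & m / (m - 1) * p < q].
Proof.
move=> p1 pQ Qm; have p0 : 0 < p by exact: lt_trans p1.
have Q0 : 0 < Q by exact: lt_trans pQ.
have m1 : 1 < m by apply: lt_trans Qm; rewrite ltr_pdivlMr// mul1r.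
have m0 : 0 < m by exact: lt_trans m1.
have mm0 : 0 < m - 1 by rewrite subr_gt0.
pose s := (m * p)^-1.
have s0 : 0 < s by rewrite invr_gt0 mulr_gt0.
have sQ : s < Q^-1.
  by rewrite /s ltf_pV2 ?posrE ?mulr_gt0// -ltr_pdivrMr.
have Qp : Q^-1 < p^-1 by rewrite ltf_pV2 ?posrE.
(* The midpoint between the two ends, positive as [s < Q^-1 < p^-1]. *)
pose t := p^-1 - (Q^-1 + s) / 2.
have t0 : 0 < t by rewrite /t; move: sQ Qp; lra.
exists t^-1; rewrite invrK; split.
- rewrite -[ltLHS]invrK ltf_pV2 ?posrE ?invr_gt0// /t.
  by move: s0 sQ; lra.
- rewrite -ltr_pdivlMl// mulr1 /t; move: sQ; lra.
have -> : m / (m - 1) * p = (p^-1 - s)^-1.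
  by rewrite /s; field; rewrite !gt_eqF//= (_ : m - 1 = m - 1)// ?subr_gt0.
rewrite ltf_pV2 ?posrE//; first by rewrite /t; move: sQ; lra.
by move: sQ Qp; lra.
Qed.

Section weak_solution_bound.
Variables (R : realType) (N d : nat) (X : 'I_d -> 'rV[R]_N -> 'rV[R]_N).
Hypothesis lipX : forall j, locally_lipschitz (X j).
Variables (Omega : set 'rV[R]_N).
Hypothesis oO : open Omega.
Variables (p q alpha beta S : R) (h f u : 'rV[R]_N -> R) (G : 'rV[R]_N -> 'rV[R]_d).
Variable a : 'rV[R]_N -> R -> 'rV[R]_d -> 'rV[R]_d.
Hypotheses (p1 : 1 < p) (q0 : 0 < q) (alpha0 : 0 < alpha) (beta0 : 0 < beta).
Hypothesis S0 : 0 <= S.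
Hypothesis sobolev : forall phi, test_function Omega phi ->
  (\int[lebesgueN]_(x in Omega) (`|phi x| `^ q)%:E <=
   S%:E * (\int[lebesgueN]_(x in Omega) (enorm (Xgrad X phi x) `^ p)%:E) `^ (q / p))%E.
Hypothesis Lh : Lspace_on Omega (p / (p - 1))%:E h.
Hypothesis aP : structure_conditions Omega p alpha beta h a.
Hypothesis mf : measurable_fun Omega f.
Hypothesis uG : W0_gradient Omega X p u G.
Hypothesis weak : forall v H, W0_gradient Omega X p v H ->
  Rintegral lebesgueN Omega (fun x => dotv (a x (u x) (G x)) (H x)) =
  Rintegral lebesgueN Omega (fun x => f x * v x).

Let mO : measurable Omega. Proof. exact: open_measurable_rV. Qed.
Let p0 : 0 < p. Proof. exact: lt_trans p1. Qed.
Let S' := S * (2 `^ p * 2) `^ (q / p).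
Let S'0 : 0 <= S'. Proof. by rewrite mulr_ge0 ?powR_ge0. Qed.

Definition sobolev_constant : R := S' * alpha^-1 `^ (q / p).

Lemma weak_solution_integrable :
  (\int[lebesgueN]_(x in Omega) (`|u x| `^ q)%:E < +oo)%E.
Proof.
apply: le_lt_trans (W0_sobolev lipX oO p1 S0 q0 sobolev uG) _.
apply: lte_mul_pinfty; rewrite ?lee_fin//.
by rewrite poweR_lty//; exact: W0_energy_lty uG.
Qed.

(** Sobolev's inequality for a truncation of the solution, whose energy is bounded by
    testing the equation with that very truncation. *)
Lemma truncation_bound c k e : c = 1 \/ c = -1 -> 0 < e ->
  (\int[lebesgueN]_(x in Omega) (`|soft_trunc k e (c * u x)| `^ q)%:E <=
   sobolev_constant%:E * (\int[lebesgueN]_(x in Omega)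
     (`|f x| * `|soft_trunc k e (c * u x)|)%:E) `^ (q / p))%E.
Proof.
move=> c1 e0.
have cuG : W0_gradient Omega X p (fun x => c * u x) (fun x => c *: G x).
  exact: (W0_gradient_sign p1 uG c1).
have tG := W0_soft_trunc lipX oO p1 k e0 cuG.
apply: le_trans (W0_sobolev lipX oO p1 S0 q0 sobolev tG) _.
rewrite -/S' /sobolev_constant [(S' * _)%:E]EFinM -[leRHS]muleA; apply: lee_wpmul2l; first by rewrite lee_fin.
rewrite -poweR_EFin -poweRM.
- apply: gt0_ler_poweR.
  + by rewrite divr_ge0// ltW.
  + rewrite in_itv/= leey andbT; apply: integral_ge0 => x _.
    by rewrite lee_fin powR_ge0.
  + rewrite in_itv/= leey andbT; apply: mule_ge0.
      by rewrite lee_fin invr_ge0 ltW.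
    by apply: integral_ge0 => x _; rewrite lee_fin mulr_ge0.
  have energy := energy_inequality lipX oO p1 alpha0 beta0 Lh aP mf uG weak k c1 e0.
  have an0 : alpha != 0 by rewrite gt_eqF.
  apply: (@le_trans _ _ (\int[lebesgueN]_(x in Omega)
      (soft_step k e (c * u x) * enorm (G x) `^ p)%:E)%E); last first.
    rewrite -[leLHS]mul1e -(mulVf an0) EFinM -muleA; apply: lee_wpmul2l; last exact: energy.
    by rewrite lee_fin invr_ge0 ltW.
  have mstep : measurable_fun Omega (soft_step k e \o (fun x => c * u x)).
    apply: measurable_soft_step e0 _ _.
    exact: W0_measurable cuG.
  have mG : measurable_fun Omega (fun x => enorm (G x)).
    by apply: measurable_enorm => j; exact: W0_gradient_measurable uG.
  have mtG : measurable_fun Omega (fun x => enorm (soft_step k e (c * u x) *: (c *: G x))).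
    by apply: measurable_enorm => j; exact: (W0_gradient_measurable j tG).
  apply: (ge0_le_integral_EFin _ mO).
  + exact: (measurableT_comp (measurable_powR _) mtG).
  + exact: (measurable_funM mstep (measurableT_comp (measurable_powR _) mG)).
  + by move=> x; exact: powR_ge0.
  move=> x _; have /andP[t0 t1] := soft_step_bounds k e0 (c * u x).
  have c1' : `|c| = 1 by case: c1 => ->; rewrite ?normrN normr1.
  rewrite !enormZ c1' mul1r (ger0_norm t0) powRM ?enorm_ge0//.
  apply: ler_wpM2r; first exact: powR_ge0.
  (* A factor between 0 and 1 only decreases when raised to a power [p > 1]. *)
  have [->|tn0] := eqVneq (soft_step k e (c * u x)) 0; first by rewrite powR0// gt_eqF.
  by rewrite -[leRHS](powRr1 t0); apply: ger_powR; [rewrite lt_def tn0 t0 | exact: ltW].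
- by rewrite lee_fin invr_ge0 ltW.
- by apply: integral_ge0 => x _; rewrite lee_fin mulr_ge0.
Qed.

End weak_solution_bound.

Lemma Lnorm_on_pinfty_le (R : realType) (N : nat) (Omega : set 'rV[R]_N)
    (u : 'rV[R]_N -> R) (b : R) : 0 <= b ->
  {ae (@lebesgueN R N), forall x, Omega x -> `|u x| <= b} ->
  (Lnorm_on Omega +oo u <= b%:E)%E.
Proof.
move=> b0 ub; rewrite /Lnorm_on unlock; case: ifP => _; last by rewrite lee_fin.
apply/ess_supP.
apply: (@filterS _ _ (ae_filter_ringOfSetsType lebesgueN) _ _ _ ub) => x hx.
rewrite /= lee_fin patchE; case: ifPn => [|_]; first by rewrite inE.
by rewrite -[point]/(0 : R) normr0.
Qed.

Theorem theorem4p3 (R : realType) (N d : nat)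
    (X : 'I_d -> 'rV[R]_N -> 'rV[R]_N) (Omega : set 'rV[R]_N)
    (Q p m alpha : R) :
  (2 <= N)%N -> (2 <= d)%N ->
  (forall j, locally_lipschitz (X j)) ->
  open Omega -> bounded_set Omega ->
  cc_connected X -> cc_topology X ->
  2 < Q -> doubling X Q -> poincare X ->
  1 < p -> p < Q -> Q / p < m -> 0 < alpha ->
  exists C : R,
    forall (beta : R) (h : 'rV[R]_N -> R)
      (a : 'rV[R]_N -> R -> 'rV[R]_d -> 'rV[R]_d) (f u : 'rV[R]_N -> R),
    0 < beta -> Lspace_on Omega (p / (p - 1))%:E h ->
    structure_conditions Omega p alpha beta h a ->
    Lspace_on Omega m%:E f ->
    weak_solution Omega X p a f u ->
    Lspace_on Omega +oo%E u /\
    (Lnorm_on Omega +oo%E u <=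
       C%:E * (Lnorm_on Omega m%:E f) `^ ((p - 1)^-1))%E.
Proof.
move=> N2 _ lipX oO bO conn topo _ dbl HP p1 pQ Qm alpha0.
have [q [pq Qpq mpq]] := intermediate_exponent p1 pQ Qm.
have N0 : (0 < N)%N by exact: ltnW.
have [S S0 sob] := sobolev_test_function conn topo dbl N0 lipX HP oO bO p1 pq Qpq.
have p0 : 0 < p by exact: lt_trans p1.
have q0 : 0 < q by exact: lt_trans pq.
have m1 : 1 < m by apply: lt_trans Qm; rewrite ltr_pdivlMr// mul1r.
have m0 : 0 < m by exact: lt_trans m1.
have mO : measurable Omega by exact: open_measurable_rV.
pose S1 := sobolev_constant p q alpha S.
have S10 : 0 <= S1.
  by rewrite /S1 /sobolev_constant !mulr_ge0 ?powR_ge0 ?(ltW S0).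
pose C := level_constant lebesgueN Omega p q m S1.
exists C => beta h a f u beta0 Lh aP [mf Lf] [G uG weak].
have If := (Lnorm_on_lty Omega f m0).1 Lf.
pose Phi := fine (\int[lebesgueN]_(x in Omega) (`|f x| `^ m)%:E) `^ m^-1.
have NE : Lnorm_on Omega m%:E f = Phi%:E.
  rewrite (Lnorm_onE Omega f (lt0r_neq0 m0)) -poweR_EFin fineK// ge0_fin_numE//.
  by apply: integral_ge0 => x _; rewrite lee_fin powR_ge0.
have C0 : 0 <= C * Phi `^ (p - 1)^-1.
  by rewrite mulr_ge0 ?powR_ge0// !mulr_ge0 ?powR_ge0.
have mu : measurable_fun Omega u by exact: W0_measurable uG.
have half c b : c = 1 \/ c = -1 -> 0 < b -> C * Phi `^ (p - 1)^-1 <= b ->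
    {ae lebesgueN, forall x, Omega x -> c * u x <= b}.
  move=> c1 b0 Cb.
  have mcu : measurable_fun Omega (fun x => c * u x).
    exact: (measurable_funM (measurable_cst _) mu).
  have Icu : (\int[lebesgueN]_(x in Omega) (`|c * u x| `^ q)%:E < +oo)%E.
    apply: le_lt_trans (weak_solution_integrable lipX oO p1 q0 (ltW S0) sob uG).
    rewrite le_eqVlt; apply/orP; left; apply/eqP; apply: eq_integral => x _.
    by rewrite normrM; case: c1 => ->; rewrite ?normrN normr1 mul1r.
  apply: (ae_le_level_constant mO (lebesgueN_bounded_fin bO) mcu mf p1 m1 S10 mpq If Icu _ b0 Cb).
  move=> k e _ e0.
  exact: (truncation_bound lipX oO p1 q0 alpha0 beta0 (ltW S0) sob Lh aP mf uG weak).
have bound b : 0 < b -> C * Phi `^ (p - 1)^-1 <= b -> (Lnorm_on Omega +oo u <= b%:E)%E.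
  move=> b0 Cb; apply: Lnorm_on_pinfty_le; first exact: ltW.
  have [h1 h2] := (half 1 b (or_introl erefl) b0 Cb, half (-1) b (or_intror erefl) b0 Cb).
  apply: (@filterS2 _ _ (ae_filter_ringOfSetsType lebesgueN) _ _ _ _ h1 h2) => x le1 le2 Ox.
  by rewrite ler_norml lerNl -mulN1r le2//= -[u x]mul1r le1.
(* [C * Phi `^ (p - 1)^-1] may vanish, whereas the bound was obtained at positive
   levels only. *)
have main : (Lnorm_on Omega +oo u <= (C * Phi `^ (p - 1)^-1)%:E)%E.
  apply/lee_addgt0Pr => e e0; rewrite -EFinD; apply: bound; first by rewrite ltr_wpDl.
  by rewrite lerDl ltW.
split; last by rewrite NE poweR_EFin -EFinM.
by split=> //; apply: le_lt_trans main _; rewrite ltry.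
Qed.
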